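(* Let $x\in C_6$. (a) There is a unitary element $u\in C_6$ such that $x=\{u,x,u\}$. (b) Let $u\in C_6$ be a unitary element with $x=\{u,x,u\}$. Then: (i) There are real numbers $\alpha_1,\alpha_2,\alpha_3$ and mutually orthogonal minimal tripotents $u_1,u_2,u_3$ such that $u_j\le u$ for $j=1,2,3$ and $x=\alpha_1u_1+\alpha_2u_2+\alpha_3u_3$. (ii) The representation from (i) is unique in the following sense: the triple $(\alpha_1,\alpha_2,\alpha_3)$ is uniquely determined up to reordering, and for any real number $\alpha$ the sum $\sum_{\alpha_j=\alpha}u_j$ is uniquely determined. (c) Let $u\in C_6$ be a unitary element with $x=\{u,x,u\}$, fix a representation of $x$ as in (b)(i), and set $\operatorname{dt}_ux=\alpha_1\alpha_2\alpha_3$. If $x$ is unitary, this quantity equals the quantity $\operatorname{dt}_ux$ defined in the context for pairs of unitary elements. If $x$ and $u$ belong to $H_3(\mathbb H_C)$, then $\operatorname{dt}_ux=\operatorname{dt}_{3,u}x$. (d) The quantity $$\operatorname{dt}x=\operatorname{dt}_ux\cdot\operatorname{dt}u$$ (with $\operatorname{dt}u$ the determinant of the unitary element $u$) does not depend on the particular choice of the unitary element $u\in C_6$ satisfying $x=\{u,x,u\}$. Moreover, if $x$ is unitary, this quantity coincides with the determinant $\operatorname{dt}x$ of the unitary element $x$ defined in the context. If $x\in H_3(\mathbb H_C)$, then $\operatorname{dt}x=\operatorname{dt}_3x$. (e) Jordan $*$-automorphisms of $C_6$ preserve the values of $\operatorname{dt}$.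
   Context: Cayley–Dickson algebras: $\mathcal A_0=\mathbb C$ with its usual product, $x^{\diamond}=x$, $x^*=\overline{x}$. Inductively $\mathcal A_{n+1}=\mathcal A_n\times\mathcal A_n$ with $\overline{(x_1,x_2)}=(\overline{x_1},\overline{x_2})$, $(x_1,x_2)^{\diamond}=(x_1^{\diamond},-x_2)$, $(x_1,x_2)^*=(x_1^*,-\overline{x_2})$ and $(x_1,x_2)\boxdot(y_1,y_2)=(x_1\boxdot y_1-y_2\boxdot x_2^{\diamond},\ x_1^{\diamond}\boxdot y_2+y_1\boxdot x_2)$. Biquaternions: $\mathbb H_C=\mathcal A_2$ (associative); complex octonions: $\mathbb O=\mathcal A_3$; $a\in\mathcal A_n$ is identified with $(a,0)\in\mathcal A_{n+1}$. For matrices over $\mathbb O$: $(x^\diamond)_{ij}=(x_{ji})^\diamond$, $(x^* )_{ij}=(x_{ji})^*$, and $\boxdot$ is the usual matrix product. The Cartan factor of type 6 is the JB$^*$-algebra $C_6=H_3(\mathbb O)=\{x\in M_3(\mathbb O): x^{\diamond}=x\}$ with $x\circ y=\frac12(x\boxdot y+y\boxdot x)$, involution $^*$, unit $\mathbf 1$ (unit matrix) and triple product $\{x,y,z\}=(x\circ y^* )\circ z+(z\circ y^* )\circ x-(x\circ z)\circ y^*$. A Jordan $*$-automorphism is a complex-linear bijection preserving $\circ$ and $^*$. $u$ is unitary if $\{u,u,x\}=x$ for all $x\in C_6$. A tripotent is $v$ with $\{v,v,v\}=v$; it is minimal if $\{x:\{v,v,x\}=x\}=\mathbb C v\neq\{0\}$.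 Tripotents $v,w$ are orthogonal if $\{v,v,w\}=0$; $v\le w$ means that $w-v$ is a tripotent orthogonal to $v$. Determinants of unitaries: for unitary $x,e\in C_6$ one can write $x=\alpha_1v_1+\alpha_2v_2+\alpha_3v_3$ with complex numbers $\alpha_j$ of modulus one and mutually orthogonal minimal tripotents $v_j\le e$; the triple is unique up to reordering, and $\operatorname{dt}_ex:=\alpha_1\alpha_2\alpha_3$. Further $\operatorname{dt}x:=\operatorname{dt}_{\mathbf 1}x$. Determinants over biquaternions: $H_n(\mathbb H_C)=\{x\in M_n(\mathbb H_C):x^\diamond=x\}$ (diagonal entries are then complex numbers). $(\operatorname{dt}_n)$ is the unique sequence of continuous maps $\operatorname{dt}_n:H_n(\mathbb H_C)\to\mathbb H_C$ with $\operatorname{dt}_1(x_{11})=x_{11}$ and $\operatorname{dt}_{n+1}x=x_{11}\operatorname{dt}_n(x_{ij}-x_{11}^{-1}x_{i1}x_{1j})_{2\le i,j\le n+1}$ whenever $x_{11}\ne0$; its values are complex numbers. Explicitly, $\operatorname{dt}_3x=x_{11}x_{22}x_{33}+x_{32}x_{21}x_{13}+x_{31}x_{12}x_{23}-x_{11}x_{32}x_{23}-x_{22}x_{31}x_{13}-x_{21}x_{12}x_{33}$. For a unitary $e\in H_n(\mathbb H_C)$, $\operatorname{dt}_{n,e}x:=\operatorname{dt}_n(Tx)$, where $T:M_n(\mathbb H_C)\to M_n(\mathbb H_C)$ is any $*$-isomorphism from $M_n(\mathbb H_C)$ with product $(x,y)\mapsto xe^*y$ and involution $x\mapsto ex^*e$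 onto $M_n(\mathbb H_C)$ with its standard C$^*$-algebra structure such that $T(x^\diamond)=T(x)^\diamond$ for all $x$ (such $T$ exists, for example $T(x)=v^*xv^*$ with $v\in H_n(\mathbb H_C)$ unitary, $v^2=e$, and the value does not depend on $T$). *)

(* Defs.v *)
From HB Require Import structures.
From mathcomp Require Import all_boot all_order all_algebra all_fingroup.
From mathcomp Require Import complex ring ssrAC.
From mathcomp Require Import boolp classical_sets functions reals topology.
From mathcomp Require Import normedtype.

Set Implicit Arguments.
Unset Strict Implicit.
Unset Printing Implicit Defensive.

Import Order.TTheory GRing.Theory Num.Theory numFieldNormedType.Exports.

Local Open Scope classical_set_scope.
Local Open Scope ring_scope.
Local Open Scope complex_scope.

Declare Scope cd_scope.
Delimit Scope cd_scope with CD.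
Local Open Scope cd_scope.

(* Cayley-Dickson algebras over the complex numbers [R[i]]. Products of normed
   modules carry the componentwise linear structure and the max norm; the norm
   serves only to give each (finite-dimensional) algebra its topology. *)
Fixpoint CD (R : realType) (n : nat) : normedModType R[i] :=
  if n is m.+1 then (CD R m * CD R m)%type else R[i]^o.

Fixpoint cdconj (R : realType) (n : nat) : CD R n -> CD R n :=
  if n is m.+1 then fun x => (cdconj x.1, cdconj x.2)
  else fun x : R[i] => conjc x.

Fixpoint cddia (R : realType) (n : nat) : CD R n -> CD R n :=
  if n is m.+1 then fun x => (cddia x.1, - x.2) else id.

Fixpoint cdstar (R : realType) (n : nat) : CD R n -> CD R n :=
  if n is m.+1 then fun x => (cdstar x.1, - cdconj x.2)
  else fun x : R[i] => conjc x.

Fixpoint cdmul (R : realType) (n : nat) : CD R n -> CD R n -> CD R n :=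
  if n is m.+1 then
    fun x y => (cdmul x.1 y.1 - cdmul y.2 (cddia x.2),
                cdmul (cddia x.1) y.2 + cdmul y.1 x.2)
  else fun x y : R[i] => x * y.

Infix "⊡" := cdmul (at level 40, left associativity) : cd_scope.

Definition cdincl (R : realType) (n : nat) (x : CD R n) : CD R n.+1 := (x, 0).

Fixpoint cdscal (R : realType) (n : nat) : R[i] -> CD R n :=
  if n is m.+1 return R[i] -> CD R n then fun a => cdincl (@cdscal R m a)
  else fun a => a.
Arguments cdscal {R} n a.

(* biquaternions and complex octonions *)
Notation HC R := (CD R 2).
Notation OC R := (CD R 3).

Section Matrices.
Variables (R : realType) (n m : nat).
Implicit Types x y : 'M[CD R n]_m.

Definition cdmx_scale (a : R[i]) x : 'M[CD R n]_m :=
  map_mx (fun t => a *: t) x.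

Definition cdmx_dia x : 'M[CD R n]_m := map_mx (@cddia R n) x^T.

Definition cdmx_star x : 'M[CD R n]_m := map_mx (@cdstar R n) x^T.

Definition cdmx_mul x y : 'M[CD R n]_m :=
  \matrix_(i, k) \sum_j (x i j ⊡ y j k).

Definition cdmx_one : 'M[CD R n]_m :=
  \matrix_(i, j) (if i == j then cdscal n 1 else 0).

Definition herm : set 'M[CD R n]_m := [set x | cdmx_dia x = x].

End Matrices.

Arguments cdmx_one {R n m}.
Arguments herm R n m : clear implicits.

Infix "⊠" := cdmx_mul (at level 40, left associativity) : cd_scope.
Infix "⋅" := cdmx_scale (at level 40, left associativity) : cd_scope.

(* Elements of the Cartan factor of type 6 are represented as 3 x 3 octonion
   matrices lying in [C6]; all quantifiers are relativized to this set. *)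
Definition C6 (R : realType) : set 'M[OC R]_3 := herm R 3 3.
Arguments C6 : clear implicits.

Section CartanFactor.
Variable R : realType.
Local Notation M := 'M[OC R]_3.
Implicit Types x y z u v w e : M.

Definition jmul x y : M := 2^-1 ⋅ (x ⊠ y + y ⊠ x).

Definition triple x y z : M :=
  jmul (jmul x (cdmx_star y)) z + jmul (jmul z (cdmx_star y)) x
  - jmul (jmul x z) (cdmx_star y).

Definition jordan_star_aut (phi : M -> M) : Prop :=
  [/\ set_bij (C6 R) (C6 R) phi,
      forall a x y, C6 R x -> C6 R y -> phi (a ⋅ x + y) = a ⋅ phi x + phi y,
      forall x y, C6 R x -> C6 R y -> phi (jmul x y) = jmul (phi x) (phi y) &
      forall x, C6 R x -> phi (cdmx_star x) = cdmx_star (phi x)].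

Definition unitary u : Prop :=
  C6 R u /\ forall x, C6 R x -> triple u u x = x.

Definition tripotent v : Prop := C6 R v /\ triple v v v = v.

Definition minimal_tripotent v : Prop :=
  [/\ tripotent v,
      [set x | C6 R x /\ triple v v x = x] = range (fun a => a ⋅ v) &
      range (fun a => a ⋅ v) <> [set 0]].

Definition orthogonal v w : Prop := triple v v w = 0.

Definition tripotent_le v w : Prop :=
  tripotent (w - v) /\ orthogonal (w - v) v.

Definition frame_below e (v : 'I_3 -> M) : Prop :=
  [/\ forall j, minimal_tripotent (v j),
      forall j k, j != k -> orthogonal (v j) (v k) &
      forall j, tripotent_le (v j) e].

Definition unitary_rep e x (alpha : 'I_3 -> R[i]) (v : 'I_3 -> M) : Prop :=
  [/\ forall j, `|alpha j| = 1, frame_below e v & x = \sum_j alpha j ⋅ v j].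

Definition real_rep u x (alpha : 'I_3 -> R) (v : 'I_3 -> M) : Prop :=
  frame_below u v /\ x = \sum_j (alpha j)%:C ⋅ v j.

(* The determinants below are single-valued, so that [xget] selects the value
   common to all representations; 0 is a junk value for the case that there is
   no representation. [dtU e x] is the determinant of a unitary [x] with
   respect to a unitary [e], [dtR u x] the one of an arbitrary [x] in [C6] with
   respect to a unitary [u] such that x = {u,x,u}, and [dt x] the determinant
   of an arbitrary [x] in [C6]. *)
Definition dtU e x : R[i] :=
  xget 0 [set d | exists alpha (v : 'I_3 -> M),
            unitary_rep e x alpha v /\ d = \prod_j alpha j].

Definition dtR u x : R[i] :=
  xget 0 [set d | exists alpha (v : 'I_3 -> M),
            real_rep u x alpha v /\ d = \prod_j (alpha j)%:C].

Definition dt x : R[i] :=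
  xget 0 [set d | exists u, [/\ unitary u, x = triple u x u &
            d = dtR u x * dtU cdmx_one u]].

End CartanFactor.

Section BiquaternionDeterminant.
Variable R : realType.

(* The defining property of the sequence of determinants on the spaces
   H_n(HC), n >= 1; [D n] is [dt_{n.+1}], regarded as a function on all matrices
   of which only the restriction to hermitian matrices matters. *)
Definition dt_sequence (D : forall n, 'M[HC R]_n.+1 -> HC R) : Prop :=
  [/\ forall n, {within herm R 2 n.+1, continuous (D n)},
      forall x, herm R 2 1 x -> D 0 x = x 0 0 &
      forall n x (a : R[i]), herm R 2 n.+2 x -> x 0 0 = cdscal 2 a -> a != 0 ->
        D n.+1 x =
        x 0 0 ⊡ D n (\matrix_(i, j) (x (lift 0 i) (lift 0 j)
                                - a^-1 *: (x (lift 0 i) 0 ⊡ x 0 (lift 0 j))))].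

(* The explicit formula for the third term of that sequence, with the indices
   shifted by 1; see [dt_sequence_dt3] below. *)
Definition dt3 (x : 'M[HC R]_3) : HC R :=
  x 0 0 ⊡ x 1 1 ⊡ x 2 2 + x 2 1 ⊡ x 1 0 ⊡ x 0 2 + x 2 0 ⊡ x 0 1 ⊡ x 1 2
  - x 0 0 ⊡ x 2 1 ⊡ x 1 2 - x 1 1 ⊡ x 2 0 ⊡ x 0 2 - x 1 0 ⊡ x 0 1 ⊡ x 2 2.

(* [T] is a *-isomorphism from M_3(HC) with product x e^* y and involution
   e x^* e onto M_3(HC) with its standard structure, commuting with the
   diamond operation. *)
Definition isotope_iso (e : 'M[HC R]_3) (T : 'M[HC R]_3 -> 'M[HC R]_3) : Prop :=
  [/\ bijective T,
      forall a x y, T (a ⋅ x + y) = a ⋅ T x + T y,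
      forall x y, T (x ⊠ cdmx_star e ⊠ y) = T x ⊠ T y,
      forall x, T (e ⊠ cdmx_star x ⊠ e) = cdmx_star (T x) &
      forall x, T (cdmx_dia x) = cdmx_dia (T x)].

Definition is_dt3e (e x : 'M[HC R]_3) (d : HC R) : Prop :=
  (exists T, isotope_iso e T) /\ forall T, isotope_iso e T -> dt3 (T x) = d.

Definition inclO : 'M[HC R]_3 -> 'M[OC R]_3 := map_mx (@cdincl R 2).

End BiquaternionDeterminant.

Section DtSequence.
Variable R : realType.

Let coord (m : nat) (x : 'M[HC R]_m) : herm R 2 m x ->
  forall i j, x i j = cddia (x j i).
Proof. by move=> hx i j; rewrite -[in LHS]hx !mxE. Qed.

Let diag (m : nat) (x : 'M[HC R]_m) : herm R 2 m x ->
  forall i, exists a, x i i = cdscal 2 a.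
Proof.
have opp0 (a : R[i]) : a = - a -> a = 0.
  by move=> /eqP; rewrite -addr_eq0 -mulr2n mulrn_eq0 => /eqP.
move=> hx i; have := coord hx i i; case: (x i i) => [[p q] [r s]] /= [Eq Er Es].
by exists p; rewrite (opp0 q) // (opp0 r) // (opp0 s).
Qed.

(* adding [t] to the upper left entry *)
Let shift (m : nat) (x : 'M[HC R]_m.+1) (t : R[i]) : 'M[HC R]_m.+1 :=
  \matrix_(i, j) (x i j + (if (i == 0) && (j == 0) then cdscal 2 t else 0)).

Let cdscalE (t : R[i]) : cdscal 2 t = t *: (cdscal 2 1 : HC R).
Proof.
by congr (_, _); [congr (_, _)|congr (_, _)]; rewrite /= ?scaler0 // [RHS]mulr1.
Qed.

Let shift_herm (m : nat) (x : 'M[HC R]_m.+1) t :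
  herm R 2 m.+1 x -> herm R 2 m.+1 (shift x t).
Proof.
move=> hx; apply/matrixP=> i j; rewrite !mxE (coord hx i j) andbC.
case: (x j i) => [[p q] [r s]]; case: ifP => _ /=;
  by congr (_, _); [congr (_, _)|congr (_, _)] => /=; rewrite ?opprD ?oppr0 ?addr0.
Qed.

Let affine_cvg (v w : HC R) :
  v + (t : R[i]) *: w @[t --> (0 : R[i]^o)^'] --> v.
Proof.
have H : (t : R[i]^o) @[t --> (0 : R[i]^o)^'] --> (0 : R[i]^o).
  exact: cvg_within.
have := cvgD (cvg_cst v) (cvgZr_tmp (a := w) H); rewrite scale0r addr0. by apply.
Qed.

Let shift_cvg (m : nat) (x : 'M[HC R]_m.+1) :
  shift x t @[t --> (0 : R[i]^o)^'] --> x.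
Proof.
apply/cvg_ballP => e e0.
have H i j : \forall t \near (0 : R[i]^o)^', ball (x i j) e (shift x t i j).
  have : shift x t i j @[t --> (0 : R[i]^o)^'] --> x i j.
    have -> : (fun t => shift x t i j) = (fun t => x i j
        + (if (i == 0) && (j == 0) then t else 0) *: (cdscal 2 1 : HC R)).
      by apply/funext => t; rewrite mxE; case: ifP; rewrite ?scale0r // cdscalE.
    case: (_ && _); first exact: affine_cvg.
    by under eq_fun do rewrite scale0r addr0; exact: cvg_cst.
  by move/cvg_ballP; apply.
have : \forall t \near (0 : R[i]^o)^', forall i j, ball (x i j) e (shift x t i j).
  by apply: filter_forall => i; apply: filter_forall => j; exact: H.
by apply: filterS => t Ht; split.
Qed.

Let ext (m : nat) (F G : 'M[HC R]_m.+1 -> HC R) :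
    {within herm R 2 m.+1, continuous F} ->
    (forall x a, herm R 2 m.+1 x -> x 0 0 = cdscal 2 a -> a != 0 -> F x = G x) ->
    (forall x, exists v, forall t, G (shift x t) = G x + t *: v) ->
  forall x, herm R 2 m.+1 x -> F x = G x.
Proof.
move=> /subspace_continuousP cF FG Gaff x hx.
have [a xa] := diag hx 0; have [a0|/(FG _ _ hx xa)//] := eqVneq a 0.
have [v Gv] := Gaff x.
have FGnear : \forall t \near (0 : R[i]^o)^', F (shift x t) = G x + t *: v.
  near=> t.
  rewrite -Gv; apply: (FG _ t); first exact: shift_herm.
    by rewrite mxE !eqxx xa a0 /= -[RHS]add0r; congr (_ + _).
  by near: t; exact: withinT.
have cG : F (shift x t) @[t --> (0 : R[i]^o)^'] --> G x.
  have cA : G x + (t : R[i]) *: v @[t --> (0 : R[i]^o)^'] --> G x.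
    exact: affine_cvg.
  apply: (cvg_trans _ cA); apply: near_eq_cvg.
  by apply: filterS FGnear => t ->.
have cF' : F (shift x t) @[t --> (0 : R[i]^o)^'] --> F x.
  apply: cvg_comp (cF x hx) => P PA.
  have : \forall t \near (0 : R[i]^o)^', herm R 2 m.+1 (shift x t) -> P (shift x t).
    exact: (shift_cvg (x := x) PA).
  by apply: filterS => t; apply; exact: shift_herm.
exact: (cvg_unique _ cF' cG).
Unshelve. all: by end_near. Qed.

Let dt2 (x : 'M[HC R]_2) : HC R := x 0 0 ⊡ x 1 1 - x 1 0 ⊡ x 0 1.

Let eqHC (p q r s p' q' r' s' : R[i]) : p = p' -> q = q' -> r = r' -> s = s' ->
  ((p, q), (r, s)) = ((p', q'), (r', s')) :> HC R.
Proof. by move=> -> -> -> ->. Qed.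

Let cdmulDl (x y z : HC R) : (x + y) ⊡ z = x ⊡ z + y ⊡ z.
Proof.
move: x y z; do 3! case => [[? ?] [? ?]].
by apply: eqHC => /=; ring.
Qed.

Let cdscalM t (x : HC R) : cdscal 2 t ⊡ x = t *: x.
Proof.
by case: x => [[? ?] [? ?]]; apply: eqHC => /=; rewrite -?[_ *: _]/(_ * _); ring.
Qed.

Let cdmulZl t (x y : HC R) : (t *: x) ⊡ y = t *: (x ⊡ y).
Proof.
move: x y; do 2! case => [[? ?] [? ?]].
by apply: eqHC => /=; rewrite -?[_ *: _]/(_ * _); ring.
Qed.

Let shift00 m (x : 'M[HC R]_m.+1) t : shift x t 0 0 = x 0 0 + cdscal 2 t.
Proof. by rewrite mxE !eqxx. Qed.

Let shiftN m (x : 'M[HC R]_m.+1) t i j : ~~ ((i == 0) && (j == 0)) ->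
  shift x t i j = x i j.
Proof. by move=> /negPf nij; rewrite mxE nij addr0. Qed.

Let dt2_shift (x : 'M[HC R]_2) t : dt2 (shift x t) = dt2 x + t *: x 1 1.
Proof.
rewrite /dt2 shift00; do 3! (rewrite shiftN; last by []).
move: (x 0 0) (x 0 1) (x 1 0) (x 1 1) => a b c d.
by rewrite (cdmulDl a) (cdscalM t d); exact: addrAC.
Qed.

Let dt3_shift (x : 'M[HC R]_3) t :
  dt3 (shift x t) = dt3 x + t *: (x 1 1 ⊡ x 2 2 - x 2 1 ⊡ x 1 2).
Proof.
rewrite /dt3 shift00; do 8! (rewrite shiftN; last by []).
move: (x 0 0) (x 0 1) (x 0 2) (x 1 0) (x 1 1) (x 1 2) (x 2 0) (x 2 1) (x 2 2).
move=> a b c d e f g h i.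
have E y z : (a + cdscal 2 t) ⊡ y ⊡ z = a ⊡ y ⊡ z + t *: (y ⊡ z).
  by rewrite (cdmulDl a) (cdscalM t y) (cdmulDl (a ⊡ y)) (cdmulZl t y).
rewrite (E e i) (E h f) scalerBr opprD {E}.
move: (a ⊡ e ⊡ i) (h ⊡ d ⊡ c) (g ⊡ b ⊡ f) (a ⊡ h ⊡ f) (e ⊡ g ⊡ c).
move: (d ⊡ b ⊡ i) (t *: (e ⊡ i)) (t *: (h ⊡ f)) => s1 s2 s3 s4 s5 s6 s7 s8.
by rewrite !addrA; rewrite [LHS](ACl (1*3*4*5*7*8*2*6)%AC).
Qed.

Let lift01 : lift (0 : 'I_2) (0 : 'I_1) = 1. Proof. exact: val_inj. Qed.
Let lift02 : lift (0 : 'I_3) (0 : 'I_2) = 1. Proof. exact: val_inj. Qed.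
Let lift12 : lift (0 : 'I_3) (1 : 'I_2) = 2. Proof. exact: val_inj. Qed.

Let schur_herm n (x : 'M[HC R]_n.+2) (a : R[i]) : herm R 2 n.+2 x ->
  herm R 2 n.+1 (\matrix_(i, j) (x (lift 0 i) (lift 0 j)
                          - a *: (x (lift 0 i) 0 ⊡ x 0 (lift 0 j)))).
Proof.
move=> hx; apply/matrixP => i j; rewrite !mxE.
rewrite (coord hx (lift 0 i) (lift 0 j)) (coord hx (lift 0 i) 0).
rewrite (coord hx (lift 0 j) 0).
move: (x _ _) (x _ _) (x _ _).
do 3! case => [[? ?] [? ?]].
by apply: eqHC => /=; rewrite -?[_ *: _]/(_ * _); ring.
Qed.

Lemma dt_sequence_dt3 D x : dt_sequence D -> herm R 2 3 x -> D 2 x = dt3 x.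
Proof.
move=> [Dc D0 DS].
have D1 y : herm R 2 2 y -> D 1 y = dt2 y.
  apply: ext => // [{}y a hy ya a0|{}y]; last by exists (y 1 1) => t; exact: dt2_shift.
  rewrite (DS _ _ a) // D0; last exact: schur_herm.
  rewrite /dt2 !mxE !lift01 ya.
  move: (y 0 1) (y 1 0) (y 1 1); do 3! case => [[? ?] [? ?]].
  by apply: eqHC => /=; rewrite -?[_ *: _]/(_ * _); field.
move: x; apply: ext => // [y a hy ya a0|y]; last by eexists => t; exact: dt3_shift.
rewrite (DS _ _ a) // D1; last exact: schur_herm.
rewrite /dt2 /dt3 !mxE !lift02 !lift12 ya.
have [b yb] := diag hy 1; have [c yc] := diag hy 2; rewrite {}yb {}yc.
rewrite (coord hy 1 0) (coord hy 2 0) (coord hy 2 1).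
move: (y 0 1) (y 0 2) (y 1 2); do 3! case => [[? ?] [? ?]].
by apply: eqHC => /=; rewrite -?[_ *: _]/(_ * _); field.
Qed.

End DtSequence.

(* Main.v *)
(** Elements of [C6] are identified with the Albert algebra over the complex
    numbers, with its trace form, its cubic norm and its cross product. The
    linear bijections that preserve the hermitian form and, up to a factor of
    modulus one, the norm are automorphisms of the Jordan triple. By Jacobi
    rotations they diagonalise self-adjoint elements, they act transitively on
    the unitaries, and those fixing the unit act transitively on the frames below
    the unit. Hence an element with spectral values [a_j] relative to a unitary
    [u] has norm [a_1 a_2 a_3 N(u)], so that all the determinants are quotients
    of norms and [dt x = N(x)]. A unitary [u] with [x = {u,x,u}] is obtained by
    maximising [Re <x,u>] over the compact set of unitaries. For biquaternionic
    matrices, Newton's identities express [N(x) / N(u)] through the traces of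
    the powers of [x u^*], and every isotope isomorphism preserves these traces
    because the trace functional of the matrix algebra is unique. *)

From HB Require Import structures.
From mathcomp Require Import all_boot all_order all_algebra all_fingroup.
From mathcomp Require Import complex ring lra ssrAC.
From mathcomp Require Import boolp classical_sets functions reals topology.
From mathcomp Require Import normedtype derive.
Require Import Defs.

Set Implicit Arguments.
Unset Strict Implicit.
Unset Printing Implicit Defensive.

Import Order.TTheory GRing.Theory Num.Theory numFieldNormedType.Exports.
Local Open Scope ring_scope.

(** * Octonions over a commutative ring *)

(** Octonion matrices do not associate, so functional calculus by matrix powers and conjugation by
    octonion matrices are not at hand. What replaces them is a pair of numerical invariants:
    polarising the norm against the form yields the cross product, and form and cross product
    together yield the triple product, so a linear map has to be tested on these two invariants
    only. Unitaries, tripotents, frames and spectral representations are all phrased through the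
    triple product and travel along such maps; this reduces a question about an arbitrary unitary to
    the unit, where [x = {u,x,u}] becomes invariance under the conjugation. The complex form has
    isotropic vectors, but on conjugation-invariant octonions it is a sum of real squares, and this
    is what makes entries vanish. Diagonalisation needs no limit process: a real root of the
    characteristic cubic splits off one direction and leaves a 2 by 2 block. Isotope isomorphisms
    are arbitrary algebra maps that are not known in advance to scale the norm, which is why traces
    of powers take its place there. *)

Record octonion (K : Type) := O8 {o0 : K; o1 : K; o2 : K; o3 : K;
                                  o4 : K; o5 : K; o6 : K; o7 : K}.

(* Operations are locked to keep unification from unfolding them. *)
Fact oct_key : unit. Proof. exact: tt. Qed.

Lemma O8_eq K (a b c d e f g h a' b' c' d' e' f' g' h' : K) :
  a = a' -> b = b' -> c = c' -> d = d' -> e = e' -> f = f' -> g = g' -> h = h' ->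
  O8 a b c d e f g h = O8 a' b' c' d' e' f' g' h'.
Proof. by do 8! move=> ->. Qed.

Lemma oct_case K (P : octonion K -> Prop) :
  (forall a b c d e f g h : K, P (O8 a b c d e f g h)) -> forall x, P x.
Proof. by move=> H [a b c d e f g h]. Qed.

Section OctonionModule.
Variable K : comNzRingType.
Local Notation oct := (octonion K).
Implicit Types x y z : oct.

HB.instance Definition _ := gen_eqMixin oct.
HB.instance Definition _ := gen_choiceMixin oct.

Definition oadd x y := O8 (o0 x + o0 y) (o1 x + o1 y) (o2 x + o2 y) (o3 x + o3 y)
  (o4 x + o4 y) (o5 x + o5 y) (o6 x + o6 y) (o7 x + o7 y).
Definition oopp x := O8 (- o0 x) (- o1 x) (- o2 x) (- o3 x) (- o4 x) (- o5 x) (- o6 x) (- o7 x).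
Definition oscale k x := O8 (k * o0 x) (k * o1 x) (k * o2 x) (k * o3 x)
  (k * o4 x) (k * o5 x) (k * o6 x) (k * o7 x).

Fact oaddA : associative oadd.
Proof. by move=> x y z; apply: O8_eq; exact: addrA. Qed.
Fact oaddC : commutative oadd.
Proof. by move=> x y; apply: O8_eq; exact: addrC. Qed.
Fact oadd0 : left_id (O8 0 0 0 0 0 0 0 0) oadd.
Proof. by case=> *; apply: O8_eq; exact: add0r. Qed.
Fact oaddN : left_inverse (O8 0 0 0 0 0 0 0 0) oopp oadd.
Proof. by case=> *; apply: O8_eq; exact: addNr. Qed.
HB.instance Definition _ := GRing.isZmodule.Build oct oaddA oaddC oadd0 oaddN.

Fact oscaleA a b x : oscale a (oscale b x) = oscale (a * b) x.
Proof. by apply: O8_eq; exact: mulrA. Qed.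
Fact oscale1 : left_id 1 oscale.
Proof. by case=> *; apply: O8_eq; exact: mul1r. Qed.
Fact oscaleDr : right_distributive oscale +%R.
Proof. by move=> k x y; apply: O8_eq; exact: mulrDr. Qed.
Fact oscaleDl x : {morph oscale^~ x : a b / a + b}.
Proof. by move=> a b; apply: O8_eq; exact: mulrDl. Qed.
HB.instance Definition _ := GRing.Zmodule_isLmodule.Build K oct
  oscaleA oscale1 oscaleDr oscaleDl.

End OctonionModule.

Section OctonionOperations.
Variable K : comNzRingType.
Local Notation oct := (octonion K).

(* The product of the Cayley-Dickson algebra of dimension 8, with coordinates
   ordered as (((0, 1), (2, 3)), ((4, 5), (6, 7))). *)
Definition omul := locked_with oct_key (fun X Y : oct =>
  let: O8 a b c d e f g h := X in let: O8 a' b' c' d' e' f' g' h' := Y in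
  O8
    (a * a' - b * b' - c * c' - d * d' - e * e' - f * f' - g * g' - h * h')
    (a * b' + b * a' + d * c' + f * e' + g * h' - c * d' - e * f' - h * g')
    (a * c' + b * d' + c * a' + g * e' + h * f' - d * b' - e * g' - f * h')
    (a * d' + c * b' + d * a' + f * g' + h * e' - b * c' - e * h' - g * f')
    (a * e' + b * f' + c * g' + d * h' + e * a' - f * b' - g * c' - h * d')
    (a * f' + c * h' + e * b' + f * a' + g * d' - b * e' - d * g' - h * c')
    (a * g' + d * f' + e * c' + g * a' + h * b' - b * h' - c * e' - f * d')
    (a * h' + b * g' + e * d' + f * c' + h * a' - c * f' - d * e' - g * b')).

Definition odia := locked_with oct_key (fun X : oct =>
  let: O8 a b c d e f g h := X in
  O8 a (- b) (- c) (- d) (- e) (- f) (- g) (- h)).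

(** The complex bilinear form that polarises [omul x (odia x)]; it is not hermitian, and over [R[i]]
    it has isotropic vectors. *)
Definition odot := locked_with oct_key (fun X Y : oct =>
  let: O8 a b c d e f g h := X in let: O8 a' b' c' d' e' f' g' h' := Y in
  a * a' + b * b' + c * c' + d * d' + e * e' + f * f' + g * g' + h * h').

Definition oscal (a : K) : oct := locked_with oct_key (O8 a 0 0 0 0 0 0 0).

Variables a b c d e f g h a' b' c' d' e' f' g' h' k : K.
Local Notation X := (O8 a b c d e f g h).
Local Notation Y := (O8 a' b' c' d' e' f' g' h').

Lemma O8D : X + Y =
  O8 (a + a') (b + b') (c + c') (d + d') (e + e') (f + f') (g + g') (h + h').
Proof. by []. Qed.

Lemma O8N : - X = O8 (- a) (- b) (- c) (- d) (- e) (- f) (- g) (- h).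
Proof. by []. Qed.

Lemma O8Z : k *: X =
  O8 (k * a) (k * b) (k * c) (k * d) (k * e) (k * f) (k * g) (k * h).
Proof. by []. Qed.

Lemma O8_0 : 0 = O8 (0 : K) 0 0 0 0 0 0 0. Proof. by []. Qed.

Lemma O8_scal : oscal k = O8 k 0 0 0 0 0 0 0.
Proof. exact: locked_withE. Qed.

Lemma O8_dia : odia X = O8 a (- b) (- c) (- d) (- e) (- f) (- g) (- h).
Proof. by rewrite /odia locked_withE. Qed.

Lemma O8_dot : odot X Y =
  a * a' + b * b' + c * c' + d * d' + e * e' + f * f' + g * g' + h * h'.
Proof. by rewrite /odot locked_withE. Qed.

Lemma O8M : omul X Y =
  O8
    (a * a' - b * b' - c * c' - d * d' - e * e' - f * f' - g * g' - h * h')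
    (a * b' + b * a' + d * c' + f * e' + g * h' - c * d' - e * f' - h * g')
    (a * c' + b * d' + c * a' + g * e' + h * f' - d * b' - e * g' - f * h')
    (a * d' + c * b' + d * a' + f * g' + h * e' - b * c' - e * h' - g * f')
    (a * e' + b * f' + c * g' + d * h' + e * a' - f * b' - g * c' - h * d')
    (a * f' + c * h' + e * b' + f * a' + g * d' - b * e' - d * g' - h * c')
    (a * g' + d * f' + e * c' + g * a' + h * b' - b * h' - c * e' - f * d')
    (a * h' + b * g' + e * d' + f * c' + h * a' - c * f' - d * e' - g * b').
Proof. by rewrite /omul locked_withE. Qed.

End OctonionOperations.

Ltac oct_intro := repeat match goal with x : _ |- _ =>
   match type of x with context [octonion] => elim/oct_case: x => * end end.
Ltac oct_ring :=
  rewrite ?(O8_0, O8_scal, O8_dia, O8_dot, O8M, O8Z, O8N, O8D);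
  cbn [o0 o1 o2 o3 o4 o5 o6 o7];
  first [apply: O8_eq | idtac]; ring.
Ltac by_coordinates := oct_intro; oct_ring.

Section OctonionIdentities.
Variable K : comNzRingType.
Local Notation oct := (octonion K).
Implicit Types (k a : K) (x y z u : oct).

Lemma odotC x y : odot x y = odot y x. Proof. by_coordinates. Qed.

Lemma odotDl x y z : odot (x + y) z = odot x z + odot y z.
Proof. by_coordinates. Qed.

Lemma odotDr x y z : odot z (x + y) = odot z x + odot z y.
Proof. by_coordinates. Qed.

Lemma odotZl k x y : odot (k *: x) y = k * odot x y. Proof. by_coordinates. Qed.

Lemma odotZr k x y : odot x (k *: y) = k * odot x y. Proof. by_coordinates. Qed.

Lemma odotNl x y : odot (- x) y = - odot x y. Proof. by_coordinates. Qed.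

Lemma odotNr x y : odot x (- y) = - odot x y. Proof. by_coordinates. Qed.

Lemma odot0l x : odot 0 x = 0. Proof. by_coordinates. Qed.

Lemma odot0r x : odot x 0 = 0. Proof. by_coordinates. Qed.

Lemma omulDl x y z : omul (x + y) z = omul x z + omul y z.
Proof. by_coordinates. Qed.

Lemma omulDr x y z : omul z (x + y) = omul z x + omul z y.
Proof. by_coordinates. Qed.

Lemma omulZl k x y : omul (k *: x) y = k *: omul x y. Proof. by_coordinates. Qed.

Lemma omulZr k x y : omul x (k *: y) = k *: omul x y. Proof. by_coordinates. Qed.

Lemma omulNl x y : omul (- x) y = - omul x y. Proof. by_coordinates. Qed.

Lemma omulNr x y : omul x (- y) = - omul x y. Proof. by_coordinates. Qed.

Lemma omul0l x : omul 0 x = 0. Proof. by_coordinates. Qed.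

Lemma omul0r x : omul x 0 = 0. Proof. by_coordinates. Qed.

Lemma odiaD x y : odia (x + y) = odia x + odia y. Proof. by_coordinates. Qed.

Lemma odiaZ k x : odia (k *: x) = k *: odia x. Proof. by_coordinates. Qed.

Lemma odiaN x : odia (- x) = - odia x. Proof. by_coordinates. Qed.

Lemma odia0 : odia 0 = 0 :> oct. Proof. by_coordinates. Qed.

Lemma odiaK x : odia (odia x) = x. Proof. by_coordinates. Qed.

Lemma odiaM x y : odia (omul x y) = omul (odia y) (odia x).
Proof. by_coordinates. Qed.

Lemma odot_dia x y : odot (odia x) (odia y) = odot x y.
Proof. by_coordinates. Qed.

Lemma odot_mull x y z : odot (omul x y) z = odot y (omul (odia x) z).
Proof. by_coordinates. Qed.

Lemma odot_mulr x y z : odot (omul x y) z = odot x (omul z (odia y)).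
Proof. by_coordinates. Qed.

Lemma omul_dial x y : omul (odia x) (omul x y) = odot x x *: y.
Proof. by_coordinates. Qed.

Lemma omul_diar x y : omul (omul y x) (odia x) = odot x x *: y.
Proof. by_coordinates. Qed.

(** Together with [moufang] this removes the nested products from the double adjoint in
    [jadjK_entry]. *)
Lemma omul_sandwich x y :
  omul (omul x y) x = 2 * odot x (odia y) *: x - odot x x *: odia y.
Proof. by_coordinates. Qed.

Lemma omul_flex x y : omul (omul x y) x = omul x (omul y x).
Proof. by_coordinates. Qed.

(** The middle Moufang identity, the substitute for associativity both in the double adjoint and in
    the invariance of the norm under [jtrial]. *)
Lemma moufang u x y : omul (omul u x) (omul y u) = omul (omul u (omul x y)) u.
Proof. by_coordinates. Qed.

Lemma oscalZ k a : k *: oscal a = oscal (k * a) :> oct.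
Proof. by_coordinates. Qed.

Lemma odia_scal a : odia (oscal a) = oscal a :> oct. Proof. by_coordinates. Qed.

Lemma omul_scall a x : omul (oscal a) x = a *: x. Proof. by_coordinates. Qed.

Lemma omul_scalr a x : omul x (oscal a) = a *: x. Proof. by_coordinates. Qed.

Definition ore := locked_with oct_key (@o0 K).

Lemma oreE : ore = @o0 K. Proof. exact: locked_withE. Qed.

Lemma oreD x y : ore (x + y) = ore x + ore y. Proof. by rewrite oreE. Qed.

Lemma oreZ k x : ore (k *: x) = k * ore x. Proof. by rewrite oreE. Qed.

Lemma ore_scal a : ore (oscal a) = a. Proof. by rewrite oreE O8_scal. Qed.

Lemma odot_scall a x : odot (oscal a) x = a * ore x.
Proof. by elim/oct_case: x => *; rewrite oreE O8_scal O8_dot /=; ring. Qed.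

Lemma odot_scalr a x : odot x (oscal a) = a * ore x.
Proof. by rewrite odotC odot_scall. Qed.

Lemma omul_dia x : omul x (odia x) = oscal (odot x x). Proof. by_coordinates. Qed.

Lemma odia_trace x : odia x = oscal (2 * ore x) - x.
Proof. by elim/oct_case: x => *; rewrite oreE /=; oct_ring. Qed.

(** The left side is the scalar part of the product of [x], [y] and [z], and scalar parts are
    cyclic. This makes the cubic term of the norm symmetric under [jcyc]. *)
Lemma odot_cyc x y z : odot (omul x y) (odia z) = odot (omul z x) (odia y).
Proof. by rewrite (odot_mulr z) -odiaM -odot_dia odiaK odotC. Qed.

End OctonionIdentities.

Ltac oct_expand := rewrite ?(omulDl, omulDr, omulZl, omulZr, omulNl, omulNr,
  odiaD, odiaZ, odiaN, odiaM, odiaK).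
Ltac dot_expand :=
  oct_expand; rewrite ?(odotDl, odotDr, odotZl, odotZr, odotNl, odotNr).

(** Nondegeneracy of the dot product turns vector identities into scalar ones, which [ring] can
    decide. *)
Lemma odot_ext (K : comNzRingType) (x y : octonion K) :
  (forall w, odot x w = odot y w) -> x = y.
Proof.
elim/oct_case: x => a b c d e f g h; elim/oct_case: y => a' b' c' d' e' f' g' h' H.
by apply: O8_eq; [have := H (O8 1 0 0 0 0 0 0 0) | have := H (O8 0 1 0 0 0 0 0 0)
  | have := H (O8 0 0 1 0 0 0 0 0) | have := H (O8 0 0 0 1 0 0 0 0)
  | have := H (O8 0 0 0 0 1 0 0 0) | have := H (O8 0 0 0 0 0 1 0 0)
  | have := H (O8 0 0 0 0 0 0 1 0) | have := H (O8 0 0 0 0 0 0 0 1)];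
  rewrite !O8_dot !(mulr0, mulr1, addr0, add0r).
Qed.

(* vector identities in which products only occur as atoms *)
Ltac oct_module := apply: odot_ext => ?; dot_expand; ring.

(** * The Albert algebra *)

(* [J6 a b c x y z] stands for the hermitian matrix with diagonal [a, b, c] and
   entries [x], [y], [z] in the places (2,3), (3,1) and (1,2). *)
Record albert (K : Type) := J6 {ja : K; jb : K; jc : K;
  jx : octonion K; jy : octonion K; jz : octonion K}.

Lemma albert_case K (P : albert K -> Prop) :
  (forall a b c x y z, P (J6 a b c x y z)) -> forall X, P X.
Proof. by move=> H [a b c x y z]. Qed.

Lemma J6_eq K (a b c a' b' c' : K) (x y z x' y' z' : octonion K) :
  a = a' -> b = b' -> c = c' -> x = x' -> y = y' -> z = z' ->
  J6 a b c x y z = J6 a' b' c' x' y' z'.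
Proof. by do 6! move=> ->. Qed.

Lemma J6_inj K (X Y : albert K) : X = Y ->
  [/\ ja X = ja Y, jb X = jb Y, jc X = jc Y &
      [/\ jx X = jx Y, jy X = jy Y & jz X = jz Y]].
Proof. by move=> ->. Qed.

Section AlbertModule.
Variable K : comNzRingType.
Local Notation J := (albert K).
Implicit Types X Y Z : J.

HB.instance Definition _ := gen_eqMixin J.
HB.instance Definition _ := gen_choiceMixin J.

Definition jadd X Y := J6 (ja X + ja Y) (jb X + jb Y) (jc X + jc Y)
  (jx X + jx Y) (jy X + jy Y) (jz X + jz Y).
Definition jopp X := J6 (- ja X) (- jb X) (- jc X)
  (- jx X) (- jy X) (- jz X).
Definition jscale k X := J6 (k * ja X) (k * jb X) (k * jc X)
  (k *: jx X) (k *: jy X) (k *: jz X).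

Fact jaddA : associative jadd.
Proof. by move=> X Y Z; apply: J6_eq; exact: addrA. Qed.
Fact jaddC : commutative jadd.
Proof. by move=> X Y; apply: J6_eq; exact: addrC. Qed.
Fact jadd0 : left_id (J6 0 0 0 0 0 0) jadd.
Proof. by case=> *; apply: J6_eq; exact: add0r. Qed.
Fact jaddN : left_inverse (J6 0 0 0 0 0 0) jopp jadd.
Proof. by case=> *; apply: J6_eq; exact: addNr. Qed.
HB.instance Definition _ := GRing.isZmodule.Build J jaddA jaddC jadd0 jaddN.

Fact jscaleA a b X : jscale a (jscale b X) = jscale (a * b) X.
Proof. by apply: J6_eq; rewrite /= ?scalerA ?mulrA. Qed.
Fact jscale1 : left_id 1 jscale.
Proof. by case=> *; apply: J6_eq; rewrite /= ?scale1r ?mul1r. Qed.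
Fact jscaleDr : right_distributive jscale +%R.
Proof. by move=> k X Y; apply: J6_eq; rewrite /= ?scalerDr ?mulrDr. Qed.
Fact jscaleDl X : {morph jscale^~ X : a b / a + b}.
Proof. by move=> a b; apply: J6_eq; rewrite /= ?scalerDl ?mulrDl. Qed.
HB.instance Definition _ := GRing.Zmodule_isLmodule.Build K J
  jscaleA jscale1 jscaleDr jscaleDl.

End AlbertModule.

Section AlbertOperations.
Variable K : comNzRingType.
Local Notation oct := (octonion K).
Local Notation albert := (albert K).

Lemma J6D (a b c a' b' c' : K) (x y z x' y' z' : oct) :
  J6 a b c x y z + J6 a' b' c' x' y' z' =
  J6 (a + a') (b + b') (c + c') (x + x') (y + y') (z + z').
Proof. by []. Qed.

Lemma J6N (a b c : K) (x y z : oct) :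
  - J6 a b c x y z = J6 (- a) (- b) (- c) (- x) (- y) (- z).
Proof. by []. Qed.

Lemma J6Z (k a b c : K) (x y z : oct) :
  k *: J6 a b c x y z =
  J6 (k * a) (k * b) (k * c) (k *: x) (k *: y) (k *: z).
Proof. by []. Qed.

Definition jdiag (a b c : K) : albert := J6 a b c 0 0 0.

Definition jone : albert := jdiag 1 1 1.

(** Freudenthal's determinant; the cubic term is twice the scalar part of [(z x) y]. *)
Definition albert_norm (X : albert) : K :=
  let: J6 a b c x y z := X in
  a * b * c + 2 * odot (omul z x) (odia y)
  - a * odot x x - b * odot y y - c * odot z z.

Definition albert_form (X Y : albert) : K :=
  let: J6 a b c x y z := X in
  let: J6 a' b' c' x' y' z' := Y in
  a * a' + b * b' + c * c' + 2 * (odot x x' + odot y y' + odot z z').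

Definition albert_cross (X Y : albert) : albert :=
  let: J6 a b c x y z := X in
  let: J6 a' b' c' x' y' z' := Y in
  J6 (b * c' + b' * c - 2 * odot x x') (c * a' + c' * a - 2 * odot y y')
     (a * b' + a' * b - 2 * odot z z')
     (odia (omul y z' + omul y' z) - a *: x' - a' *: x)
     (odia (omul z x' + omul z' x) - b *: y' - b' *: y)
     (odia (omul x y' + omul x' y) - c *: z' - c' *: z).

Definition albert_adj (X : albert) : albert :=
  let: J6 a b c x y z := X in
  J6 (b * c - odot x x) (c * a - odot y y) (a * b - odot z z)
     (odia (omul y z) - a *: x) (odia (omul z x) - b *: y)
     (odia (omul x y) - c *: z).

Definition jnorm := locked_with oct_key albert_norm.
Lemma jnorm_def : jnorm = albert_norm. Proof. exact: locked_withE. Qed.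
Definition jform := locked_with oct_key albert_form.
Lemma jform_def : jform = albert_form. Proof. exact: locked_withE. Qed.
Definition jcross := locked_with oct_key albert_cross.
Lemma jcross_def : jcross = albert_cross. Proof. exact: locked_withE. Qed.
Definition jadj := locked_with oct_key albert_adj.
Lemma jadj_def : jadj = albert_adj. Proof. exact: locked_withE. Qed.

(** The triple product of a cubic Jordan algebra, linear in all three arguments. The product of the
    Cartan factor arises from it by conjugating the middle argument and halving. *)
Definition jtriple (X Y Z : albert) : albert :=
  jform X Y *: Z + jform Z Y *: X - jcross (jcross X Z) Y.

Section Coordinates.
Variables (a b c a' b' c' : K) (x y z x' y' z' : oct).
Local Notation X := (J6 a b c x y z).
Local Notation Y := (J6 a' b' c' x' y' z').

Lemma jnormE : jnorm X = a * b * c + 2 * odot (omul z x) (odia y)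
  - a * odot x x - b * odot y y - c * odot z z.
Proof. by rewrite jnorm_def. Qed.

Lemma jformE : jform X Y =
  a * a' + b * b' + c * c' + 2 * (odot x x' + odot y y' + odot z z').
Proof. by rewrite jform_def. Qed.

Lemma jcrossE : jcross X Y =
  J6 (b * c' + b' * c - 2 * odot x x') (c * a' + c' * a - 2 * odot y y')
     (a * b' + a' * b - 2 * odot z z')
     (odia (omul y z' + omul y' z) - a *: x' - a' *: x)
     (odia (omul z x' + omul z' x) - b *: y' - b' *: y)
     (odia (omul x y' + omul x' y) - c *: z' - c' *: z).
Proof. by rewrite jcross_def. Qed.

Lemma jadjE : jadj X =
  J6 (b * c - odot x x) (c * a - odot y y) (a * b - odot z z)
     (odia (omul y z) - a *: x) (odia (omul z x) - b *: y)
     (odia (omul x y) - c *: z).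
Proof. by rewrite jadj_def. Qed.

End Coordinates.

End AlbertOperations.

Section AlbertIdentities.
Variable K : comNzRingType.
Implicit Types (k : K) (X Y Z W : albert K).

Lemma jformC X Y : jform X Y = jform Y X.
Proof.
elim/albert_case: X => a b c x y z; elim/albert_case: Y => a' b' c' x' y' z'.
rewrite !jformE (odotC x) (odotC y) (odotC z); ring.
Qed.

Lemma jformDl X Y Z : jform (X + Y) Z = jform X Z + jform Y Z.
Proof.
elim/albert_case: X => a b c x y z; elim/albert_case: Y => a' b' c' x' y' z'.
elim/albert_case: Z => d e f u v w.
by rewrite !J6D !jformE; dot_expand; ring.
Qed.

Lemma jformZl k X Y : jform (k *: X) Y = k * jform X Y.
Proof.
elim/albert_case: X => a b c x y z; elim/albert_case: Y => a' b' c' x' y' z'.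
by rewrite !J6Z !jformE; dot_expand; ring.
Qed.

Lemma jformDr X Y Z : jform Z (X + Y) = jform Z X + jform Z Y.
Proof. by rewrite ![jform Z _]jformC jformDl. Qed.

Lemma jformZr k X Y : jform X (k *: Y) = k * jform X Y.
Proof. by rewrite ![jform X _]jformC jformZl. Qed.

Lemma jcrossC X Y : jcross X Y = jcross Y X.
Proof.
elim/albert_case: X => a b c x y z; elim/albert_case: Y => a' b' c' x' y' z'.
rewrite !jcrossE (odotC x) (odotC y) (odotC z).
by apply: J6_eq; [ring|ring|ring|oct_module|oct_module|oct_module].
Qed.

Lemma jcrossDl X Y Z : jcross (X + Y) Z = jcross X Z + jcross Y Z.
Proof.
elim/albert_case: X => a b c x y z; elim/albert_case: Y => a' b' c' x' y' z'.
elim/albert_case: Z => d e f u v w.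
rewrite !J6D !jcrossE J6D.
by apply: J6_eq; [dot_expand; ring|dot_expand; ring|dot_expand; ring
  |oct_module|oct_module|oct_module].
Qed.

Lemma jcrossZl k X Y : jcross (k *: X) Y = k *: jcross X Y.
Proof.
elim/albert_case: X => a b c x y z; elim/albert_case: Y => a' b' c' x' y' z'.
rewrite !J6Z !jcrossE J6Z.
by apply: J6_eq; [dot_expand; ring|dot_expand; ring|dot_expand; ring
  |oct_module|oct_module|oct_module].
Qed.

Lemma jcrossDr X Y Z : jcross Z (X + Y) = jcross Z X + jcross Z Y.
Proof. by rewrite ![jcross Z _]jcrossC jcrossDl. Qed.

Lemma jcrossZr k X Y : jcross X (k *: Y) = k *: jcross X Y.
Proof. by rewrite ![jcross X _]jcrossC jcrossZl. Qed.

Lemma jcross_adj X : jcross X X = 2 *: jadj X.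
Proof.
elim/albert_case: X => a b c x y z; rewrite jcrossE jadjE J6Z.
by apply: J6_eq; [ring|ring|ring|oct_module|oct_module|oct_module].
Qed.

Lemma jform_adj X : jform (jadj X) X = 3 * jnorm X.
Proof.
elim/albert_case: X => a b c x y z; rewrite jadjE jnormE jformE; dot_expand.
have E1 : odot (omul (odia z) (odia y)) x = odot (omul z x) (odia y).
  by rewrite odot_mull odiaK odotC.
have E2 : odot (omul (odia x) (odia z)) y = odot (omul z x) (odia y).
  by rewrite -odiaM -odot_dia odiaK.
have E3 : odot (omul (odia y) (odia x)) z = odot (omul z x) (odia y).
  by rewrite odot_mulr odiaK odotC.
by rewrite E1 E2 E3; ring.
Qed.

(** By nondegeneracy of the form, this characterises the cross product through norm and form alone;
    hence maps that respect the latter two also respect the former. *)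
Lemma jnorm_polar X Y Z : jform (jcross X Y) Z =
  jnorm (X + Y + Z) - jnorm (X + Y) - jnorm (Y + Z) - jnorm (X + Z)
  + jnorm X + jnorm Y + jnorm Z.
Proof.
elim/albert_case: X => a b c x y z; elim/albert_case: Y => a' b' c' x' y' z'.
elim/albert_case: Z => d e f u v w.
(* The three shapes of the cubic term are brought to a common one, so that [ring] sees equal
   atoms. *)
have E1 (p q r : octonion K) : odot (omul (odia r) (odia q)) p = odot (omul r p) (odia q).
  by rewrite odot_mull odiaK odotC.
have E2 (p q r : octonion K) : odot (omul (odia p) (odia r)) q = odot (omul r p) (odia q).
  by rewrite -odiaM -odot_dia odiaK.
have E3 (p q r : octonion K) : odot (omul (odia q) (odia p)) r = odot (omul r p) (odia q).
  by rewrite odot_mulr odiaK odotC.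
rewrite !J6D !jcrossE !jnormE jformE; dot_expand.
rewrite !(E1 u) !(E2 _ v) !(E3 _ _ w).
rewrite (odotC x' x) (odotC y' y) (odotC z' z) (odotC u x) (odotC v y) (odotC w z).
by rewrite  (odotC u x') (odotC v y') (odotC w z'); ring.
Qed.

(** The (2,3) entry of the double adjoint; the other two off-diagonal entries follow by cyclic
    renaming. The only term that resists the alternative laws is [(x y) (z x)], which the Moufang
    identity brings into the sandwich form [(x (y z)) x]. *)
Fact jadjK_entry (a b c : K) (x y z : octonion K) :
  odia (omul (odia (omul z x) - b *: y) (odia (omul x y) - c *: z))
  - (b * c - odot x x) *: (odia (omul y z) - a *: x) =
  (a * b * c + 2 * odot (omul z x) (odia y) - a * odot x x - b * odot y y
   - c * odot z z) *: x.
Proof.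
have -> : omul (odia (omul z x) - b *: y) (odia (omul x y) - c *: z) =
    odia (omul (omul x y) (omul z x)) - c *: omul (odia (omul z x)) z
    - b *: omul y (odia (omul x y)) + (b * c) *: omul y z.
  rewrite (odiaM (omul x y)) !(omulDl, omulDr, omulNl, omulNr, omulZl, omulZr).
  by apply: odot_ext => w; rewrite !(odotDl, odotNl, odotZl); ring.
rewrite moufang omul_sandwich.
rewrite !(odiaD, odiaN, odiaZ) !(odiaM (odia _) z) !(odiaM y (odia _)) !odiaK.
rewrite omul_dial omul_diar.
have -> : odot x (odia (omul y z)) = odot (omul z x) (odia y).
  by rewrite odiaM odot_mull.
by move: (odia (omul y z)) => p; apply: odot_ext => w;
  rewrite !(odotDl, odotNl, odotZl); ring.
Qed.

(** For an element of norm zero this makes the adjoint an element with vanishing adjoint, which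
    [rank_one_diag] can handle. *)
Lemma jadjK X : jadj (jadj X) = jnorm X *: X.
Proof.
elim/albert_case: X => a b c x y z; rewrite !jadjE jnormE J6Z.
have D p q : odot (omul p q) (omul p q) = odot p p * odot q q.
  by rewrite odot_mull omul_dial odotZr.
have E1 : odot (omul (odia z) (odia y)) x = odot (omul z x) (odia y).
  by rewrite odot_mull odiaK odotC.
have E2 : odot (omul (odia x) (odia z)) y = odot (omul z x) (odia y).
  by rewrite -odiaM -odot_dia odiaK.
have E3 : odot (omul (odia y) (odia x)) z = odot (omul z x) (odia y).
  by rewrite odot_mulr odiaK odotC.
apply: J6_eq.
- dot_expand; rewrite D !odot_dia E1 [odot x _]odotC E1; ring.
- dot_expand; rewrite D !odot_dia E2 [odot y _]odotC E2; ring.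
- dot_expand; rewrite D !odot_dia E3 [odot z _]odotC E3; ring.
- exact: jadjK_entry.
- by rewrite (jadjK_entry b c a y z x) odot_cyc; congr (_ *: _); ring.
- by rewrite (jadjK_entry c a b z x y) -odot_cyc; congr (_ *: _); ring.
Qed.

End AlbertIdentities.

(** * Norm similarities of the Albert algebra *)

Section Similarities.
Variable K : comNzRingType.
Implicit Types (X Y : albert K) (u : octonion K).

(** Conjugation by a cyclic permutation matrix; it spares two of every three symmetric arguments. *)
Definition jcyc X := let: J6 a b c x y z := X in J6 b c a y z x.

(** This is [D X D] for the diagonal matrix [D] of the [d]'s, without an inverse on either side: it
    serves to move a diagonal unitary to the unit. *)
Definition jphase (d1 d2 d3 : K) X := let: J6 a b c x y z := X in
  J6 (d1 ^+ 2 * a) (d2 ^+ 2 * b) (d3 ^+ 2 * c)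
     ((d2 * d3) *: x) ((d3 * d1) *: y) ((d1 * d2) *: z).

(** A triality map: the three octonion places undergo right, two-sided and left multiplication, and
    the Moufang identity preserves the cubic term. A suitable [u] turns the entry [z] into a
    scalar. *)
Definition jtrial u X := let: J6 a b c x y z := X in
  J6 a b c (omul x u) (omul (odia u) (omul y (odia u))) (omul u z).

(* conjugation by the rotation [[c, -s], [s, c]] of the first two coordinates,
   if [c ^+ 2 + s ^+ 2 = 1] *)
Definition jrot (c s : K) X := let: J6 a b d x y z := X in
  let r := ore z in
  J6 (c ^+ 2 * a - 2 * (c * s) * r + s ^+ 2 * b)
     (s ^+ 2 * a + 2 * (c * s) * r + c ^+ 2 * b) d
     (c *: x + s *: odia y) (c *: y - s *: odia x)
     ((c ^+ 2 + s ^+ 2) *: z + oscal (c * s * (a - b) - 2 * s ^+ 2 * r)).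

Lemma jcycK : cancel jcyc (jcyc \o jcyc). Proof. by case. Qed.

Lemma jcycK' : cancel (jcyc \o jcyc) jcyc. Proof. by case. Qed.

Lemma jcyc_linear k X Y : jcyc (k *: X + Y) = k *: jcyc X + jcyc Y.
Proof. by case: X => *; case: Y => *. Qed.

Lemma jform_cyc X Y : jform (jcyc X) (jcyc Y) = jform X Y.
Proof. by case: X => *; case: Y => *; rewrite !jformE; ring. Qed.

Lemma jnorm_cyc X : jnorm (jcyc X) = jnorm X.
Proof. by case: X => *; rewrite !jnormE odot_cyc; ring. Qed.

Lemma jphaseM (d1 d2 d3 e1 e2 e3 : K) X :
  jphase d1 d2 d3 (jphase e1 e2 e3 X) = jphase (d1 * e1) (d2 * e2) (d3 * e3) X.
Proof. by case: X => *; apply: J6_eq; rewrite ?scalerA; try (congr (_ *: _)); ring. Qed.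

Lemma jphase1 X : jphase 1 1 1 X = X.
Proof. by case: X => *; rewrite /jphase !expr1n !mul1r !scale1r. Qed.

Lemma jphase_linear (d1 d2 d3 : K) k X Y :
  jphase d1 d2 d3 (k *: X + Y) = k *: jphase d1 d2 d3 X + jphase d1 d2 d3 Y.
Proof.
by case: X => *; case: Y => *; apply: J6_eq => /=;
  [ring|ring|ring|oct_module|oct_module|oct_module].
Qed.

Lemma jnorm_phase (d1 d2 d3 : K) X :
  jnorm (jphase d1 d2 d3 X) = (d1 * d2 * d3) ^+ 2 * jnorm X.
Proof.
case: X => *; rewrite /jphase !jnormE !(omulZl, omulZr, odiaZ).
by rewrite !(odotZl, odotZr); ring.
Qed.

Lemma jform_phase (d1 d2 d3 e1 e2 e3 : K) X Y :
  d1 * e1 = 1 -> d2 * e2 = 1 -> d3 * e3 = 1 ->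
  jform (jphase d1 d2 d3 X) (jphase e1 e2 e3 Y) = jform X Y.
Proof.
case: X => a b c x y z; case: Y => a' b' c' x' y' z' E1 E2 E3.
rewrite /jphase !jformE !(odotZl, odotZr).
have -> : d1 ^+ 2 * a * (e1 ^+ 2 * a') = (d1 * e1) ^+ 2 * (a * a') by ring.
have -> : d2 ^+ 2 * b * (e2 ^+ 2 * b') = (d2 * e2) ^+ 2 * (b * b') by ring.
have -> : d3 ^+ 2 * c * (e3 ^+ 2 * c') = (d3 * e3) ^+ 2 * (c * c') by ring.
have D p q p' q' t : p * q * (p' * q' * t) = (p * p') * (q * q') * t :> K.
  by move=> *; ring.
by rewrite !D E1 E2 E3 !expr1n !mul1r.
Qed.

Lemma jtrialK u : odot u u = 1 -> cancel (jtrial u) (jtrial (odia u)).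
Proof.
move=> u1 [a b c x y z]; rewrite /jtrial odiaK.
have u1' : odot (odia u) (odia u) = 1 by rewrite odot_dia.
apply: J6_eq => //; first by rewrite omul_diar u1 scale1r.
  have R p : omul (omul p (odia u)) u = p.
    by have := omul_diar (odia u) p; rewrite odiaK u1' scale1r.
  have L p : omul u (omul (odia u) p) = p.
    by have := omul_dial (odia u) p; rewrite odiaK u1' scale1r.
  by rewrite -(omul_flex (odia u)) R L.
by rewrite omul_dial u1 scale1r.
Qed.

Lemma jtrial_linear u k X Y :
  jtrial u (k *: X + Y) = k *: jtrial u X + jtrial u Y.
Proof.
case: X => *; case: Y => *; apply: J6_eq => //=;
  by rewrite !(omulDl, omulDr, omulZl, omulZr).
Qed.

Lemma jform_trial u X Y : odot u u = 1 ->
  jform (jtrial u X) (jtrial u Y) = jform X Y.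
Proof.
case: X => a b c x y z; case: Y => a' b' c' x' y' z' u1.
have u1' : odot (odia u) (odia u) = 1 by rewrite odot_dia.
rewrite /jtrial !jformE odot_mulr omul_diar u1 scale1r.
rewrite [odot (omul u z) _]odot_mull omul_dial u1 scale1r.
rewrite [odot (omul (odia u) _) _]odot_mull omul_dial u1' scale1r.
by rewrite odot_mulr omul_diar u1' scale1r.
Qed.

Lemma jnorm_trial u X : odot u u = 1 -> jnorm (jtrial u X) = jnorm X.
Proof.
case: X => a b c x y z u1.
have u1' : odot (odia u) (odia u) = 1 by rewrite odot_dia.
rewrite /jtrial !jnormE moufang !odiaM odiaK.
rewrite [odot (omul (omul u _) u) _]odot_mulr omul_diar u1 scale1r.
rewrite [odot (omul u (omul z x)) _]odot_mull omul_dial u1 scale1r.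
rewrite [odot (omul x u) _]odot_mulr omul_diar u1 scale1r.
rewrite [odot (omul u z) _]odot_mull omul_dial u1 scale1r.
rewrite [odot (omul (odia u) _) _]odot_mull omul_dial u1' scale1r.
by rewrite [odot (omul y _) _]odot_mulr omul_diar u1' scale1r.
Qed.

Lemma jrot_linear (c s : K) k X Y :
  jrot c s (k *: X + Y) = k *: jrot c s X + jrot c s Y.
Proof.
case: X => *; case: Y => *; apply: J6_eq => //=.
- by rewrite oreD oreZ; ring.
- by rewrite oreD oreZ; ring.
all: apply: odot_ext => w; rewrite ?oreD ?oreZ.
all: by rewrite !(odotDl, odotZl, odiaD, odiaZ, odotNl, odot_scall); ring.
Qed.

Lemma jrotK (c s : K) : c ^+ 2 + s ^+ 2 = 1 -> cancel (jrot c s) (jrot c (- s)).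
Proof.
move=> E [a b d x y z]; apply: J6_eq => //=.
- rewrite oreD oreZ ore_scal.
  transitivity ((c ^+ 2 + s ^+ 2) ^+ 2 * a); first by ring.
  by rewrite E expr1n mul1r.
- rewrite oreD oreZ ore_scal.
  transitivity ((c ^+ 2 + s ^+ 2) ^+ 2 * b); first by ring.
  by rewrite E expr1n mul1r.
- transitivity ((c ^+ 2 + s ^+ 2) *: x); last by rewrite E scale1r.
  rewrite odiaD odiaN !odiaZ odiaK; apply: odot_ext => w.
  by rewrite !(odotDl, odotZl, odotNl); ring.
- transitivity ((c ^+ 2 + s ^+ 2) *: y); last by rewrite E scale1r.
  rewrite odiaD !odiaZ odiaK; apply: odot_ext => w.
  by rewrite !(odotDl, odotZl, odotNl); ring.
transitivity ((c ^+ 2 + s ^+ 2) ^+ 2 *: z); last by rewrite E expr1n scale1r.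
rewrite oreD oreZ ore_scal; apply: odot_ext => w.
by rewrite !(odotDl, odotZl, odot_scall); ring.
Qed.

Lemma jform_rot (c s : K) X Y : c ^+ 2 + s ^+ 2 = 1 ->
  jform (jrot c s X) (jrot c s Y) = jform X Y.
Proof.
case: X => a b d x y z; case: Y => a' b' d' x' y' z' E; rewrite !jformE.
rewrite !(odotDl, odotZl, odotNl, odotDr, odotZr, odotNr) !odot_dia.
rewrite !odot_scall !odot_scalr ore_scal.
have -> : odot (odia y) x' = odot y (odia x') by rewrite -odot_dia odiaK.
have -> : odot (odia x) y' = odot x (odia y') by rewrite -odot_dia odiaK.
transitivity ((c ^+ 2 + s ^+ 2) ^+ 2 * (a * a' + b * b' + 2 * odot z z')
  + d * d' + 2 * (c ^+ 2 + s ^+ 2) * (odot x x' + odot y y')); first by ring.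
by rewrite E; ring.
Qed.

Lemma jnorm_rot (c s : K) X : c ^+ 2 + s ^+ 2 = 1 ->
  jnorm (jrot c s X) = jnorm X.
Proof.
case: X => a b d x y z E; rewrite /jrot !jnormE.
have T1 : odot (omul z x) x = odot x x * ore z.
  by rewrite odot_mulr omul_dia odot_scalr.
have T2 : odot (omul z (odia y)) (odia y) = odot y y * ore z.
  by rewrite odot_mulr omul_dia odot_scalr odot_dia.
(* The rotation mixes [x] with [odia y]; the cubic term with the two interchanged comes back through
   [odia z = 2 Re z - z]. *)
have T3 : odot (omul z (odia y)) x = 2 * ore z * odot x (odia y) - odot (omul z x) (odia y).
  rewrite odot_mull (odia_trace z) omulDl omulNl omul_scall odotDr odotNr odotZr.
  by rewrite odotC [odot (odia y) (omul _ _)]odotC.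
rewrite odiaD odiaN !odiaZ odiaK !(omulDl, omulDr, omulZl, omulZr, omul_scall).
rewrite !(odotDl, odotDr, odotZl, odotZr, odotNl, odotNr, odot_scall, odot_scalr).
rewrite !odot_dia oreD oreZ ore_scal T1 T2 T3 [odot (odia y) x]odotC.
have -> : odot y (odia x) = odot x (odia y) by rewrite -odot_dia odiaK odotC.
have -> : odot (odia x) y = odot x (odia y) by rewrite -odot_dia odiaK.
transitivity ((c ^+ 2 + s ^+ 2) ^+ 2 * (a * b * d
  + 2 * odot (omul z x) (odia y) - a * odot x x - b * odot y y
  - d * odot z z)); first by ring.
by rewrite E expr1n mul1r.
Qed.

End Similarities.

(** * Conjugation and the structure group *)

Section Conjugation.
Variable R : rcfType.
Local Notation K := R[i].
Local Notation oct := (octonion K).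
Local Notation J := (albert K).
Implicit Types (k : K) (x y z : oct) (X Y Z : J).

Definition oconj x : oct := O8 (conjc (o0 x)) (conjc (o1 x)) (conjc (o2 x))
  (conjc (o3 x)) (conjc (o4 x)) (conjc (o5 x)) (conjc (o6 x)) (conjc (o7 x)).

Lemma oconjK : involutive oconj.
Proof. by case=> *; apply: O8_eq; rewrite /= conjcK. Qed.

Lemma oconjD x y : oconj (x + y) = oconj x + oconj y.
Proof. by apply: O8_eq; rewrite /= rmorphD. Qed.

Lemma oconjN x : oconj (- x) = - oconj x.
Proof. by apply: O8_eq; rewrite /= rmorphN. Qed.

Lemma oconjZ k x : oconj (k *: x) = conjc k *: oconj x.
Proof. by apply: O8_eq; rewrite /= rmorphM. Qed.

Lemma oconj0 : oconj 0 = 0.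
Proof. by apply: O8_eq; exact: (rmorph0 (@conjc R)). Qed.

Lemma oconjM x y : oconj (omul x y) = omul (oconj x) (oconj y).
Proof.
case: x => *; case: y => *; rewrite /oconj !O8M.
by apply: O8_eq; rewrite /= !(rmorphB, rmorphD, rmorphM).
Qed.

Lemma oconj_dia x : oconj (odia x) = odia (oconj x).
Proof. by case: x => *; rewrite /oconj !O8_dia /= !rmorphN. Qed.

Lemma oconj_dot x y : conjc (odot x y) = odot (oconj x) (oconj y).
Proof.
by case: x => *; case: y => *; rewrite /oconj !O8_dot /= !(rmorphD, rmorphM).
Qed.

Lemma oconj_scal k : oconj (oscal k) = oscal (conjc k).
Proof.
by rewrite /oconj !O8_scal; apply: O8_eq => //; exact: (rmorph0 (@conjc R)).
Qed.

Lemma ore_conj x : ore (oconj x) = conjc (ore x). Proof. by rewrite oreE. Qed.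

Definition jconj X : J := J6 (conjc (ja X)) (conjc (jb X)) (conjc (jc X))
  (oconj (jx X)) (oconj (jy X)) (oconj (jz X)).

Lemma jconjK : involutive jconj.
Proof. by case=> *; apply: J6_eq; rewrite /= ?conjcK ?oconjK. Qed.

Lemma jconjD X Y : jconj (X + Y) = jconj X + jconj Y.
Proof. by apply: J6_eq; rewrite /= ?rmorphD ?oconjD. Qed.

Lemma jconjN X : jconj (- X) = - jconj X.
Proof. by apply: J6_eq; rewrite /= ?rmorphN ?oconjN. Qed.

Lemma jconjZ k X : jconj (k *: X) = conjc k *: jconj X.
Proof. by apply: J6_eq; rewrite /= ?rmorphM ?oconjZ. Qed.

Lemma jconj_linear k X Y : jconj (k *: X + Y) = conjc k *: jconj X + jconj Y.
Proof. by rewrite jconjD jconjZ. Qed.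

Lemma jconj_form X Y : conjc (jform X Y) = jform (jconj X) (jconj Y).
Proof.
case: X => *; case: Y => *; rewrite /jconj !jformE /= -!oconj_dot.
by rewrite !(rmorph_nat, rmorphD, rmorphM).
Qed.

Lemma jconj_cross X Y : jconj (jcross X Y) = jcross (jconj X) (jconj Y).
Proof.
case: X => *; case: Y => *; rewrite /jconj !jcrossE /= -!oconj_dot.
rewrite -!oconjM -!oconjD -!oconj_dia -!oconjZ -!oconjN -!oconjD.
by apply: J6_eq; rewrite /= ?(rmorph_nat, rmorphB, rmorphD, rmorphM).
Qed.

Lemma jconj_norm X : conjc (jnorm X) = jnorm (jconj X).
Proof.
case: X => *; rewrite /jconj !jnormE /= -!oconjM -!oconj_dia -!oconj_dot.
by rewrite !(rmorph_nat, rmorphB, rmorphD, rmorphM).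
Qed.

Definition jherm X Y := jform X (jconj Y).

Lemma jform_ext X Y : (forall Z, jform X Z = jform Y Z) -> X = Y.
Proof.
case: X => a b c x y z; case: Y => a' b' c' x' y' z' H.
have D (p q : oct) : (forall w, 2 * odot p w = 2 * odot q w) -> p = q.
  by move=> E; apply: odot_ext => w; apply: (@mulfI K 2); rewrite ?pnatr_eq0.
have := H (jdiag 1 0 0); have := H (jdiag 0 1 0); have := H (jdiag 0 0 1).
rewrite /jdiag !jformE !odot0r !(mulr0, mulr1, addr0, add0r) => -> -> ->.
apply: J6_eq => //; apply: D => w; [have := H (J6 0 0 0 w 0 0)
  | have := H (J6 0 0 0 0 w 0) | have := H (J6 0 0 0 0 0 w)];
  by rewrite !jformE !odot0r !(mulr0, mulr1, addr0, add0r).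
Qed.

(* Linear bijections preserving the hermitian form and, up to a factor of
   modulus one, the norm; these are automorphisms of the Jordan triple. *)
Definition structure_map (g : J -> J) := exists h chi,
  [/\ cancel g h /\ cancel h g, forall k X Y, g (k *: X + Y) = k *: g X + g Y,
      forall X Y, jherm (g X) (g Y) = jherm X Y, chi * conjc chi = 1 &
      forall X, jnorm (g X) = chi * jnorm X].

Lemma structure_id : structure_map id.
Proof. by exists id, 1; split=> // *; rewrite ?rmorph1 ?mul1r. Qed.

Lemma structure_comp g g' : structure_map g -> structure_map g' ->
  structure_map (g \o g').
Proof.
move=> [h [chi [[gK hK] gL gH chi1 gN]]] [h' [chi' [[gK' hK'] gL' gH' chi1' gN']]].
exists (h' \o h), (chi * chi'); split => [|k X Y|X Y||X] /=.
- by split; [exact: can_comp|exact: can_comp].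
- by rewrite gL' gL.
- by rewrite gH gH'.
- by rewrite rmorphM /= mulrACA chi1 chi1' mulr1.
by rewrite gN gN' mulrA.
Qed.

Lemma structure_inv g : structure_map g ->
  exists h, [/\ structure_map h, cancel g h & cancel h g].
Proof.
move=> [h [chi [[gK hK] gL gH chi1 gN]]]; exists h; split=> //.
exists g, (conjc chi); split => [|k X Y|X Y||X] //.
- by apply: (can_inj gK); rewrite gL !hK.
- by rewrite -gH !hK.
- by rewrite conjcK mulrC.
by rewrite -{2}[X]hK gN mulrA [_ * chi]mulrC chi1 mul1r.
Qed.

Section StructureMap.
Variables (g : J -> J) (Gg : structure_map g).

Lemma structure_linear k X Y : g (k *: X + Y) = k *: g X + g Y.
Proof. by case: Gg => h [chi [_ ->]]. Qed.

Lemma structure0 : g 0 = 0.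
Proof.
by have := structure_linear (-1) 0 0; rewrite !scaler0 addr0 scaleN1r addNr.
Qed.

Lemma structureD X Y : g (X + Y) = g X + g Y.
Proof. by have := structure_linear 1 X Y; rewrite !scale1r. Qed.

Lemma structureZ k X : g (k *: X) = k *: g X.
Proof. by have := structure_linear k X 0; rewrite !addr0 structure0 addr0. Qed.

Lemma structureN X : g (- X) = - g X.
Proof. by rewrite -scaleN1r structureZ scaleN1r. Qed.

Lemma structureB X Y : g (X - Y) = g X - g Y.
Proof. by rewrite structureD structureN. Qed.

Lemma structure_herm X Y : jherm (g X) (g Y) = jherm X Y.
Proof. by case: Gg => h [chi [_ _ ->]]. Qed.

Lemma structure_inj : injective g.
Proof. by case: Gg => h [chi [[/can_inj]]]. Qed.

Lemma structure_norm : exists chi, chi != 0 /\ forall X, jnorm (g X) = chi * jnorm X.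
Proof.
case: Gg => h [chi [_ _ _ E H]]; exists chi; split=> //.
by apply: contra_eq_neq E => ->; rewrite mul0r eq_sym oner_eq0.
Qed.

(** Pairing with [g Z] turns the cross product into a polarised norm, which [g] scales by [chi].
    Since [g] preserves the hermitian form, its contragredient for the bilinear form is
    [jconj \o g \o jconj]. *)
Lemma structure_cross : exists chi, chi * conjc chi = 1 /\
  forall X Y, jcross (g X) (g Y) = chi *: jconj (g (jconj (jcross X Y))).
Proof.
case: Gg => h [chi [[gK hK] gL gH chi1 gN]]; exists chi; split=> // X Y.
apply: jform_ext => Z; rewrite -[Z]hK; move: (h Z) => {}Z.
rewrite jformZl [jform (jconj _) _]jformC -/(jherm _ _) gH /jherm jconjK [jform Z _]jformC.
by rewrite !jnorm_polar -!structureD !gN; ring.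
Qed.

(** The double cross product picks up [chi] once and its conjugate once; they cancel because [chi]
    has modulus one. *)
Lemma structure_triple X Y Z :
  jtriple (g X) (jconj (g Y)) (g Z) = g (jtriple X (jconj Y) Z).
Proof.
have [chi [chi1 E]] := structure_cross.
rewrite /jtriple structureB structureD !structureZ -!/(jherm _ _) !structure_herm.
congr (_ + _ - _); rewrite E jcrossZl -jconj_cross E jconjZ jconjK scalerA.
by rewrite chi1 scale1r jconj_cross jconjK.
Qed.

Lemma structure_adj : exists chi, chi * conjc chi = 1 /\
  forall X, jadj (g X) = chi *: jconj (g (jconj (jadj X))).
Proof.
have [chi [chi1 E]] := structure_cross; exists chi; split=> // X.
apply: (@scalerI _ _ (2 : K)); first by rewrite pnatr_eq0.
rewrite -jcross_adj E jcross_adj jconjZ structureZ jconjZ conjcK.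
by rewrite !scalerA mulrC.
Qed.

End StructureMap.
End Conjugation.

(** * Diagonalisation *)

Section Diagonalisation.
Variable R : rcfType.
Local Notation K := R[i].
Local Notation oct := (octonion K).
Local Notation J := (albert K).
Local Notation "x %:C" := (real_complex R x) : ring_scope.
Implicit Types (k : K) (x y z : oct) (X Y Z U : J).

Lemma conjc_fix k : conjc k = k -> k = (complex.Re k)%:C.
Proof.
by case: k => a b [] /eqP; rewrite eq_sym -addr_eq0 -mulr2n mulrn_eq0 => /eqP ->.
Qed.

(** On real octonions the form is a sum of eight real squares, so it has a real square root that
    vanishes only at zero. *)
Lemma oct_real x : oconj x = x ->
  exists2 r : R, 0 <= r & odot x x = (r ^+ 2)%:C /\ (r = 0 -> x = 0).
Proof.
case: x => a b c d e f g h [] /conjc_fix -> /conjc_fix -> /conjc_fix ->.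
move=> /conjc_fix -> /conjc_fix -> /conjc_fix -> /conjc_fix -> /conjc_fix ->.
move: (complex.Re a) (complex.Re b) (complex.Re c) (complex.Re d)
  (complex.Re e) (complex.Re f) (complex.Re g) (complex.Re h).
move=> {}a {}b {}c {}d {}e {}f {}g {}h.
pose q := a ^+ 2 + b ^+ 2 + c ^+ 2 + d ^+ 2 + e ^+ 2 + f ^+ 2 + g ^+ 2 + h ^+ 2.
have q0 : 0 <= q by rewrite !addr_ge0 ?sqr_ge0.
exists (Num.sqrt q); first exact: sqrtr_ge0.
split; first by rewrite sqr_sqrtr // O8_dot -!expr2 !rmorphD !rmorphXn.
move/eqP; rewrite sqrtr_eq0 => q0'; have : q == 0 by rewrite eq_le q0 q0'.
rewrite /q !paddr_eq0 ?addr_ge0 ?sqr_ge0 // !sqrf_eq0.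
by do ![case/andP]; do 8! move=> /eqP ->.
Qed.

Lemma oct_real_eq0 x : oconj x = x -> odot x x = 0 -> x = 0.
Proof.
move=> /oct_real[r _ [-> H]] /(@complexI _ _ 0) /eqP.
by rewrite sqrf_eq0 => /eqP /H.
Qed.

(** Fixing the unit removes the factor: such maps preserve the norm and the adjoint exactly and
    commute with [jconj]. *)
Definition jaut (g : J -> J) := structure_map g /\ g (jone _) = jone _.

Lemma jaut_id : jaut id. Proof. by split=> //; exact: structure_id. Qed.

Lemma jaut_comp g g' : jaut g -> jaut g' -> jaut (g \o g').
Proof.
by move=> [Sg g1] [Sg' g1']; split; [exact: structure_comp|rewrite /= g1' g1].
Qed.

Lemma jaut_inv g : jaut g -> exists h, [/\ jaut h, cancel g h & cancel h g].
Proof.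
move=> [/structure_inv[h [Sh gK hK]] g1]; exists h; split=> //; split=> //.
by rewrite -{1}g1 gK.
Qed.

Lemma jone_norm : jnorm (jone K) = 1.
Proof. by rewrite jnormE omul0l !odot0r odot0l; ring. Qed.

Lemma jone_conj : jconj (jone K) = jone _.
Proof.
by apply: J6_eq; first [exact: (rmorph1 (@conjc R)) | exact: oconj0].
Qed.

Lemma jform_one X : jform (jone K) X = ja X + jb X + jc X.
Proof. by case: X => *; rewrite jformE !odot0l /=; ring. Qed.

Lemma jcross_one X : jcross (jone K) X = jform (jone K) X *: jone K - X.
Proof.
rewrite jform_one; case: X => a b c x y z; rewrite jcrossE.
rewrite !omul0l !omul0r !odot0l !addr0 odia0 !scaler0 !scale1r.
by apply: J6_eq => /=; rewrite ?scaler0 ?subr0 ?sub0r ?add0r //; ring.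
Qed.

(** Applied to a conjugate, this recovers the involution from the triple product; at the unit,
    [x = {u,x,u}] therefore says that [x] is self-adjoint. *)
Lemma jtriple_one X : jtriple (jone K) X (jone K) = 2 *: X.
Proof.
rewrite /jtriple (jcross_one (jone K)).
have -> : jform (jone K) (jone K) *: jone K - jone K = 2 *: jone K.
  rewrite jform_one -{5}[jone K]scale1r -scalerBl; congr (_ *: _).
  by rewrite /=; ring.
rewrite jcrossZl jcross_one scalerBr scalerA mulr_natl mulr2n scalerDl.
by rewrite jformC opprB addrC subrK.
Qed.

Section Automorphism.
Variables (g : J -> J) (Ag : jaut g).

Lemma jaut_conj X : jconj (g X) = g (jconj X).
Proof.
case: Ag => Sg g1; apply: (@scalerI _ _ (2 : K)); first by rewrite pnatr_eq0.
by rewrite -jtriple_one -{1 2}g1 structure_triple // jtriple_one structureZ.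
Qed.

Lemma jaut_norm X : jnorm (g X) = jnorm X.
Proof.
case: Ag => Sg g1; have [chi [_ E]] := structure_norm Sg.
by have := E (jone _); rewrite g1 jone_norm mulr1 E => <-; rewrite mul1r.
Qed.

Lemma jaut_adj X : jadj (g X) = g (jadj X).
Proof.
case: Ag => Sg g1; have [chi [_ E]] := structure_adj Sg.
have A1 : jadj (jone K) = jone _.
  by rewrite jadjE !omul0l odia0 !odot0l !scaler0 !subr0 mulr1.
have := E (jone _); rewrite g1 A1 jone_conj g1 jone_conj => /esym E1.
have chi1 : chi = 1 by move: E1 => [] + _ _ => /=; rewrite mulr1.
by rewrite E chi1 scale1r jaut_conj jconjK.
Qed.

End Automorphism.

Lemma jaut_cyc : jaut (@jcyc K).
Proof.
split=> //; exists (@jcyc K \o @jcyc K), 1.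
split; [by split; [exact: jcycK|exact: jcycK'] | exact: jcyc_linear | | |].
- by move=> X Y; rewrite /jherm -(jform_cyc X); case: Y.
- by rewrite rmorph1 mulr1.
by move=> X; rewrite jnorm_cyc mul1r.
Qed.

Lemma jaut_trial u : oconj u = u -> odot u u = 1 -> jaut (jtrial u).
Proof.
move=> ur u1; have u1' : odot (odia u) (odia u) = 1 by rewrite odot_dia.
split; last by apply: J6_eq; rewrite //= ?omul0l ?omul0r.
exists (jtrial (odia u)), 1; split.
- split; [exact: jtrialK|move=> X; rewrite -{1}[u]odiaK; exact: jtrialK].
- exact: jtrial_linear.
- move=> X Y; rewrite /jherm -(jform_trial X _ u1); congr jform.
  by case: Y => *; apply: J6_eq; rewrite //= !oconjM ?oconj_dia ur.
- by rewrite rmorph1 mulr1.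
by move=> X; rewrite jnorm_trial // mul1r.
Qed.

Lemma jaut_rot (c s : R) : c ^+ 2 + s ^+ 2 = 1 -> jaut (jrot c%:C s%:C).
Proof.
move=> E0; have E : c%:C ^+ 2 + s%:C ^+ 2 = 1.
  by rewrite -!rmorphXn -rmorphD E0.
have E' : c%:C ^+ 2 + (- s%:C) ^+ 2 = 1 by rewrite sqrrN.
split; last first.
  apply: J6_eq; rewrite //= ?oreE /=.
  - by rewrite mulr0 subr0 !mulr1.
  - by rewrite mulr0 addr0 !mulr1 addrC.
  - by rewrite odia0 !scaler0 addr0.
  - by rewrite odia0 !scaler0 subr0.
  - by rewrite subrr !mulr0 subr0 scaler0 add0r O8_scal.
exists (jrot c%:C (- s%:C)), 1; split.
- split; first exact: jrotK.
  by move=> X; rewrite -{1}[s%:C]opprK; exact: jrotK.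
- exact: jrot_linear.
- move=> X Y; rewrite /jherm -(jform_rot X _ E); congr jform.
  case: Y => *; apply: J6_eq; rewrite //= ?ore_conj ?oconjD ?oconjN ?oconjZ ?oconj_dia ?oconj_scal;
  rewrite ?(rmorphB, rmorphD, rmorphM, rmorphXn, rmorph_nat) /= ?rmorph_nat ?oppr0 //.
- by rewrite rmorph1 mulr1.
by move=> X; rewrite jnorm_rot // mul1r.
Qed.

Lemma structure_phase d1 d2 d3 : d1 * conjc d1 = 1 -> d2 * conjc d2 = 1 ->
  d3 * conjc d3 = 1 -> structure_map (@jphase K d1 d2 d3).
Proof.
move=> E1 E2 E3; exists (jphase (conjc d1) (conjc d2) (conjc d3)), ((d1 * d2 * d3) ^+ 2).
split.
- split=> X; rewrite jphaseM; last by rewrite E1 E2 E3 jphase1.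
  by rewrite ![conjc _ * _]mulrC E1 E2 E3 jphase1.
- exact: jphase_linear.
- move=> X Y; rewrite /jherm -(jform_phase X _ E1 E2 E3); congr jform.
  by case: Y => *; apply: J6_eq; rewrite /= ?oconjZ ?rmorphM ?rmorphXn.
- rewrite rmorphXn -exprMn !rmorphM.
  have -> : d1 * d2 * d3 * (conjc d1 * conjc d2 * conjc d3) =
    (d1 * conjc d1) * (d2 * conjc d2) * (d3 * conjc d3) by ring.
  by rewrite E1 E2 E3 !mulr1 expr1n.
by move=> X; rewrite jnorm_phase.
Qed.

End Diagonalisation.

Section RealDiagonalisation.
Variable R : rcfType.
Local Notation K := R[i].
Local Notation oct := (octonion K).
Local Notation J := (albert K).
Local Notation "x %:C" := (real_complex R x) : ring_scope.
Implicit Types (k : K) (x y z : oct) (X Y Z U : J).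

Lemma jacobi (t d : R) : t != 0 ->
  exists c s, c ^+ 2 + s ^+ 2 = 1 /\ t * (c ^+ 2 - s ^+ 2) + c * s * d = 0.
Proof.
move=> t0; pose q := d / (2 * t); pose r := Num.sqrt (q ^+ 2 + 1).
have r2 : r ^+ 2 = q ^+ 2 + 1 by rewrite sqr_sqrtr // addr_ge0 ?sqr_ge0.
(* [m] is the tangent [s / c] of the rotation angle, a root of [t (1 - m^2) + m d = 0]. *)
pose m := q + r; have m2 : m ^+ 2 = 2 * q * m + 1.
  by rewrite /m sqrrD r2 mulr2n; ring.
have n0 : 0 < 1 + m ^+ 2 by rewrite ltr_wpDr ?sqr_ge0.
pose n := Num.sqrt (1 + m ^+ 2); have n2 : n ^+ 2 = 1 + m ^+ 2.
  by rewrite sqr_sqrtr // ltW.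
have nn0 : n != 0 by rewrite -sqrf_eq0 n2 gt_eqF.
exists n^-1, (m / n); split.
  rewrite exprMn exprVn -[X in X + _]mul1r -mulrDl n2 divff // gt_eqF //.
have -> : n^-1 * (m / n) * d = (2 * t * q) * m * n^-1 ^+ 2.
  by rewrite /q; field; rewrite t0 nn0.
rewrite exprMn -[X in X - _]mul1r -mulrBl m2; ring.
Qed.

(** A triality map makes [z] a real scalar, and a Jacobi rotation then clears it. The last clauses
    record what must survive for later use: off-diagonal entries already cleared stay cleared, and a
    diagonal element whose first two entries agree is not disturbed. *)
Lemma jz_block X : jconj X = X -> exists g, [/\ jaut g, jz (g X) = 0,
  jc (g X) = jc X, jx X = 0 -> jy X = 0 -> jx (g X) = 0 /\ jy (g X) = 0 &
  forall a c, g (jdiag a a c) = jdiag a a c].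
Proof.
case: X => a b c x y z /= [/conjc_fix ra /conjc_fix rb _ _ _ rz].
have [r r0 [zz z0]] := oct_real rz.
have [rE|rN0] := eqVneq r 0; first by exists id; split; rewrite ?z0 //; exact: jaut_id.
have rC : (r%:C)^-1 != 0 by rewrite invr_eq0 -(inj_eq (@complexI _)) in rN0 *.
(* Chosen so that [omul u z] is the scalar [r], the length of [z]. *)
pose u := (r%:C)^-1 *: odia z.
have ur : oconj u = u by rewrite oconjZ oconj_dia rz fmorphV /= oppr0.
have u1 : odot u u = 1.
  rewrite odotZl odotZr odot_dia zz rmorphXn mulrA -invfM -expr2 mulVf //.
  by rewrite expf_neq0 // -invr_eq0.
have uz : omul u z = oscal r%:C.
  rewrite omulZl -{2}[z]odiaK omul_dia odot_dia zz oscalZ rmorphXn expr2 mulKf //.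
  by rewrite -invr_eq0.
have [p [s [ps E]]] := jacobi (complex.Re a - complex.Re b) rN0.
exists (jrot p%:C s%:C \o jtrial u); split => /=.
- by apply: jaut_comp; [exact: jaut_rot|exact: jaut_trial].
- have E1 : p%:C ^+ 2 + s%:C ^+ 2 = 1 by rewrite -!rmorphXn -rmorphD ps.
  rewrite E1 scale1r uz ore_scal.
  have oscD (m n : K) : oscal m + oscal n = oscal (m + n).
    by rewrite -[oscal m]/(_) -(mulr1 m) -(mulr1 n) -!oscalZ -scalerDl oscalZ mulrDl.
  have E' : r%:C * (p%:C ^+ 2 - s%:C ^+ 2) + p%:C * s%:C * (a - b) = 0.
    by rewrite ra rb -!rmorphXn -!rmorphB -!rmorphM -rmorphD E.
  rewrite oscD; set m := _ + _; suff -> : m = 0 by rewrite O8_scal.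
  rewrite -E' /m -[X in X + _]mul1r -[X in X * _ + _ = _]E1; ring.
- by [].
- by move=> -> ->; rewrite !(omul0l, omul0r, odia0, scaler0, addr0, subr0).
have E1 : p%:C ^+ 2 + s%:C ^+ 2 = 1 by rewrite -!rmorphXn -rmorphD ps.
have ore0 : ore (0 : oct) = 0 by rewrite oreE.
move=> m n; rewrite !omul0l !omul0r !odia0 !ore0; apply: J6_eq => //.
- by transitivity ((p%:C ^+ 2 + s%:C ^+ 2) * m); [ring|rewrite E1 mul1r].
- by transitivity ((p%:C ^+ 2 + s%:C ^+ 2) * m); [ring|rewrite E1 mul1r].
- by rewrite !scaler0 addr0.
- by rewrite !scaler0 subr0.
by rewrite scaler0 add0r subrr !mulr0 subr0 O8_scal.
Qed.

Lemma jx_block X : jconj X = X -> exists g, [/\ jaut g, jx (g X) = 0,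
  ja (g X) = ja X, jy X = 0 -> jz X = 0 -> jy (g X) = 0 /\ jz (g X) = 0 &
  forall a c, g (jdiag c a a) = jdiag c a a].
Proof.
move=> rX; have rX' : jconj (jcyc X) = jcyc X by rewrite (jaut_conj (jaut_cyc R)) rX.
have [g [Ag E1 E2 E3 E4]] := jz_block rX'.
exists (@jcyc K \o @jcyc K \o g \o @jcyc K); split=> /=.
- by do ![apply: jaut_comp => //; try exact: jaut_cyc].
- by case: (g _) E1.
- by case: (X) (g _) E2 => ? ? ? ? ? ? [].
- by case: (X) (g _) E3 => ? ? ? ? ? ? [].
by move=> a c; rewrite E4.
Qed.

Lemma jy_block X : jconj X = X -> exists g, [/\ jaut g, jy (g X) = 0,
  jb (g X) = jb X, jz X = 0 -> jx X = 0 -> jz (g X) = 0 /\ jx (g X) = 0 &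
  forall a c, g (jdiag a c a) = jdiag a c a].
Proof.
move=> rX; have rX' : jconj (jcyc X) = jcyc X by rewrite (jaut_conj (jaut_cyc R)) rX.
have [g [Ag E1 E2 E3 E4]] := jx_block rX'.
exists (@jcyc K \o @jcyc K \o g \o @jcyc K); split=> /=.
- by do ![apply: jaut_comp => //; try exact: jaut_cyc].
- by case: (g _) E1.
- by case: (X) (g _) E2 => ? ? ? ? ? ? [].
- by case: (X) (g _) E3 => ? ? ? ? ? ? [].
by move=> a c; rewrite E4.
Qed.

Lemma jaut_real g X : jaut g -> jconj X = X -> jconj (g X) = g X.
Proof. by move=> Ag rX; rewrite jaut_conj // rX. Qed.

Lemma albert_eta X : X = J6 (ja X) (jb X) (jc X) (jx X) (jy X) (jz X).
Proof. by case: X. Qed.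

(** Once [z] is cleared, the vanishing adjoint gives [a b = 0], [b c = odot x x] and
    [c a = odot y y]. So [x] or [y] is real and isotropic, hence zero, and a second rotation clears
    the other one. One of the two diagonal entries in the rotated block then vanishes as well, and
    [jcyc] moves the surviving entry to the first place. *)
Lemma rank_one_diag X : jconj X = X -> jadj X = 0 ->
  exists g k, jaut g /\ g X = jdiag k 0 0.
Proof.
move=> rX X0; have [g [Ag gz _ _ _]] := jz_block rX.
have := jaut_adj Ag X; rewrite X0 (structure0 Ag.1).
have := jaut_real Ag rX.
case EgX: (g X) gz => [a b c x y z] /= z0 [_ _ _ rx ry _].
rewrite z0 in EgX *; rewrite jadjE omul0l omul0r odot0l.
case/J6_inj => /= /eqP; rewrite subr_eq0 => /eqP bc /eqP.
rewrite subr_eq0 => /eqP ca /eqP; rewrite subr0 mulf_eq0 => ab _.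
case/orP: ab => [/eqP a0|/eqP b0].
  have y0 : y = 0 by apply: oct_real_eq0 => //; rewrite -ca a0 mulr0.
  have rgX := jaut_real Ag rX.
  have [h [Ah hx ha hyz _]] := jx_block rgX.
  rewrite EgX in hx ha hyz; have [//|//|hy hz] := hyz.
  have := jaut_adj Ah (g X); rewrite (jaut_adj Ag) X0 (structure0 Ag.1) (structure0 Ah.1).
  rewrite EgX; case Eh: (h _) hx ha hy hz => [a' b' c' x' y' z'] /= E1 E2 E3 E4.
rewrite {}E1 {}E2 {}E3 {}E4 in Eh *.
  rewrite jadjE a0 odot0l => /J6_inj[/= /eqP]; rewrite subr0 mulf_eq0 => bc' _ _ _.
  case/orP: bc' => /eqP E.
    exists (@jcyc K \o @jcyc K \o h \o g), c'; split.
      by do ![apply: jaut_comp => //; try exact: jaut_cyc].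
    by rewrite /= EgX Eh E a0.
  exists (@jcyc K \o h \o g), b'; split.
    by do ![apply: jaut_comp => //; try exact: jaut_cyc].
  by rewrite /= EgX Eh E a0.
have x0 : x = 0 by apply: oct_real_eq0 => //; rewrite -bc b0 mul0r.
have rgX := jaut_real Ag rX.
have [h [Ah hy hb hzx _]] := jy_block rgX.
rewrite EgX in hy hb hzx; have [//|//|hz hx] := hzx.
have := jaut_adj Ah (g X); rewrite (jaut_adj Ag) X0 (structure0 Ag.1) (structure0 Ah.1).
rewrite EgX; case Eh: (h _) hx hb hy hz => [a' b' c' x' y' z'] /= E1 E2 E3 E4.
rewrite {}E1 {}E2 {}E3 {}E4 in Eh *.
rewrite jadjE b0 odot0l => /J6_inj[/= _ /eqP]; rewrite subr0 mulf_eq0 => ca' _ _.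
case/orP: ca' => /eqP E.
  exists (h \o g), a'; split; first exact: jaut_comp.
  by rewrite /= EgX Eh E b0.
exists (@jcyc K \o @jcyc K \o h \o g), c'; split.
  by do ![apply: jaut_comp => //; try exact: jaut_cyc].
by rewrite /= EgX Eh E b0.
Qed.

End RealDiagonalisation.

(** * The characteristic cubic and the spectral theorem for self-adjoint elements *)

Section CharacteristicPolynomial.
Variable K : comNzRingType.
Implicit Types (k : K) (X Y : albert K).

Lemma jnorm_char X k : jnorm (X - k *: jone K) =
  jnorm X - k * jform (jone K) (jadj X) + k ^+ 2 * jform (jone K) X - k ^+ 3.
Proof.
case: X => a b c x y z.
rewrite jadjE /jone /jdiag J6Z J6N J6D !scaler0 !subr0 !jnormE !jformE !odot0l.
by ring.
Qed.

Lemma jnorm_diag a b c : jnorm (jdiag a b c) = a * b * c :> K.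
Proof. by rewrite jnormE omul0l !odot0l; ring. Qed.

End CharacteristicPolynomial.

Section RealSpectralTheorem.
Variable R : rcfType.
Local Notation K := R[i].
Local Notation oct := (octonion K).
Local Notation J := (albert K).
Local Notation "x %:C" := (real_complex R x) : ring_scope.
Implicit Types (k : K) (x y z : oct) (X Y Z U : J).

Lemma cubic_root (p q r : R) : exists t, t ^+ 3 + p * t ^+ 2 + q * t + r = 0.
Proof.
pose f : {poly R} := 'X^3 + p *: 'X^2 + q *: 'X + r%:P.
(* At [B] and [- B] the leading term dominates, so the cubic changes sign between them. *)
pose B := 1 + `|p| + `|q| + `|r|.
have fE t : f.[t] = t ^+ 3 + p * t ^+ 2 + q * t + r by rewrite /f !hornerE.
have B1 : 1 <= B by rewrite /B -!addrA lerDl !addr_ge0.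
have B0 : 0 <= B by rewrite (le_trans _ B1).
have bnd : `|p| * B ^+ 2 + `|q| * B + `|r| <= B ^+ 3.
  have -> : B ^+ 3 = B ^+ 2 + `|p| * B ^+ 2 + `|q| * B ^+ 2 + `|r| * B ^+ 2.
    by rewrite /B; ring.
  have Bsq : B <= B ^+ 2 by rewrite expr2 ler_peMl.
  have Bsq1 : 1 <= B ^+ 2 by rewrite (le_trans B1).
  have H1 : `|q| * B <= `|q| * B ^+ 2 by rewrite ler_wpM2l.
  have H2 : `|r| <= `|r| * B ^+ 2 by rewrite ler_peMr.
  have H3 : 0 <= B ^+ 2 by rewrite sqr_ge0.
  lra.
have A (s t : R) : 0 <= t -> - (`|s| * t) <= s * t <= `|s| * t.
  by move=> t0; rewrite -real_ler_norml ?num_real // normrM (ger0_norm t0).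
have /andP[p1 p2] := A p (B ^+ 2) (sqr_ge0 _).
have /andP[q1 q2] := A q B B0.
have /andP[r1 r2] : - `|r| <= r <= `|r| by rewrite -real_ler_norml ?num_real.
have [||t _ /rootP] := @Num.Theory.poly_ivt _ f (- B) B; first by lra.
  rewrite !fE sqrrN; have -> : (- B) ^+ 3 = - B ^+ 3 by ring.
  by apply/andP; split; lra.
by rewrite fE; exists t.
Qed.

Lemma jconj_eqP X : jconj X = X -> [/\ ja X = (complex.Re (ja X))%:C,
  jb X = (complex.Re (jb X))%:C & jc X = (complex.Re (jc X))%:C].
Proof. by case: X => a b c x y z [/conjc_fix + /conjc_fix + /conjc_fix]. Qed.

Lemma jform_real X Y : jconj X = X -> jconj Y = Y ->
  jform X Y = (complex.Re (jform X Y))%:C.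
Proof. by move=> rX rY; apply: conjc_fix; rewrite jconj_form rX rY. Qed.

Lemma jadj_real X : jconj X = X -> jconj (jadj X) = jadj X.
Proof.
move=> rX; apply: (@scalerI _ _ (2 : K)); first by rewrite pnatr_eq0.
by rewrite -{1}(rmorph_nat (@conjc R)) -jconjZ -jcross_adj jconj_cross rX.
Qed.

Lemma jreal_shift X (t : R) : jconj X = X ->
  jconj (X - t%:C *: jone K) = X - t%:C *: jone K.
Proof.
by move=> rX; rewrite jconjD jconjN jconjZ rX jone_conj conjc_real.
Qed.

Lemma jone_diag k : k *: jone K = jdiag k k k.
Proof. by rewrite /jone /jdiag J6Z !mulr1 !scaler0. Qed.

(** After subtracting a root of the characteristic cubic the norm vanishes, so the adjoint is of
    rank one and can be moved to [jdiag k 0 0]. If [k = 0], the element itself is of rank one.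
    Otherwise its pairing with the adjoint clears the first diagonal entry, the last two diagonal
    entries of the adjoint clear [y] and [z], and one rotation of the remaining block finishes. *)
Lemma jdiag_real X : jconj X = X ->
  exists g (a b c : R), jaut g /\ g X = jdiag a%:C b%:C c%:C.
Proof.
move=> rX; suff [g [a [b [c [Ag gX]]]]] : exists g a b c, jaut g /\ g X = jdiag a b c.
  have := jaut_real Ag rX; rewrite gX => /jconj_eqP[/= ra rb rc].
  exists g, (complex.Re a), (complex.Re b), (complex.Re c); split=> //.
  by rewrite -ra -rb -rc.
have [t tE] : exists t : R, jnorm (X - t%:C *: jone K) = 0.
  have [t E] := cubic_root (- complex.Re (jform (jone K) X))
    (complex.Re (jform (jone K) (jadj X))) (- complex.Re (jnorm X)).
  exists t; rewrite jnorm_char (jform_real (jone_conj _) rX).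
  rewrite (jform_real (jone_conj _) (jadj_real rX)).
  rewrite [jnorm X]conjc_fix; last by rewrite jconj_norm rX.
  rewrite -!rmorphXn -!rmorphM -rmorphB -rmorphD -rmorphB -[RHS](rmorph0 (real_complex R)).
  by congr _%:C; rewrite -oppr0 -[in RHS]E; ring.
set Y := X - _ in tE; have rY : jconj Y = Y by exact: jreal_shift.
suff [g [a [b [c [Ag gY]]]]] : exists g a b c, jaut g /\ g Y = jdiag a b c.
  exists g, (a + t%:C), (b + t%:C), (c + t%:C); split=> //.
  have -> : X = Y + t%:C *: jone K by rewrite subrK.
  by rewrite (structureD Ag.1) (structureZ Ag.1) Ag.2 gY jone_diag J6D !addr0.
move: Y tE rY => {t rX}Y NY rY {X}.
have QQ : jadj (jadj Y) = 0 by rewrite jadjK NY scale0r.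
have [g [k [Ag gQ]]] := rank_one_diag (jadj_real rY) QQ.
have [k0|kN0] := eqVneq k 0.
  have Y0 : jadj Y = 0.
    by apply: (structure_inj Ag.1); rewrite gQ k0 (structure0 Ag.1).
  by have [h [a [Ah hY]]] := rank_one_diag rY Y0; exists h, a, 0, 0.
rewrite -jaut_adj // in gQ.
have rgY := jaut_real Ag rY; have NgY := jaut_norm Ag Y.
case EgY: (g Y) => [a b c x y z]; rewrite EgY in rgY gQ NgY.
(* The product [k * a] is the pairing of the element with its adjoint, that is, three times its
   norm. *)
have a0 : a = 0.
  have := jform_adj (J6 a b c x y z); rewrite NgY NY gQ jformE !odot0l mulr0.
  by rewrite !mul0r !addr0 mulr0 addr0 => /eqP; rewrite mulf_eq0 (negPf kN0) => /eqP.
move: gQ rgY; rewrite jadjE a0 mulr0 mul0r !sub0r.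
move=> /J6_inj[/= _ yy zz _] /J6_inj[_ _ _ [/= _ ry rz]].
have y0 : y = 0 by apply: oct_real_eq0 => //; apply/eqP; rewrite -oppr_eq0 yy.
have z0 : z = 0 by apply: oct_real_eq0 => //; apply/eqP; rewrite -oppr_eq0 zz.
have rgY := jaut_real Ag rY.
have [h [Ah hx ha hyz _]] := jx_block rgY.

rewrite EgY /= in hx hyz; have [//|//|hy hz] := hyz.
exists (h \o g), (ja (h (g Y))), (jb (h (g Y))), (jc (h (g Y))); split.
  exact: jaut_comp.
by rewrite [LHS]albert_eta /= EgY hx hy hz.
Qed.

End RealSpectralTheorem.

Section AlbertExpansion.
Variable K : comNzRingType.
Implicit Types (k : K) (X Y : albert K).

Lemma jformNl X Y : jform (- X) Y = - jform X Y.
Proof. by rewrite -scaleN1r jformZl mulN1r. Qed.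

Lemma jformNr X Y : jform X (- Y) = - jform X Y.
Proof. by rewrite ![jform X _]jformC jformNl. Qed.

Lemma jcrossNl X Y : jcross (- X) Y = - jcross X Y.
Proof. by rewrite -scaleN1r jcrossZl scaleN1r. Qed.

Lemma jcrossNr X Y : jcross X (- Y) = - jcross X Y.
Proof. by rewrite ![jcross X _]jcrossC jcrossNl. Qed.

End AlbertExpansion.

Ltac jform_expand := rewrite ?(jcrossDl, jcrossDr, jcrossZl, jcrossZr, jcrossNl,
  jcrossNr) ?(jformDl, jformDr, jformZl, jformZr, jformNl, jformNr).
(* linear identities over the Albert algebra, with cross products as atoms *)
Ltac albert_module := apply: jform_ext => ?; jform_expand; ring.

(** * Unitary elements and the transitive action on them *)

Section Unitaries.
Variable R : rcfType.
Local Notation K := R[i].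
Local Notation oct := (octonion K).
Local Notation J := (albert K).
Local Notation "x %:C" := (real_complex R x) : ring_scope.
Implicit Types (k : K) (x y z : oct) (X Y Z U : J).

(* twice the triple product of the Cartan factor *)
Definition jtrip X Y Z : J := jtriple X (jconj Y) Z.

Definition junitary U := forall X, jtrip U U X = 2 *: X.

Lemma structure_trip g X Y Z : structure_map g ->
  jtrip (g X) (g Y) (g Z) = g (jtrip X Y Z).
Proof. by move=> Sg; rewrite /jtrip structure_triple. Qed.

Lemma junitary_one : junitary (jone K).
Proof.
move=> X; rewrite /jtrip jone_conj /jtriple jcross_one jcrossC jcrossDr jcrossNr.
rewrite jcrossZr !jcross_one !jform_one /= [jform X _]jformC jform_one.
albert_module.
Qed.

Lemma junitary_structure g U : structure_map g -> junitary U -> junitary (g U).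
Proof.
move=> Sg HU X; have [h [Sh gK hK]] := structure_inv Sg.
by rewrite -[X]hK structure_trip // HU structureZ.
Qed.

Lemma sqrtC_unit k : k * conjc k = 1 -> sqrtC k * conjc (sqrtC k) = 1.
Proof.
move=> k1; have E : (sqrtC k * conjc (sqrtC k)) ^+ 2 = 1 ^+ 2.
  by rewrite exprMn -rmorphXn /= sqrtCK k1 expr1n.
have /eqP := E; rewrite eqf_sqr => /orP[/eqP //|/eqP E'].
have : 0 <= sqrtC k * conjc (sqrtC k) by exact: mul_conjC_ge0.
by rewrite E' oppr_ge0 lt_geF // ltr01.
Qed.

Fact jtrip_E1_z X Y : jz (jtrip X Y (jdiag 1 0 0)) =
  conjc (ja Y) *: jz X + odia (omul (jx X) (oconj (jy Y))) + jb X *: oconj (jz Y).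
Proof.
case: X => a b c x y z; case: Y => a' b' c' x' y' z'.
rewrite /jtrip /jtriple /jconj /jdiag !jcrossE !jformE /=.
rewrite !(odot0r, odot0l, omul0l, omul0r, scaler0, scale0r, odia0, mulr0, mul0r,
  mulr1, mul1r, addr0, add0r, subr0, sub0r, oppr0, scale1r).
rewrite omulNl odiaN; oct_module.
Qed.

Fact jtrip_E1_a X Y : ja (jtrip X Y (jdiag 1 0 0)) =
  2 * ja X * conjc (ja Y) + 2 * (odot (jy X) (oconj (jy Y)) + odot (jz X) (oconj (jz Y))).
Proof.
case: X => a b c x y z; case: Y => a' b' c' x' y' z'.
rewrite /jtrip /jtriple /jconj /jdiag !jcrossE !jformE /=.
rewrite !(odot0r, odot0l, omul0l, omul0r, scaler0, scale0r, odia0, mulr0, mul0r,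
  mulr1, mul1r, addr0, add0r, subr0, sub0r, oppr0, scale1r).
by rewrite odotNl; ring.
Qed.

(** The hypotheses say that the off-diagonal entries are purely imaginary. Subtracting from the [jz]
    entry of the unitarity equation at [jdiag 1 0 0] its conjugate cancels the octonion product and
    leaves a multiple of [jz U] by twice the difference of the real parts. *)
Fact junitary_z U : junitary U -> oconj (jx U) = - jx U ->
  oconj (jy U) = - jy U -> oconj (jz U) = - jz U ->
  complex.Re (ja U) != complex.Re (jb U) -> jz U = 0.
Proof.
move=> HU rx ry rz ab; have E := congr1 (@jz K) (HU (jdiag 1 0 0)).
rewrite jtrip_E1_z ry rz /= scaler0 in E.
have E' := congr1 (@oconj R) E; move: E E'.
rewrite !oconjD !oconjZ oconj_dia oconjM !oconjN conjcK oconj0 rx ry rz.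
rewrite !opprK !omulNl !omulNr odiaN => E E'.
have : (2 * (complex.Re (ja U) - complex.Re (jb U))%:C) *: jz U = 0.
  rewrite -[RHS](subrr 0) -{1}E -E'.
  have -> : 2 * (complex.Re (ja U) - complex.Re (jb U))%:C =
    conjc (ja U) + ja U - jb U - conjc (jb U).
    by case: (ja U) (jb U) => [p q] [p' q']; apply/eqP; rewrite eq_complex /=;
      apply/andP; split; apply/eqP; ring.
  oct_module.
move/eqP; rewrite scaler_eq0 mulf_eq0 pnatr_eq0 /= => /orP[|/eqP //].
by rewrite (inj_eq (@complexI R) _ 0) subr_eq0 (negPf ab).
Qed.

(* Real parts that can be told apart are separated by the previous lemma;
   within equal ones the imaginary part can be diagonalised freely. *)
Lemma junitary_diag U : junitary U -> exists g a b c, jaut g /\ g U = jdiag a b c.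
Proof.
move=> HU0.
have [f [d1 [d2 [d3 [Af fA]]]]] : exists f (a b c : R), jaut f /\
    f (U + jconj U) = jdiag a%:C b%:C c%:C.
  by apply: jdiag_real; rewrite jconjD jconjK addrC.
suff [g [a [b [c [Ag gU]]]]] : exists g a b c, jaut g /\ g (f U) = jdiag a b c.
  by exists (g \o f), a, b, c; split=> //; exact: jaut_comp.
have HU := junitary_structure Af.1 HU0.
rewrite (structureD Af.1) -(jaut_conj Af) in fA.
move: (f U) HU fA => {U HU0 f Af}U HU DU.
(* Up to the factor -2 this is the imaginary part of [U]. Since [U] is recovered from [B] and
   [U + jconj U], one automorphism has to diagonalise both. *)
pose B := 'i%C *: (U - jconj U).
have rB : jconj B = B.
  rewrite jconjZ jconjD jconjN jconjK.
  have -> : conjc 'i%C = - 'i%C :> K by apply/eqP; rewrite eq_complex /= oppr0 !eqxx.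
  by albert_module.
suff [g [Ag [a [b [c gD]]] [a' [b' [c' gB]]]]] : exists g, [/\ jaut g,
    exists a b c, g (U + jconj U) = jdiag a b c & exists a b c, g B = jdiag a b c].
  have -> : U = 2^-1 *: ((U + jconj U) - 'i%C *: B).
    rewrite /B scalerA -expr2 sqr_i; apply: (@scalerI _ _ (2 : K)).
      by rewrite pnatr_eq0.
    by rewrite scalerA divff ?pnatr_eq0 //; albert_module.
  exists g, (2^-1 * (a - 'i%C * a')), (2^-1 * (b - 'i%C * b')), (2^-1 * (c - 'i%C * c')).
  split=> //; rewrite (structureZ Ag.1) (structureB Ag.1) gD (structureZ Ag.1) gB.
  by apply: J6_eq; rewrite //= !scaler0 subr0 scaler0.
have [/= Da Db Dc [/= Dx Dy Dz]] := J6_inj DU.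
have dx k d : k + conjc k = d%:C -> d = 2 * complex.Re k.
  by case: k => p q [<- _] /=; ring.
move: Da Db Dc => /dx da /dx db /dx dc.
have rx : oconj (jx U) = - jx U by apply/eqP; rewrite -addr_eq0 addrC Dx.
have ry : oconj (jy U) = - jy U by apply/eqP; rewrite -addr_eq0 addrC Dy.
have rz : oconj (jz U) = - jz U by apply/eqP; rewrite -addr_eq0 addrC Dz.
have neq (p q : R) : 2 * p != 2 * q -> p != q.
  by apply: contra_neq => ->.
have z0 : d1 != d2 -> jz U = 0.
  by rewrite da db => /neq; exact: junitary_z.
have x0 : d2 != d3 -> jx U = 0.
  rewrite db dc => /neq bc.
  have := junitary_z (junitary_structure (jaut_cyc R).1 HU).
  by case: (U) rx ry rz bc => ? ? ? ? ? ? /= rx ry rz bc /(_ ry rz rx bc).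
have y0 : d1 != d3 -> jy U = 0.
  rewrite da dc eq_sym => /neq ca.
  have := junitary_z (junitary_structure (jaut_cyc R).1
    (junitary_structure (jaut_cyc R).1 HU)).
  by case: (U) rx ry rz ca => ? ? ? ? ? ? /= rx ry rz ca /(_ rz rx ry ca).
have diagB X : jx X = 0 -> jy X = 0 -> jz X = 0 -> exists a b c, X = jdiag a b c.
  by case: X => a b c x y z /= -> -> ->; exists a, b, c.
have Bx : jx U = 0 -> jx B = 0 by move=> E; rewrite /B /= rx E opprK addr0 scaler0.
have By : jy U = 0 -> jy B = 0 by move=> E; rewrite /B /= ry E opprK addr0 scaler0.
have Bz : jz U = 0 -> jz B = 0 by move=> E; rewrite /B /= rz E opprK addr0 scaler0.
rewrite DU; move: (B) rB Bx By Bz => {}B rB Bx By Bz.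
have [d12|/[dup] d12 /z0/Bz {}Bz] := eqVneq d1 d2;
  have [d23|/[dup] d23 /x0/Bx {}Bx] := eqVneq d2 d3.
- have [g [a [b [c [Ag gB]]]]] := jdiag_real rB.
  exists g; split; [exact: Ag| |by do 3! eexists; exact: gB].
  by exists d3%:C, d3%:C, d3%:C; rewrite d12 d23 -jone_diag (structureZ Ag.1) Ag.2.
- have By0 : jy B = 0 by apply/By/y0; rewrite d12.
  have [g [Ag gz _ /(_ Bx By0)[gx gy] gD]] := jz_block rB.
  by exists g; split; [exact: Ag|rewrite d12 gD; do 3! eexists; reflexivity|exact: diagB].
- have By0 : jy B = 0 by apply/By/y0; rewrite -d23.
  have [g [Ag gx _ /(_ By0 Bz)[gy gz] gD]] := jx_block rB.
  by exists g; split; [exact: Ag|rewrite d23 gD; do 3! eexists; reflexivity|exact: diagB].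
have [d13|/y0/By {}By] := eqVneq d1 d3.
  have [g [Ag gy _ /(_ Bz Bx)[gz gx] gD]] := jy_block rB.
  by exists g; split; [exact: Ag|rewrite d13 gD; do 3! eexists; reflexivity|exact: diagB].
by exists id; split; [exact: jaut_id|do 3! eexists; reflexivity|exact: diagB].
Qed.

Lemma junitary_diagP a b c : junitary (jdiag a b c) ->
  [/\ a * conjc a = 1, b * conjc b = 1 & c * conjc c = 1].
Proof.
have H p q r : junitary (jdiag p q r) -> p * conjc p = 1.
  move/(_ (jdiag 1 0 0))/(congr1 (@ja K)); rewrite jtrip_E1_a /= oconj0 odot0l.
  rewrite addr0 !mulr0 addr0 -mulrA => /(mulfI _) -> //; by rewrite pnatr_eq0.
move=> HU; split; first exact: H HU.
  exact: H (junitary_structure (jaut_cyc R).1 HU).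
exact: H (junitary_structure (jaut_cyc R).1 (junitary_structure (jaut_cyc R).1 HU)).
Qed.

Lemma junitary_one_transitive U : junitary U ->
  exists2 g, structure_map g & g U = jone K.
Proof.
move=> HU; have [g [a [b [c [Ag gU]]]]] := junitary_diag HU.
have := junitary_structure Ag.1 HU; rewrite gU => /junitary_diagP[a1 b1 c1].
have V k : k * conjc k = 1 -> exists d, d ^+ 2 * k = 1 /\ d * conjc d = 1.
  (* Phases act on diagonal entries by their squares, whence a square root of the inverse [conjc k]
     of [k]. *)
  move=> k1; exists (sqrtC (conjc k)); rewrite sqrtCK mulrC k1; split=> //.
  by apply: sqrtC_unit; rewrite conjcK mulrC.
have [d1 [da e1]] := V a a1; have [d2 [db e2]] := V b b1; have [d3 [dc e3]] := V c c1.
exists (jphase d1 d2 d3 \o g).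
  exact: structure_comp (structure_phase e1 e2 e3) Ag.1.
by rewrite /= gU /jdiag /jphase da db dc !scaler0.
Qed.

Lemma junitaryP U : junitary U <-> exists2 g, structure_map g & g (jone K) = U.
Proof.
split=> [/junitary_one_transitive[g Sg gU]|[g Sg <-]]; last first.
  exact: junitary_structure junitary_one.
by have [h [Sh gK hK]] := structure_inv Sg; exists h; rewrite -?gU.
Qed.

End Unitaries.

(** * Frames of minimal tripotents *)

Section Frames.
Variable R : rcfType.
Local Notation K := R[i].
Local Notation J := (albert K).
Local Notation "x %:C" := (real_complex R x) : ring_scope.
Implicit Types (k : K) (X Y Z U V W : J) (v : 'I_3 -> J).

Definition jtripotent V := jtrip V V V = 2 *: V.

Definition jminimal V := [/\ jtripotent V, V <> 0 &
  forall X, jtrip V V X = 2 *: X -> exists k, X = k *: V].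

Definition jframe U v := [/\ forall j, jminimal (v j),
  forall i j, i != j -> jtrip (v i) (v i) (v j) = 0 &
  forall j, jtripotent (U - v j) /\ jtrip (U - v j) (U - v j) (v j) = 0].

(** Weaker than [structure_map], as nothing is said about the norm. Maps induced by Jordan
    automorphisms are at first only known to be of this kind, and it suffices for transporting
    frames. *)
Definition triple_iso (f : J -> J) := exists h,
  [/\ cancel f h /\ cancel h f, forall k X Y, f (k *: X + Y) = k *: f X + f Y &
      forall X Y Z, f (jtrip X Y Z) = jtrip (f X) (f Y) (f Z)].

Lemma structure_triple_iso g : structure_map g -> triple_iso g.
Proof.
move=> Sg; have [h [Sh gK hK]] := structure_inv Sg; exists h; split=> //.
  exact: structure_linear.
by move=> X Y Z; rewrite structure_trip.
Qed.

Section TripleIsomorphism.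
Variables (f : J -> J) (If : triple_iso f).

Lemma isoP k X Y : f (k *: X + Y) = k *: f X + f Y.
Proof. by case: If => h []. Qed.

Lemma iso0 : f 0 = 0.
Proof.
by have := isoP (-1) 0 0; rewrite !scaler0 addr0 scaleN1r addNr.
Qed.

Lemma isoD X Y : f (X + Y) = f X + f Y.
Proof. by have := isoP 1 X Y; rewrite !scale1r. Qed.

Lemma isoZ k X : f (k *: X) = k *: f X.
Proof. by have := isoP k X 0; rewrite !addr0 iso0 addr0. Qed.

Lemma isoB X Y : f (X - Y) = f X - f Y.
Proof. by rewrite isoD -scaleN1r isoZ scaleN1r. Qed.

Lemma iso_sum v (a : 'I_3 -> K) :
  f (\sum_j a j *: v j) = \sum_j a j *: f (v j).
Proof. by rewrite !big_ord_recl !big_ord0 !isoD !isoZ iso0. Qed.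

Lemma iso_trip X Y Z : f (jtrip X Y Z) = jtrip (f X) (f Y) (f Z).
Proof. by case: If => h []. Qed.

Lemma iso_inj : injective f.
Proof. by case: If => h [[/can_inj]]. Qed.

Lemma iso_tripotent V : jtripotent V -> jtripotent (f V).
Proof. by move=> HV; rewrite /jtripotent -iso_trip HV isoZ. Qed.

Lemma iso_minimal V : jminimal V -> jminimal (f V).
Proof.
case=> HV V0 Vm; split; first exact: iso_tripotent.
  by move=> fV; apply/V0/iso_inj; rewrite fV iso0.
case: (If) => h [[fK hK] _ _] X; rewrite -[X]hK -iso_trip -isoZ => /iso_inj.
by move=> /Vm[k ->]; exists k; rewrite isoZ.
Qed.

Lemma iso_frame U v : jframe U v -> jframe (f U) (f \o v).
Proof.
case=> Hm Ho Hl; split=> [j|j k jk|j] /=; first exact: iso_minimal.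
  by rewrite -iso_trip Ho // iso0.
by have [H1 H2] := Hl j; rewrite -isoB -iso_trip H2 iso0; split=> //; exact: iso_tripotent.
Qed.

Lemma iso_unitary U : junitary U -> junitary (f U).
Proof.
by case: (If) => h [[fK hK] _ _] HU X; rewrite -[X]hK -iso_trip HU isoZ.
Qed.

End TripleIsomorphism.

Lemma jconj_triple X Y Z :
  jconj (jtriple X Y Z) = jtriple (jconj X) (jconj Y) (jconj Z).
Proof. by rewrite /jtriple !jconjD jconjN !jconjZ !jconj_form !jconj_cross. Qed.

(** Both sides are twice the Jordan product, which is commutative. *)
Lemma jtriple_one_sym X Y : jtriple X Y (jone K) = jtriple Y X (jone K).
Proof.
rewrite /jtriple ![jcross _ (jone K)]jcrossC !jcross_one.
rewrite !jcrossDl !jcrossZl !jcrossNl !jcross_one (jcrossC Y X) (jformC Y X).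
albert_module.
Qed.

(* An element below the unit is self-adjoint, since [{w,w,1} = w] for its
   complement [w]. *)
Lemma jtripotent_le1_real V : jtripotent (jone K - V) ->
  jtrip (jone K - V) (jone K - V) V = 0 -> jconj V = V.
Proof.
set W := _ - _ => HW HV.
have E : jtrip W W (jone K) = 2 *: W.
  have -> : jone K = W + V by rewrite subrK.
  transitivity (jtrip W W W + jtrip W W V); last by rewrite HW HV addr0.
  by rewrite /jtrip /jtriple; albert_module.
have : jconj W = W.
  apply: (@scalerI _ _ (2 : K)); first by rewrite pnatr_eq0.
  rewrite -[in LHS](rmorph_nat (@conjc R)) -jconjZ -E.
  by rewrite /jtrip jconj_triple jconjK jone_conj jtriple_one_sym.
by rewrite jconjD jconjN jone_conj => /addrI/oppr_inj.
Qed.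

Definition jE (j : 'I_3) : J := jdiag (j == 0)%:R (j == 1)%:R (j == 2)%:R.

Lemma jtrip_diag a b c X : jtrip (jdiag a b c) (jdiag a b c) X =
  J6 (2 * (a * conjc a) * ja X) (2 * (b * conjc b) * jb X) (2 * (c * conjc c) * jc X)
    ((b * conjc b + c * conjc c) *: jx X) ((c * conjc c + a * conjc a) *: jy X)
    ((a * conjc a + b * conjc b) *: jz X).
Proof.
case: X => p q r x y z; rewrite /jtrip /jtriple /jconj /jdiag !jcrossE !jformE /=.
rewrite oconj0 !(odot0r, odot0l, omul0l, omul0r, scaler0, odia0, mulr0, addr0).
by apply: J6_eq => /=; rewrite ?(scaler0, subr0, sub0r, addr0, scalerN, opprK);
  first [ring|oct_module].
Qed.

Lemma jtrip_E0 X : jtrip (jE 0) (jE 0) X = J6 (2 * ja X) 0 0 0 (jy X) (jz X).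
Proof.
have c1 : conjc 1 = 1 :> K by exact: rmorph1.
have c0 : conjc 0 = 0 :> K by exact: rmorph0.
rewrite -[jE 0]/(jdiag 1 0 0) jtrip_diag c1 c0.
apply: J6_eq; rewrite ?(mulr1, mulr0, mul0r) //.
- by rewrite addr0 scale0r.
- by rewrite add0r scale1r.
by rewrite addr0 scale1r.
Qed.

Lemma jtrip_E1 X : jtrip (jE 1) (jE 1) X = J6 0 (2 * jb X) 0 (jx X) 0 (jz X).
Proof.
have c1 : conjc 1 = 1 :> K by exact: rmorph1.
have c0 : conjc 0 = 0 :> K by exact: rmorph0.
rewrite -[jE 1]/(jdiag 0 1 0) jtrip_diag c1 c0.
apply: J6_eq; rewrite ?(mulr1, mulr0, mul0r) //.
- by rewrite addr0 scale1r.
- by rewrite addr0 scale0r.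
by rewrite add0r scale1r.
Qed.

(** Tripotency of the element alone would allow the entry -1, that of its complement alone the entry
    2; together they leave 0 and 1. Two or more entries 1 contradict minimality, since a diagonal
    unit supported on one of them is fixed without being a multiple of the element. *)
Lemma jproj_diag a b c : jconj (jdiag a b c) = jdiag a b c ->
  jminimal (jdiag a b c) -> jtripotent (jone K - jdiag a b c) ->
  exists j, jdiag a b c = jE j.
Proof.
move=> rV [HV V0 Vm].
have D1 : jone K - jdiag a b c = jdiag (1 - a) (1 - b) (1 - c).
  by apply: J6_eq; rewrite /= ?subr0.
rewrite D1; move: HV; rewrite /jtripotent !jtrip_diag.
move=> /J6_inj[/= a1 b1 c1 _] /J6_inj[/= a2 b2 c2 _].
have [/= ra rb rc _] := J6_inj rV.
have A k : conjc k = k -> 2 * (k * conjc k) * k = 2 * k ->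
    2 * ((1 - k) * conjc (1 - k)) * (1 - k) = 2 * (1 - k) -> k = 0 \/ k = 1.
  move=> rk; rewrite rmorphB rmorph1 /= rk -!mulrA => /(mulfI _) + /(mulfI _).
  rewrite pnatr_eq0 => /(_ isT) E1 /(_ isT) E2.
  (* The cubes cancel when the tripotency equations for [k] and for [1 - k] are added. *)
  have /eqP : 3 * (k * (k - 1)) = 0.
    transitivity (((1 - k) * ((1 - k) * (1 - k)) - (1 - k)) + (k * (k * k) - k)).
      ring.
    by rewrite E1 E2 !subrr addr0.
  rewrite !mulf_eq0 pnatr_eq0 subr_eq0 /=.
  by case/orP=> /eqP; [left|right].
have fixE p q r : (2 * (a * conjc a) * p = 2 * p) -> (2 * (b * conjc b) * q = 2 * q) ->
   (2 * (c * conjc c) * r = 2 * r) -> exists k, [/\ p = k * a, q = k * b & r = k * c].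
  move=> Ep Eq Er; have [|k /J6_inj[]] := Vm (jdiag p q r); last by exists k.
  by rewrite jtrip_diag; apply: J6_eq; rewrite //= !scaler0.
have z1 : (1 : K) <> 0 by apply/eqP/oner_neq0.
case: (A _ ra a1 a2) (A _ rb b1 b2) (A _ rc c1 c2) => [a3|a3] [b3|b3] [c3|c3].
- case: V0; by rewrite a3 b3 c3.
- by exists 2; rewrite a3 b3 c3 /jE.
- by exists 1; rewrite a3 b3 c3 /jE.
- have [|||k [_ E1 E2]] := fixE 0 1 0; rewrite ?a3 ?b3 ?c3 ?rmorph1; try ring.
  by case: z1; rewrite E1 b3 -c3.
- by exists 0; rewrite a3 b3 c3 /jE.
- have [|||k [E1 E2 E3]] := fixE 1 0 0; rewrite ?a3 ?b3 ?c3 ?rmorph1; try ring.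
  by case: z1; rewrite E1 a3 -c3.
- have [|||k [E1 E2 E3]] := fixE 1 0 0; rewrite ?a3 ?b3 ?c3 ?rmorph1; try ring.
  by case: z1; rewrite E1 a3 -b3.
have [|||k [E1 E2 E3]] := fixE 1 0 0; rewrite ?a3 ?b3 ?c3 ?rmorph1; try ring.
by case: z1; rewrite E1 a3 -b3.
Qed.

Lemma jE_to_0 j : exists2 h, jaut h & h (jE j) = jE 0.
Proof.
case: j => [[|[|[|//]]] j3].
- exists id; first exact: jaut_id.
  by rewrite /jE /=.
- by exists (@jcyc K); [exact: jaut_cyc|rewrite /jE].
by exists (@jcyc K \o @jcyc K); [apply: jaut_comp; exact: jaut_cyc|rewrite /jE].
Qed.

Lemma jproj_to_E v : jframe (jone K) v -> exists2 g, jaut g & g (v 0) = jE 0.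
Proof.
case=> Hm _ Hl; have [H1 H2] := Hl 0.
have [g [a [b [c [Ag gv]]]]] := jdiag_real (jtripotent_le1_real H1 H2).
have If := structure_triple_iso Ag.1.
have [|||j Ej] := @jproj_diag a%:C b%:C c%:C.
- by rewrite -gv (jaut_conj Ag) (jtripotent_le1_real H1 H2).
- by rewrite -gv; exact: iso_minimal.
- by rewrite -gv -Ag.2 -(isoB If); exact: iso_tripotent.
rewrite {}Ej in gv.
have [h Ah hE] := jE_to_0 j.
by exists (h \o g); [exact: jaut_comp|rewrite /= gv].
Qed.

Lemma jaut_frame g v : jaut g -> jframe (jone K) v -> jframe (jone K) (g \o v).
Proof.
by case=> Sg g1 /(iso_frame (structure_triple_iso Sg)); rewrite g1.
Qed.

(** A rotation by a right angle, carried to the last two coordinates by [jcyc]. *)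
Lemma jswap : exists g : J -> J, jaut g /\ forall a b c, g (jdiag a b c) = jdiag a c b.
Proof.
exists (@jcyc K \o @jcyc K \o jrot (0 : R)%:C (1 : R)%:C \o @jcyc K); split.
  do ![apply: jaut_comp => //; try exact: jaut_cyc].
  by apply: jaut_rot; rewrite expr0n expr1n add0r.
move=> a b c; apply: J6_eq => //=; rewrite ?oreE /= ?odia0 ?scaler0 ?subr0 ?addr0 ?add0r //.
- by ring.
- by ring.
by rewrite !mul0r !mulr0 subr0 O8_scal.
Qed.

(** Once the first tripotent is [jE 0], orthogonality confines the second to the lower 2 by 2 block.
    A rotation of that block, followed if necessary by a swap, brings it to [jE 1] without moving
    [jE 0]; orthogonality to both then leaves only [jE 2] for the third. *)
Lemma jframe_std v : jframe (jone K) v ->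
  exists2 g, jaut g & forall j, g (v j) = jE j.
Proof.
move=> Hv; have [g Ag g0] := jproj_to_E Hv.
have Fg := jaut_frame Ag Hv; case: (Fg) => Hm Ho Hl.
have real j : jconj (g (v j)) = g (v j).
  by have [H1 H2] := Hl j; exact: jtripotent_le1_real H1 H2.
have orth0 j : j != 0 -> ja (g (v j)) = 0 /\ jy (g (v j)) = 0 /\ jz (g (v j)) = 0.
  rewrite eq_sym => /Ho; rewrite /= g0 jtrip_E0.
  by move=> /J6_inj[/= /eqP + _ _ [_ -> ->]]; rewrite mulf_eq0 pnatr_eq0 => /eqP.
have [h [Ah hx ha hyz hE]] := jx_block (real 1).
have [|a1 [y1 z1]] := orth0 1; first by [].
have [hy hz] := hyz y1 z1.
have hE0 : h (jE 0) = jE 0 by exact: hE.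
have [h' [Ah' h'E h'1]] : exists h', [/\ jaut h', h' (jE 0) = jE 0 &
    h' (h (g (v 1))) = jE 1].
  have hgv : h (g (v 1)) = jdiag 0 (jb (h (g (v 1)))) (jc (h (g (v 1)))).
    by rewrite [LHS]albert_eta hx hy hz ha a1.
  have [|||j Ej] := @jproj_diag 0 (jb (h (g (v 1)))) (jc (h (g (v 1)))).
  - by rewrite -hgv (jaut_conj Ah) real.
  - by rewrite -hgv; exact: (iso_minimal (structure_triple_iso Ah.1) (Hm 1)).
  - rewrite -hgv -Ah.2 -(isoB (structure_triple_iso Ah.1)).
    by apply: (iso_tripotent (structure_triple_iso Ah.1)); case: (Hl 1).
  rewrite -hgv in Ej; case: j Ej => [[|[|[|//]]] j3] Ej.
  - have : ja (jE (Ordinal j3)) = 0 by rewrite -Ej ha.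
    by rewrite /jE /= => /eqP; rewrite oner_eq0.
  - by exists id; split; [exact: jaut_id| |rewrite /= Ej; rewrite /jE].
  have [s [As sE]] := jswap; exists s; split=> //.
    by rewrite /jE sE.
  by rewrite Ej /jE sE.
have Ak := jaut_comp Ah' Ah; pose k := h' \o h.
have Fk := jaut_frame Ak Fg; case: (Fk) => Hm' Ho' Hl'.
exists (k \o g); first exact: jaut_comp.
have k0 : k (g (v 0)) = jE 0 by rewrite g0 /k /= hE0.
have [a2 b2 [x2 y2 z2]] : [/\ ja (k (g (v 2))) = 0, jb (k (g (v 2))) = 0 &
    [/\ jx (k (g (v 2))) = 0, jy (k (g (v 2))) = 0 & jz (k (g (v 2))) = 0]].
  have : jtrip (jE 0) (jE 0) (k (g (v 2))) = 0 by rewrite -k0; exact: (Ho' 0 2 isT).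
  have : jtrip (jE 1) (jE 1) (k (g (v 2))) = 0.
    by rewrite -h'1; exact: (Ho' 1 2 isT).
  rewrite jtrip_E0 jtrip_E1.
  move=> /J6_inj[/= _ /eqP + _ [-> _ ->]] /J6_inj[/= /eqP + _ _ [_ -> _]].
  by rewrite !mulf_eq0 !pnatr_eq0 => /eqP -> /eqP ->.
have kgv : k (g (v 2)) = jdiag 0 0 (jc (k (g (v 2)))).
  by rewrite [LHS]albert_eta a2 b2 x2 y2 z2.
have [|||j Ej] := @jproj_diag 0 0 (jc (k (g (v 2)))).
- by rewrite -kgv (jaut_conj Ak) real.
- by rewrite -kgv; exact: (Hm' 2).
- by rewrite -kgv; case: (Hl' 2).
rewrite -kgv in Ej; case=> [[|[|[|//]]] i3].
- by rewrite (_ : Ordinal i3 = 0); [exact: k0|exact: val_inj].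
- by rewrite (_ : Ordinal i3 = 1); [exact: h'1|exact: val_inj].
rewrite (_ : Ordinal i3 = 2); last exact: val_inj.
rewrite -[LHS]/(k (g (v 2))) Ej; case: j Ej => [[|[|[|//]]] j3] Ej.
- by move: a2; rewrite Ej /= => /eqP; rewrite oner_eq0.
- by move: b2; rewrite Ej /= => /eqP; rewrite oner_eq0.
by rewrite (_ : Ordinal j3 = 2) //; exact: val_inj.
Qed.

Lemma jframe_E : jframe (jone K) jE.
Proof.
have cb (b : bool) : conjc b%:R = b%:R :> K by exact: rmorph_nat.
have cb' (b : bool) : conjc (1 - b%:R) = 1 - b%:R :> K.
  by rewrite rmorphB rmorph1 rmorph_nat.
have D1 a b c : jone K - jdiag a b c = jdiag (1 - a) (1 - b) (1 - c).
  by apply: J6_eq; rewrite /= ?subr0.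
split=> [j|i j|j].
- have [h Ah hj] := jE_to_0 j; have [g [Ag hK gK]] := jaut_inv Ah.
  rewrite -[jE j]hK hj; apply: (iso_minimal (structure_triple_iso Ag.1)).
  split.
  + by rewrite /jtripotent jtrip_E0; apply: J6_eq; rewrite /= ?mulr0 ?scaler0.
  + by move=> /J6_inj[/= /eqP]; rewrite oner_eq0.
  move=> [a b c x y z]; rewrite jtrip_E0.
  have n2 : (2 : K) != 0 by rewrite pnatr_eq0.
  move=> /J6_inj[/= _ /eqP E2 /eqP E3 [/eqP E4 /eqP E5 /eqP E6]]; exists a.
  move: E2 E3 E4; rewrite ![0 == _]eq_sym !mulf_eq0 scaler_eq0 (negPf n2).
  move=> /eqP -> /eqP -> /eqP ->.
  have D (w : octonion K) : w == 2 *: w -> w = 0.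
    by rewrite -subr_eq0 -{1}[w]scale1r -scalerBl scaler_eq0 => /orP[|/eqP //];
      rewrite -opprB oppr_eq0 (_ : 2 - 1 = 1 :> K) ?oner_eq0 //; ring.
  by rewrite (D _ E5) (D _ E6); apply: J6_eq; rewrite /= ?mulr1 ?mulr0 ?scaler0.
- case: i => [[|[|[|//]]] i3]; case: j => [[|[|[|//]]] j3] // _;
    rewrite /jE jtrip_diag !cb; apply: J6_eq;
    by rewrite /= ?(mulr1n, mulr0n, scaler0, mulr1, mulr0, mul0r).
case: j => [[|[|[|//]]] j3]; rewrite /jtripotent D1 !jtrip_diag !cb';
  split; apply: J6_eq;
  by rewrite /= ?(mulr1n, mulr0n, subrr, subr0, scaler0, mulr1, mulr0, mul0r).
Qed.

Lemma jE_sum (a : 'I_3 -> K) : \sum_j a j *: jE j = jdiag (a 0) (a 1) (a 2).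
Proof.
rewrite !big_ord_recl big_ord0 (_ : lift ord0 ord0 = 1); last exact: val_inj.
rewrite (_ : lift ord0 _ = 2); last exact: val_inj.
by apply: J6_eq; rewrite /= ?mulr0 ?mulr1 ?scaler0 ?addr0 ?add0r.
Qed.

End Frames.

(** * Spectral representations: norms, existence and uniqueness *)

Section SpectralRepresentations.
Variable R : rcfType.
Local Notation K := R[i].
Local Notation J := (albert K).
Local Notation "x %:C" := (real_complex R x) : ring_scope.
Implicit Types (k : K) (X Y Z U V W : J) (v w : 'I_3 -> J) (a b : 'I_3 -> K).

Definition jrep U v a X := jframe U v /\ X = \sum_j a j *: v j.

Lemma iso_rep f U v a X : triple_iso f -> jrep U v a X ->
  jrep (f U) (f \o v) a (f X).
Proof.
by move=> If [Fv ->]; split; [exact: iso_frame|rewrite (iso_sum If)].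
Qed.

Lemma big_ord3 (T : nmodType) (F : 'I_3 -> T) : \sum_j F j = F 0 + F 1 + F 2.
Proof.
rewrite !big_ord_recl big_ord0 (_ : lift ord0 ord0 = 1); last exact: val_inj.
by rewrite (_ : lift ord0 _ = 2) ?addr0 ?addrA //; exact: val_inj.
Qed.

Lemma prod_ord3 (T : comNzRingType) (F : 'I_3 -> T) : \prod_j F j = F 0 * F 1 * F 2.
Proof.
rewrite !big_ord_recl big_ord0 (_ : lift ord0 ord0 = 1); last exact: val_inj.
by rewrite (_ : lift ord0 _ = 2) ?mulr1 ?mulrA //; exact: val_inj.
Qed.

Lemma jrep_diag v a X : jrep (jone K) v a X ->
  exists2 g, jaut g & g X = jdiag (a 0) (a 1) (a 2) /\ forall j, g (v j) = jE R j.
Proof.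
case=> /jframe_std[g Ag gE] ->; exists g => //; split=> //.
rewrite (iso_sum (structure_triple_iso Ag.1)) -jE_sum.
by apply: eq_bigr => j _; rewrite gE.
Qed.

Lemma jdiag_rep g X (c1 c2 c3 : K) : jaut g -> g X = jdiag c1 c2 c3 ->
  exists v, jrep (jone K) v (fun j => nth 0 [:: c1; c2; c3] j) X.
Proof.
move=> Ag gX; have [h [Ah gK hK]] := jaut_inv Ag; exists (h \o @jE R).
rewrite -[X]gK -{1}Ah.2; apply: (iso_rep (structure_triple_iso Ah.1)).
by split; [exact: jframe_E|rewrite jE_sum gX].
Qed.

Lemma jaut_form_one g X : jaut g -> jform (jone K) (g X) = jform (jone K) X.
Proof.
by move=> [Sg g1]; rewrite !(jformC (jone K)) -jone_conj -/(jherm _ _) -{1}g1 structure_herm.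
Qed.

Lemma jrep_char v a X : jrep (jone K) v a X ->
  [/\ jform (jone K) X = a 0 + a 1 + a 2,
      jform (jone K) (jadj X) = a 1 * a 2 + a 2 * a 0 + a 0 * a 1 &
      jnorm X = \prod_j a j].
Proof.
move=> /jrep_diag[g Ag [gX _]].
rewrite -(jaut_form_one X Ag) -(jaut_form_one (jadj X) Ag) -(jaut_adj Ag) -(jaut_norm Ag) gX.
by rewrite !jform_one jnorm_diag jadjE !odot0l !subr0 prod_ord3.
Qed.

Lemma jnorm_unitary U : junitary U -> jnorm U * conjc (jnorm U) = 1.
Proof.
case/junitaryP=> g [h [chi [_ _ _ chi1 E]]] <-.
by rewrite E jone_norm mulr1.
Qed.

Lemma jnorm_unitary_neq0 U : junitary U -> jnorm U != 0.
Proof.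
by move/jnorm_unitary; apply: contra_eq_neq => ->; rewrite mul0r eq_sym oner_eq0.
Qed.

(** A structure map that moves [U] to the unit multiplies the norms of [U] and [X] by the same
    nonzero factor and keeps the coefficients. All later statements on determinants rest on this
    formula. *)
Lemma jrep_norm U v a X : junitary U -> jrep U v a X ->
  jnorm X = (\prod_j a j) * jnorm U.
Proof.
move=> /junitary_one_transitive[g Sg gU] /(iso_rep (structure_triple_iso Sg)).
rewrite gU => /jrep_char[_ _ NX].
have [chi [chi0 E]] := structure_norm Sg.
apply: (mulfI chi0); rewrite -E NX mulrCA -E gU jone_norm mulr1 //.
Qed.

Lemma real_rep_exists U X : junitary U -> jtrip U X U = 2 *: X ->
  exists (a : 'I_3 -> R) v, jrep U v (fun j => (a j)%:C) X.
Proof.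
move=> /junitary_one_transitive[g Sg gU] HX.
have [h [Sh gK hK]] := structure_inv Sg.
(* At the unit the hypothesis on [X] turns into self-adjointness. *)
have rX : jconj (g X) = g X.
  apply: (@scalerI _ _ (2 : K)); first by rewrite pnatr_eq0.
  by rewrite -jtriple_one -/(jtrip _ _ _) -gU structure_trip // HX structureZ.
have [f [a [b [c [Af fX]]]]] := jdiag_real rX.
have [v /(iso_rep (structure_triple_iso Sh))] := jdiag_rep Af fX.
rewrite gK -gU gK => -[Fv EX].
exists (fun j => nth 0 [:: a; b; c] j), (h \o v); split=> //.
by rewrite EX !big_ord3.
Qed.

Lemma unitary_rep_exists U X : junitary U -> junitary X ->
  exists (a : 'I_3 -> K) v, (forall j, a j * conjc (a j) = 1) /\ jrep U v a X.
Proof.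
move=> /junitary_one_transitive[g Sg gU] /(junitary_structure Sg) HX.
have [h [Sh gK hK]] := structure_inv Sg.
have [f [a [b [c [Af fX]]]]] := junitary_diag HX.
have := junitary_structure Af.1 HX; rewrite fX => /junitary_diagP[a1 b1 c1].
have [v /(iso_rep (structure_triple_iso Sh))] := jdiag_rep Af fX.
rewrite gK -gU gK => H.
exists (fun j => nth 0 [:: a; b; c] j), (h \o v); split=> // -[[|[|[|//]]] j3] //.
Qed.

Lemma jrep_poly v a X : jrep (jone K) v a X -> \prod_j ('X - (a j)%:P) =
  'X^3 - (jform (jone K) X)%:P * 'X^2 + (jform (jone K) (jadj X))%:P * 'X - (jnorm X)%:P.
Proof.
move=> /jrep_char[-> -> ->]; rewrite !prod_ord3 !(rmorphD, rmorphM) /=; ring.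
Qed.

(** The characteristic cubic is determined by [X], and its linear factors are unique up to order. *)
Lemma jrep_spectrum v w a b X : jrep (jone K) v a X -> jrep (jone K) w b X ->
  exists s : 'S_3, forall j, b j = a (s j).
Proof.
move=> /jrep_poly Pa /jrep_poly; rewrite -Pa => {Pa} Pab.
have /tuple_permP[s Es] : perm_eq [tuple b j | j < 3] [tuple a j | j < 3].
  apply: prod_XsubC_eq; rewrite !big_tuple.
  by under eq_bigr do rewrite tnth_mktuple; under [RHS]eq_bigr do rewrite tnth_mktuple.
exists s => j; have := congr1 (fun t => nth 0 t j) Es.
by rewrite -!tnth_nth !tnth_mktuple.
Qed.

Lemma jtriple_diag_one (a1 a2 a3 b1 b2 b3 : K) :
  jtriple (jdiag a1 a2 a3) (jdiag b1 b2 b3) (jone K) =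
  2 *: jdiag (a1 * b1) (a2 * b2) (a3 * b3).
Proof.
rewrite /jtriple [jcross _ (jone K)]jcrossC jcross_one !jform_one /jone /jdiag.
apply: J6_eq; rewrite /= jcrossE !jformE ?odot0l ?odot0r ?omul0l ?omul0r /=.
all: rewrite ?(scaler0, oppr0, addr0, odia0, subr0, odot0l) //; ring.
Qed.

Lemma jrep_mul v a b X Y : jrep (jone K) v a X -> jrep (jone K) v b Y ->
  jrep (jone K) v (fun j => a j * b j) (2^-1 *: jtriple X Y (jone K)).
Proof.
move=> HX [Fv HY]; split=> //.
have [g Ag [gX gv]] := jrep_diag HX; apply: (structure_inj Ag.1).
have gY : g Y = jdiag (b 0) (b 1) (b 2).
  rewrite HY (iso_sum (structure_triple_iso Ag.1)) -jE_sum.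
  by apply: eq_bigr => j _; rewrite gv.
rewrite (iso_sum (structure_triple_iso Ag.1)).
under eq_bigr do rewrite gv.
rewrite jE_sum (structureZ Ag.1) -[Y in LHS]jconjK -(structure_triple Ag.1).
rewrite -(jaut_conj Ag) jconjK Ag.2 gX gY jtriple_diag_one scalerA mulVf ?scale1r //.
by rewrite pnatr_eq0.
Qed.

Lemma jrep_one v : jframe (jone K) v -> jrep (jone K) v (fun=> 1) (jone K).
Proof.
move=> Fv; split=> //; have [g Ag gv] := jframe_std Fv; apply: (structure_inj Ag.1).
rewrite (iso_sum (structure_triple_iso Ag.1)) Ag.2.
by under eq_bigr do rewrite gv; rewrite jE_sum.
Qed.

(** Evaluation of a polynomial in the Jordan algebra. The list holds the constant coefficient first,
    as for [horner_rec], and Horner's scheme fixes the bracketing of powers. *)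
Fixpoint jhorner X (s : seq K) : J :=
  if s is c :: s' then 2^-1 *: jtriple (jhorner X s') X (jone K) + c *: jone K else 0.

Lemma jrep_horner v a X s : jrep (jone K) v a X ->
  jrep (jone K) v (fun j => horner_rec s (a j)) (jhorner X s).
Proof.
move=> H; elim: s => [|c s IH] /=.
  by case: H => Fv _; split=> //; rewrite big1 // => j _; rewrite scale0r.
have [Fv ->] := jrep_mul IH H; split=> //.
have [_ ->] := jrep_one Fv; rewrite scaler_sumr -big_split /=.
by apply: eq_bigr => j _; rewrite scalerA mulr1 scalerDl.
Qed.

(* The spectral projections are obtained by evaluating an interpolation
   polynomial at the element. *)
Lemma jrep_unique U v w a b X : junitary U -> jrep U v a X -> jrep U w b X ->
  (exists s : 'S_3, forall j, b j = a (s j)) /\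
  (forall c, \sum_(j | a j == c) v j = \sum_(j | b j == c) w j).
Proof.
move=> /junitary_one_transitive[g Sg gU] Hv Hw.
have If := structure_triple_iso Sg.
have := iso_rep If Hv; have := iso_rep If Hw; rewrite gU => Hw' Hv'.
have [s sE] := jrep_spectrum Hv' Hw'.
split=> [|c]; first by exists s.
(* This polynomial takes the value 1 at [c] and 0 at every other spectral value; it also serves a
   [c] outside the spectrum, where both sums are empty. *)
pose p := \prod_(j | a j != c) ((c - a j)^-1 *: ('X - (a j)%:P)).
have pc : p.[c] = 1.
  rewrite horner_prod big1 // => j jc.
  by rewrite !hornerE mulVf // subr_eq0 eq_sym.
have pa j : p.[a j] = (a j == c)%:R.
  case: eqVneq => [->//|ajc].
  by rewrite horner_prod (bigD1 j) //= !hornerE subrr mulr0 mul0r.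
have pb j : p.[b j] = (b j == c)%:R by rewrite sE pa.
have [_ Ev] := jrep_horner p Hv'; have [_ Ew] := jrep_horner p Hw'.
apply: (structure_inj Sg).
have E (F : 'I_3 -> bool) (u : 'I_3 -> J) : g (\sum_(j | F j) u j) =
    \sum_j (F j)%:R *: g (u j).
  rewrite big_mkcond -(iso_sum If); congr g; apply: eq_bigr => j _.
  by case: (F j); rewrite ?scale1r ?scale0r.
rewrite !E; transitivity (jhorner (g X) p).
  by rewrite Ev; apply: eq_bigr => j _; rewrite -pa.
by rewrite Ew; apply: eq_bigr => j _; rewrite -pb.
Qed.

End SpectralRepresentations.

(** * Polar decomposition *)

Section PolarOfMaximum.
Variable R : rcfType.
Local Notation K := R[i].
Local Notation J := (albert K).
Local Notation "x %:C" := (real_complex R x) : ring_scope.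
Implicit Types (k : K) (X Y Z U V W : J).

(** For [w = k / |k|] the number [k * conjc w] is [|k|], which exceeds the real part of [k] as soon
    as [k] is not real. *)
Lemma rotate_to_abs k : complex.Im k != 0 -> exists w, w * conjc w = 1 /\
  complex.Re k < complex.Re (k * conjc w).
Proof.
case: k => p q /= q0; pose r := Num.sqrt (p ^+ 2 + q ^+ 2).
have q2 : 0 < q ^+ 2 by rewrite exprn_even_gt0.
have p2 : 0 <= p ^+ 2 := sqr_ge0 p.
have s0 : 0 < p ^+ 2 + q ^+ 2 by rewrite ltr_wpDl.
have r2 : r ^+ 2 = p ^+ 2 + q ^+ 2 by rewrite sqr_sqrtr // ltW.
have r0 : 0 < r by rewrite sqrtr_gt0.
have rN0 : r != 0 by rewrite gt_eqF.
exists (Complex (p / r) (q / r)); split.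
  apply/eqP; rewrite eq_complex /=; apply/andP; split; apply/eqP; last by ring.
  transitivity ((p ^+ 2 + q ^+ 2) / r ^+ 2); first by field.
  by rewrite -r2 divff // expf_neq0.
have -> : complex.Re (Complex p q * conjc (Complex (p / r) (q / r))) = r.
  transitivity ((p ^+ 2 + q ^+ 2) / r); first by rewrite /=; field.
  by rewrite -r2 expr2 mulfK.
rewrite /=; case: (ltP p r) => // rp; suff : r ^+ 2 <= p ^+ 2 by rewrite r2 gerDl leNgt q2.
by rewrite ler_sqr ?nnegrE // ltW // (lt_le_trans r0).
Qed.

Lemma junitary_diag1 (a b c : K) : a * conjc a = 1 -> b * conjc b = 1 -> c * conjc c = 1 ->
  junitary (jdiag a b c).
Proof.
move=> a1 b1 c1 X; rewrite jtrip_diag a1 b1 c1 mulr1.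
by rewrite [X in _ = _ *: X]albert_eta.
Qed.

Lemma jherm_diag X p q r : jherm X (jdiag p q r) =
  ja X * conjc p + jb X * conjc q + jc X * conjc r.
Proof.
case: X => a b c x y z; rewrite /jherm /jconj /jdiag jformE oconj0 !odot0r.
by rewrite !addr0 mulr0 addr0.
Qed.

(** An automorphism makes the imaginary part of [X] diagonal. Varying one phase at a time among the
    diagonal unitaries then shows that the diagonal of the transformed [X] is real, so that its
    imaginary part is zero. *)
Lemma max_real X : (forall W, junitary W ->
    complex.Re (jherm X W) <= complex.Re (jherm X (jone K))) -> jconj X = X.
Proof.
move=> mX; have [g [a [b [c [Ag gB]]]]] : exists g (a b c : R), jaut g /\
    g ('i%C *: (X - jconj X)) = jdiag a%:C b%:C c%:C.
  apply: jdiag_real; rewrite jconjZ jconjD jconjN jconjK.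
  have -> : conjc 'i%C = - 'i%C :> K by apply/eqP; rewrite eq_complex /= oppr0 !eqxx.
  by albert_module.
have {}mX W : junitary W -> complex.Re (jherm (g X) W) <= complex.Re (jherm (g X) (jone K)).
  have [h [Ah gK hK]] := jaut_inv Ag; move=> HW.
  rewrite -[in leLHS](hK W) -[in leRHS]Ag.2 !(structure_herm Ag.1).
  exact/mX/(junitary_structure Ah.1).
rewrite (structureZ Ag.1) (structureB Ag.1) -(jaut_conj Ag) in gB.
have H p q r : p * conjc p = 1 -> q * conjc q = 1 -> r * conjc r = 1 ->
    complex.Re (ja (g X) * conjc p + jb (g X) * conjc q + jc (g X) * conjc r) <=
    complex.Re (ja (g X) + jb (g X) + jc (g X)).
  move=> p1 q1 r1; have := mX _ (junitary_diag1 p1 q1 r1).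
  by rewrite /jone !jherm_diag !conjc1 !mulr1.
have one1 : 1 * conjc 1 = 1 :> K by rewrite conjc1 mulr1.
have I0 k : (forall w, w * conjc w = 1 ->
    complex.Re (k * conjc w) <= complex.Re k) -> complex.Im k = 0.
  move=> Hk; apply/eqP/negPn/negP => /rotate_to_abs[w [w1]].
  by rewrite ltNge Hk.
have ia : complex.Im (ja (g X)) = 0.
  apply: I0 => w w1; have := H w 1 1 w1 one1 one1.
  by rewrite conjc1 !mulr1 !raddfD /= !lerD2r.
have ib : complex.Im (jb (g X)) = 0.
  apply: I0 => w w1; have := H 1 w 1 one1 w1 one1.
  by rewrite conjc1 !mulr1 !raddfD /= lerD2r lerD2l.
have ic : complex.Im (jc (g X)) = 0.
  apply: I0 => w w1; have := H 1 1 w one1 one1 w1.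
  by rewrite conjc1 !mulr1 !raddfD /= lerD2l.
apply/esym/eqP; rewrite -subr_eq0; apply/eqP.
apply: (@scalerI _ _ ('i%C : K)); first by rewrite eq_complex /= oner_eq0 andbF.
apply: (structure_inj Ag.1); rewrite scaler0 (structure0 Ag.1).
rewrite (structureZ Ag.1) (structureB Ag.1) -(jaut_conj Ag) gB.
have D0 k : complex.Im k = 0 -> 'i%C * (k - conjc k) = 0.
  move=> k0; suff -> : conjc k = k by rewrite subrr mulr0.
  by case: k k0 => p q /= ->; rewrite oppr0.
by have [/= <- <- <- _] := J6_inj gB; rewrite !D0.
Qed.

End PolarOfMaximum.

Section PolarDecomposition.
Local Open Scope classical_set_scope.
Local Open Scope ring_scope.
Variable R : realType.
Local Notation K := R[i].
Local Notation J := (albert K).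
Local Notation "x %:C" := (real_complex R x) : ring_scope.
Implicit Types (k : K) (X Y Z U V W : J) (r s : 'rV[R]_54) (t : R).

(** Even and odd positions hold real and imaginary parts of the 27 = 3 + 3 * 8 complex coordinates,
    which explains 54. Compactness and the extreme value theorem are used on this row space, so that
    no topology has to be put on the Albert algebra. *)
Let ccoord r (n : nat) : K := Complex (r 0 (inord n.*2)) (r 0 (inord n.*2.+1)).

Let real_coord r : J := J6 (ccoord r 0) (ccoord r 1) (ccoord r 2)
  (O8 (ccoord r 3) (ccoord r 4) (ccoord r 5) (ccoord r 6)
      (ccoord r 7) (ccoord r 8) (ccoord r 9) (ccoord r 10))
  (O8 (ccoord r 11) (ccoord r 12) (ccoord r 13) (ccoord r 14)
      (ccoord r 15) (ccoord r 16) (ccoord r 17) (ccoord r 18))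
  (O8 (ccoord r 19) (ccoord r 20) (ccoord r 21) (ccoord r 22)
      (ccoord r 23) (ccoord r 24) (ccoord r 25) (ccoord r 26)).

Let ccoordP t r s n : ccoord (t *: r + s) n = t%:C * ccoord r n + ccoord s n.
Proof.
by apply/eqP; rewrite eq_complex /= !mxE /= !mul0r subr0 addr0 !eqxx.
Qed.

Let real_coordP t r s : real_coord (t *: r + s) = t%:C *: real_coord r + real_coord s.
Proof. by apply: J6_eq; rewrite ?ccoordP //; apply: O8_eq; exact: ccoordP. Qed.

Let real_coord0 : real_coord 0 = 0.
Proof.
by have := real_coordP (-1) 0 0; rewrite scaler0 addr0 rmorphN rmorph1 scaleN1r addNr.
Qed.

Let real_coord_sum r : real_coord r = \sum_j (r 0 j)%:C *: real_coord (delta_mx 0 j).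
Proof.
rewrite {1}[r]row_sum_delta; elim/big_rec2: _ => [|j x y _ <-]; first exact: real_coord0.
exact: real_coordP.
Qed.

Let real_coord_surj X : exists r, real_coord r = X.
Proof.
case: X => a b c [x0 x1 x2 x3 x4 x5 x6 x7] [y0 y1 y2 y3 y4 y5 y6 y7]
  [z0 z1 z2 z3 z4 z5 z6 z7].
pose l := [:: a; b; c; x0; x1; x2; x3; x4; x5; x6; x7; y0; y1; y2; y3; y4; y5; y6; y7;
  z0; z1; z2; z3; z4; z5; z6; z7].
exists (\row_j (let k := nth 0 l j./2 in if odd j then complex.Im k else complex.Re k)).
have E n : (n < 27)%N -> ccoord (\row_j (let k := nth 0 l j./2 in
    if odd j then complex.Im k else complex.Re k)) n = nth 0 l n.
  move=> n27; rewrite /ccoord !mxE.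
  have n54 : (n.*2.+1 < 54)%N by rewrite -[54%N]/(27.*2)%N ltn_Sdouble.
  rewrite !inordK //; last exact: ltnW.
  by rewrite /= odd_double uphalf_double doubleK; case: (nth _ _ _).
by apply: J6_eq; rewrite ?E //; apply: O8_eq; rewrite E.
Qed.

Let nrm k : R := complex.Re k ^+ 2 + complex.Im k ^+ 2.

Let nrm_ge0 k : 0 <= nrm k.
Proof. by rewrite addr_ge0 ?sqr_ge0. Qed.

Let nrmE k : k * conjc k = (nrm k)%:C.
Proof.
case: k => p q; apply/eqP; rewrite eq_complex /nrm /=; apply/andP; split; apply/eqP; ring.
Qed.

Let onrm (x : octonion K) := nrm (o0 x) + nrm (o1 x) + nrm (o2 x) + nrm (o3 x)
  + nrm (o4 x) + nrm (o5 x) + nrm (o6 x) + nrm (o7 x).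

Let onrmE x : odot x (oconj x) = (onrm x)%:C.
Proof.
case: x => *; rewrite /oconj O8_dot !nrmE -!rmorphD //.
Qed.

Let jnrmE X : jherm X X = (nrm (ja X) + nrm (jb X) + nrm (jc X) +
  2 * (onrm (jx X) + onrm (jy X) + onrm (jz X)))%:C.
Proof.
case: X => *; rewrite /jherm /jconj jformE !onrmE !nrmE.
have -> : (2 : K) = 2%:C by rewrite rmorph_nat.
by rewrite -!rmorphD -!rmorphM -rmorphD.
Qed.

Let ccoord_le r n : (n < 27)%N ->
  nrm (ccoord r n) <= complex.Re (jherm (real_coord r) (real_coord r)).
Proof.
rewrite jnrmE /real_coord [complex.Re _]/= => n27.
rewrite /onrm; cbn [ja jb jc jx jy jz o0 o1 o2 o3 o4 o5 o6 o7].
pose f m := nrm (ccoord r m); have P m : 0 <= f m by exact: nrm_ge0.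
rewrite -!/(f _); move: f P => {r} f P.
have F (m : nat) : f m <= 2 * f m by rewrite mulr_natl mulr2n lerDl.
rewrite !mulrDr !addrA.
(* Octonion coordinates enter the hermitian form with weight 2; lowering these 24 weights to 1 gives
   the plain sum. *)
apply: (@le_trans _ _ (\sum_(m < 27) f m)).
  by rewrite (bigD1 (Ordinal n27)) //= lerDl sumr_ge0.
rewrite !big_ord_recl big_ord0 addr0 !addrA.
by do 24! (apply: lerD; last exact: F).
Qed.

Let real_linear (b : J -> R) :=
  forall t X Y, b (t%:C *: X + Y) = t * b X + b Y.

Let real_linear_sum (b : J -> R) r : real_linear b ->
  b (real_coord r) = \sum_j b (real_coord (delta_mx 0 j)) * r 0 j.
Proof.
move=> Lb; have b0 : b 0 = 0.
  by have := Lb (-1) 0 0; rewrite scaler0 addr0 mulN1r addNr.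
rewrite real_coord_sum; elim/big_rec2: _ => // j x y _ <-.
by rewrite Lb mulrC.
Qed.

Let continuous_sum (F : 'I_54 -> 'rV[R]_54 -> R) :
  (forall i, continuous (F i)) -> continuous (fun r => \sum_i F i r).
Proof. by move=> cF; apply: continuous_big => //; exact: add_continuous. Qed.

Let continuous_linear b : real_linear b -> continuous (fun r => b (real_coord r)).
Proof.
move=> Lb; rewrite (_ : (fun _ => _) = fun r =>
  \sum_j b (real_coord (delta_mx 0 j)) * r 0 j); last first.
  by apply/funext => r; exact: real_linear_sum.
apply: continuous_sum => j r.
apply: (@continuousM _ _ (fun=> b (real_coord (delta_mx 0 j))) (fun r => r 0 j)).
  exact: cst_continuous.
exact: coord_continuous.
Qed.

(** Expanding the second argument in the basis leaves sums of products of a linear function and a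
    coordinate. *)
Let continuous_quadratic (b : J -> J -> R) :
  (forall X, real_linear (b X)) -> (forall Y, real_linear (b ^~ Y)) ->
  continuous (fun r => b (real_coord r) (real_coord r)).
Proof.
move=> L1 L2; rewrite (_ : (fun _ => _) = fun r =>
  \sum_j b (real_coord r) (real_coord (delta_mx 0 j)) * r 0 j); last first.
  by apply/funext => r; exact: real_linear_sum.
apply: continuous_sum => j r.
apply: (@continuousM _ _ (fun r => b (real_coord r) (real_coord (delta_mx 0 j)))
  (fun r => r 0 j)); last exact: coord_continuous.
exact: (continuous_linear (L2 _)).
Qed.

Let ReP (t : R) k k' : complex.Re (t%:C * k + k') = t * complex.Re k + complex.Re k'.
Proof. by case: k k' => ? ? [? ?]; rewrite /= mul0r subr0. Qed.

Let unitary_closed : closed [set r | junitary (real_coord r)].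
Proof.
rewrite (_ : [set r | _] = \bigcap_(p in @setT (J * J))
  [set r | complex.Re (jform (jtrip (real_coord r) (real_coord r) p.1) p.2) =
    complex.Re (jform (2 *: p.1) p.2)]); last first.
  apply/seteqP; split=> [r Hr [X Z] _ /=|r Hr X]; first by rewrite Hr.
  apply: jform_ext => Z; apply/eqP; rewrite eq_complex; apply/andP; split; apply/eqP.
    exact: (Hr (X, Z)).
  (* Real parts suffice in the family of conditions, because pairing with [-i Z] yields the
     imaginary part. *)
  have /= := Hr (X, - 'i%C *: Z) I; rewrite !jformZr.
  have ReI k : complex.Re (- 'i%C * k) = complex.Im k.
    by case: k => p q /=; rewrite mulNr mul0r !mulN1r oppr0 sub0r opprK.
  by rewrite !ReI.
apply: closed_bigI => -[X Z] _ /=; apply: (@preimage_closed _ _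
  (fun r => complex.Re (jform (jtrip (real_coord r) (real_coord r) X) Z)) [set x | x = _]);
  last exact: closed_eq.
move=> r _; apply: (@continuous_quadratic
  (fun Y W => complex.Re (jform (jtrip Y W X) Z))).
- move=> Y t W W'; rewrite -ReP -jformZl -jformDl; congr (complex.Re (jform _ _)).
  by rewrite /jtrip jconj_linear conjc_real /jtriple; albert_module.
- move=> W t Y Y'; rewrite -ReP -jformZl -jformDl; congr (complex.Re (jform _ _)).
  by rewrite /jtrip /jtriple; albert_module.
Qed.

Let unitary_bounded : bounded_set [set r | junitary (real_coord r)].
Proof.
(* The hermitian square of a unitary is that of the unit, namely 3, so every real coordinate has
   square at most 3. *)
exists 3; split; first by rewrite realn.
move=> M M3 r /= /junitaryP[g Sg gr].
have r3 : complex.Re (jherm (real_coord r) (real_coord r)) = 3.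
  rewrite -gr structure_herm // /jone jherm_diag !conjc1 !mulr1 /=; ring.
rewrite -[leLHS]/(mx_norm r) mx_normrE; apply: bigmax_le => [|[i j] _ /=]; first by apply: ltW; lra.
rewrite (le_trans _ (ltW M3)) // (ord1 i).
have j27 : (j./2 < 27)%N by rewrite ltn_half_double.
have : `|r 0 j| ^+ 2 <= 3.
  rewrite real_normK ?num_real // -r3 (le_trans _ (ccoord_le r j27)) //.
  have := odd_double_half j; case: (odd j) => jE; rewrite /nrm /ccoord /=.
    by rewrite -[j./2.*2.+1]/(true + j./2.*2)%N jE inord_val lerDr sqr_ge0.
  by rewrite -[j./2.*2]/(false + j./2.*2)%N jE inord_val lerDl sqr_ge0.
have := normr_ge0 (r 0 j); nra.
Qed.

(** Structure maps preserve the pairing and the set of unitaries, so the maximum may be moved to the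
    unit, where [max_real] yields self-adjointness. *)
Lemma polar_exists X : exists U, junitary U /\ jtrip U X U = 2 *: X.
Proof.
have [u1 u1E] := real_coord_surj (jone K).
have [u] : exists2 u, u \in [set r | junitary (real_coord r)] &
    forall r, r \in [set r | junitary (real_coord r)] ->
    complex.Re (jherm X (real_coord r)) <= complex.Re (jherm X (real_coord u)).
  apply: EVT_max_rV.
  - by exists u1; rewrite /= u1E; exact: junitary_one.
  - exact: bounded_closed_compact unitary_bounded unitary_closed.
  apply: continuous_subspaceT; apply: (@continuous_linear (fun Y => complex.Re (jherm X Y))).
  by move=> t Y Y'; rewrite /jherm jconj_linear conjc_real jformDr jformZr ReP.
rewrite inE /= => Hu Mu; exists (real_coord u); split=> //.
have [g Sg gu] := junitary_one_transitive Hu.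
have [h [Sh gK hK]] := structure_inv Sg.
have rX : jconj (g X) = g X.
  apply: max_real => W HW; rewrite -gu -(hK W) !(structure_herm Sg).
  have [w wE] := real_coord_surj (h W); rewrite -wE; apply: Mu.
  by rewrite inE /= wE; exact: junitary_structure.
apply: (structure_inj Sg); rewrite -(structure_trip _ _ _ Sg) gu (structureZ Sg).
by rewrite /jtrip jtriple_one rX.
Qed.

End PolarDecomposition.

(** * Hermitian octonion matrices *)

Section CubicIdentity.
Variable K : comNzRingType.
Implicit Types (k : K) (X Y Z : albert K).
Local Notation tr := (jform (jone K)).

Lemma jform1E X : tr X = ja X + jb X + jc X.
Proof. by case: X => *; rewrite jformE !odot0l /=; ring. Qed.

Fact jcross_adj_entry (a b c : K) (x y z : octonion K) :
  odia (omul y (odia (omul x y) - c *: z) + omul (odia (omul z x) - b *: y) z)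
    - a *: (odia (omul y z) - a *: x) - (b * c - odot x x) *: x =
  - ((b * c - odot x x) + (c * a - odot y y) + (a * b - odot z z)) *: x
   - (a + b + c) *: (odia (omul y z) - a *: x).
Proof.
have E1 : omul y (odia (omul x y)) = odot y y *: odia x.
  by rewrite odiaM -{1}[y]odiaK omul_dial odot_dia.
have E2 : omul (odia (omul z x)) z = odot z z *: odia x.
  by rewrite odiaM -{2}[z]odiaK omul_diar odot_dia.
rewrite !(omulDl, omulDr, omulNl, omulNr, omulZl, omulZr) E1 E2.
by move: (omul y z) => p; rewrite !(odiaD, odiaN, odiaZ, odiaK); oct_module.
Qed.

(** The Cayley-Hamilton theorem in terms of the cross product; its linearisation is the only
    nontrivial relation between nested cross products that is used. *)
Lemma jcross_adj_self X : jcross X (jadj X) =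
  (tr X * tr (jadj X) - jnorm X) *: jone K - tr (jadj X) *: X - tr X *: jadj X.
Proof.
case: X => a b c x y z; rewrite !jform1E jadjE jcrossE jnormE /jone /jdiag /=.
have E p q r : odot p (odia (omul q r)) = odot (omul r p) (odia q) :> K.
  by rewrite odiaM odot_mull.
have E2 : odot (omul x y) (odia z) = odot (omul z x) (odia y) by rewrite odot_cyc.
have E3 : odot (omul y z) (odia x) = odot (omul z x) (odia y) by rewrite -odot_cyc -E2.
apply: J6_eq => /=.
- by rewrite odotDr odotNr odotZr E; ring.
- by rewrite odotDr odotNr odotZr E E2; ring.
- by rewrite odotDr odotNr odotZr E E3; ring.
- by rewrite scaler0 sub0r jcross_adj_entry; oct_module.
- rewrite scaler0 sub0r jcross_adj_entry; oct_module.
by rewrite scaler0 sub0r jcross_adj_entry; oct_module.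
Qed.

Lemma jform_one_cross X Y : tr (jcross X Y) = tr X * tr Y - jform X Y.
Proof.
case: X => *; case: Y => *; rewrite jcrossE jformE !jform1E /=; ring.
Qed.

Lemma jform_cross_cyc X Y Z : jform (jcross X Y) Z = jform (jcross Y Z) X.
Proof.
by rewrite !jnorm_polar (addrC (Y + Z)) (addrC Z X) (addrC Y X) addrA; ring.
Qed.

End CubicIdentity.

(** * The Jordan product and its triple product *)

Section JordanProduct.
Variable R : rcfType.
Local Notation K := R[i].
Implicit Types (k : K) (X Y Z : albert K).
Local Notation tr := (jform (jone K)).

(** Cayley-Hamilton with adjoint and norm replaced by cross products, so that both sides are cubic
    in [X] and can be polarised; the factor 3 clears the denominators. *)
Let cubic X W : 3 * jform (jcross X (jcross X X)) W =
  (3 * tr X ^+ 3 - 3 * tr X * jform X X - jform (jcross X X) X) * tr W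
  - 3 * (tr X ^+ 2 - jform X X) * jform X W - 3 * tr X * jform (jcross X X) W.
Proof.
have E : 2 * tr (jadj X) = tr X ^+ 2 - jform X X.
  by rewrite -jformZr -jcross_adj jform_one_cross.
have N : 6 * jnorm X = jform (jcross X X) X.
  by rewrite jcross_adj jformZl jform_adj; ring.
rewrite jcross_adj jcrossZr jcross_adj_self -[in RHS]E.
have -> : 3 * tr X ^+ 3 - 3 * tr X * jform X X = 3 * tr X * (2 * tr (jadj X)).
  by rewrite E; ring.
rewrite -jcross_adj -N jcross_adj; jform_expand; ring.
Qed.

(** Inclusion and exclusion over the seven nonempty partial sums of [X], [Y], [Z] linearises
    [cubic]; this is the origin of the factor 6. *)
Lemma jcross_polar X Y Z :
  jcross X (jcross Y Z) + jcross Y (jcross X Z) + jcross Z (jcross X Y) =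
  (3 * tr X * tr Y * tr Z - tr X * jform Y Z - tr Y * jform X Z - tr Z * jform X Y
   - jform (jcross X Y) Z) *: jone K
  - (tr Y * tr Z - jform Y Z) *: X - (tr X * tr Z - jform X Z) *: Y
  - (tr X * tr Y - jform X Y) *: Z
  - tr X *: jcross Y Z - tr Y *: jcross X Z - tr Z *: jcross X Y.
Proof.
apply: jform_ext => W.
have C1 := cubic X W; have C2 := cubic Y W; have C3 := cubic Z W.
have C4 := cubic (X + Y) W; have C5 := cubic (Y + Z) W; have C6 := cubic (X + Z) W.
have C7 := cubic (X + Y + Z) W.
apply: (@mulfI K 6); first by rewrite pnatr_eq0.
have C : 3 * jform (jcross (X + Y + Z) (jcross (X + Y + Z) (X + Y + Z))) W
  - 3 * jform (jcross (X + Y) (jcross (X + Y) (X + Y))) W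
  - 3 * jform (jcross (Y + Z) (jcross (Y + Z) (Y + Z))) W
  - 3 * jform (jcross (X + Z) (jcross (X + Z) (X + Z))) W
  + 3 * jform (jcross X (jcross X X)) W + 3 * jform (jcross Y (jcross Y Y)) W
  + 3 * jform (jcross Z (jcross Z Z)) W =
    6 * jform (jcross X (jcross Y Z) + jcross Y (jcross X Z) + jcross Z (jcross X Y)) W.
  jform_expand.
  rewrite (jcrossC Y X) (jcrossC Z X) (jcrossC Z Y); ring.
rewrite -C C1 C2 C3 C4 C5 C6 C7; jform_expand.
rewrite (jcrossC Y X) (jcrossC Z X) (jcrossC Z Y).
rewrite (jformC Y X) (jformC Z X) (jformC Z Y).
have -> : jform (jcross Y Z) X = jform (jcross X Y) Z by rewrite [RHS]jform_cross_cyc.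
have -> : jform (jcross X Z) Y = jform (jcross X Y) Z.
  by rewrite 2![RHS]jform_cross_cyc (jcrossC X).
ring.
Qed.

Definition jprod X Y : albert K := 2^-1 *: jtriple X Y (jone K).

Lemma jtriple_oneE X Y : jtriple X Y (jone K) =
  (jform X Y - tr X * tr Y) *: jone K + tr Y *: X + tr X *: Y + jcross X Y.
Proof.
rewrite /jtriple [jcross X (jone K)]jcrossC jcross_one jcrossDl jcrossZl jcrossNl.
rewrite jcross_one; albert_module.
Qed.

(** After expansion into traces and cross products the two sides differ by the three double cross
    products only, and [jcross_polar] eliminates one of them. *)
Lemma jtriple_jprod X Y Z :
  jprod (jprod X Y) Z + jprod (jprod Z Y) X - jprod (jprod X Z) Y =
  2^-1 *: jtriple X Y Z.
Proof.
have L X' Y' : jprod (2^-1 *: X') Y' = 2^-1 *: jprod X' Y'.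
  rewrite /jprod !jtriple_oneE; albert_module.
rewrite {2 4 6}/jprod !L /jprod -!scalerDr -!scalerBr; congr (_ *: _).
apply: (@scalerI _ _ (2 : K)); first by rewrite pnatr_eq0.
rewrite scalerA divff ?pnatr_eq0 // scale1r.
have F A B C : jtriple (jtriple A B (jone K)) C (jone K) =
    (jform A C * tr B + jform B C * tr A + jform (jcross A B) C + jform A B * tr C
     - 3 * tr A * tr B * tr C) *: jone K
    + (tr B * tr C) *: A + (tr A * tr C) *: B + (jform A B + tr A * tr B) *: C
    + tr A *: jcross B C + tr B *: jcross A C + tr C *: jcross A B
    + jcross C (jcross A B).
  rewrite !jtriple_oneE; jform_expand.
  rewrite jform_one_cross jcross_one (jcrossC (jcross A B)).
  have -> : tr (jone K) = 3 by rewrite jform1E /=; ring.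
  albert_module.
have S : jcross X (jcross Y Z) = (3 * tr X * tr Y * tr Z - tr X * jform Y Z
   - tr Y * jform X Z - tr Z * jform X Y - jform (jcross X Y) Z) *: jone K
  - (tr Y * tr Z - jform Y Z) *: X - (tr X * tr Z - jform X Z) *: Y
  - (tr X * tr Y - jform X Y) *: Z
  - tr X *: jcross Y Z - tr Y *: jcross X Z - tr Z *: jcross X Y
  - jcross Y (jcross X Z) - jcross Z (jcross X Y).
  by rewrite -jcross_polar; albert_module.
rewrite !F /jtriple (jcrossC Z Y) (jcrossC (jcross X Z) Y) S.
have -> : jform (jcross Y Z) X = jform (jcross X Y) Z by rewrite [RHS]jform_cross_cyc.
have -> : jform (jcross X Z) Y = jform (jcross X Y) Z.
  by rewrite 2![RHS]jform_cross_cyc (jcrossC X).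
rewrite (jformC Z Y) (jformC Z X) (jformC Y X) (jcrossC Y X) (jcrossC Z X).
albert_module.
Qed.

End JordanProduct.

(** * The identification of octonion matrices with the Albert algebra *)

Section HermitianMatrices.
Variable R : realType.
Local Open Scope cd_scope.
Local Notation K := R[i].
Local Notation oct := (octonion K).
Local Notation J := (albert K).
Local Notation M := 'M[OC R]_3.
Implicit Types (k : K) (x y z : oct) (X Y Z : J) (i j : 'I_3).

Definition o2c x : OC R :=
  (((o0 x, o1 x), (o2 x, o3 x)), ((o4 x, o5 x), (o6 x, o7 x))).

Definition c2o (t : OC R) : oct :=
  O8 t.1.1.1 t.1.1.2 t.1.2.1 t.1.2.2 t.2.1.1 t.2.1.2 t.2.2.1 t.2.2.2.

Lemma o2cK : cancel o2c c2o. Proof. by case. Qed.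

Lemma c2oK : cancel c2o o2c.
Proof. by case=> [[[? ?] [? ?]] [[? ?] [? ?]]]. Qed.

Lemma o2cD x y : o2c (x + y) = o2c x + o2c y. Proof. by []. Qed.

Lemma o2cZ k x : o2c (k *: x) = k *: o2c x. Proof. by []. Qed.

Lemma o2c0 : o2c 0 = 0. Proof. by []. Qed.

Lemma OC_eq (a b c d e f g h a' b' c' d' e' f' g' h' : K) :
  O8 a b c d e f g h = O8 a' b' c' d' e' f' g' h' ->
  (((a, b), (c, d)), ((e, f), (g, h))) = (((a', b'), (c', d')), ((e', f'), (g', h'))) :> OC R.
Proof. by case=> -> -> -> -> -> -> -> ->. Qed.

Lemma o2cM x y : o2c x ⊡ o2c y = o2c (omul x y).
Proof.
case: x => ? ? ? ? ? ? ? ?; case: y => ? ? ? ? ? ? ? ?; rewrite O8M.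
by apply: OC_eq; apply: O8_eq; rewrite /=; ring.
Qed.

Lemma o2c_dia x : cddia (o2c x) = o2c (odia x).
Proof. by case: x => *; rewrite O8_dia. Qed.

Lemma o2c_star x : cdstar (o2c x) = o2c (odia (oconj x)).
Proof.
by case: x => *; rewrite /oconj O8_dia.
Qed.

Lemma o2c_scal k : cdscal 3 k = o2c (oscal k).
Proof. by rewrite O8_scal. Qed.

Definition jentry X i j : oct :=
  nth 0 (nth [::] [:: [:: oscal (ja X); jz X; odia (jy X)];
                      [:: odia (jz X); oscal (jb X); jx X];
                      [:: jy X; odia (jx X); oscal (jc X)]] i) j.

Definition mk X : M := \matrix_(i, j) o2c (jentry X i j).

Lemma jentry_ext X Y : (forall i j, jentry X i j = jentry Y i j) -> X = Y.
Proof.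
case: X => a b c x y z; case: Y => a' b' c' x' y' z' H.
have S k k' : oscal k = oscal k' :> oct -> k = k'.
  by move/(congr1 (@ore K)); rewrite !ore_scal.
by apply: J6_eq; [apply: S (H 0 0)|apply: S (H 1 1)|apply: S (H 2 2)
  |exact: H 1 2|exact: H 2 0|exact: H 0 1].
Qed.

Lemma mk_inj : injective mk.
Proof.
move=> X Y E; apply: jentry_ext => i j; apply: (can_inj o2cK).
by have := congr1 (fun A : M => A i j) E; rewrite !mxE.
Qed.

Lemma ord3P (P : 'I_3 -> Prop) : P 0 -> P 1 -> P 2 -> forall i, P i.
Proof.
move=> P0 P1 P2 [[|[|[|//]]] i3].
- by rewrite (_ : Ordinal i3 = 0) //; exact: val_inj.
- by rewrite (_ : Ordinal i3 = 1) //; exact: val_inj.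
by rewrite (_ : Ordinal i3 = 2) //; exact: val_inj.
Qed.

Lemma oscalD k k' : oscal (k + k') = oscal k + oscal k' :> oct.
Proof. by rewrite !O8_scal O8D !addr0. Qed.

Lemma jentryP k X Y i j : jentry (k *: X + Y) i j = k *: jentry X i j + jentry Y i j.
Proof.
by elim/ord3P: i; elim/ord3P: j; rewrite /jentry /= ?oscalD -?oscalZ ?odiaD ?odiaZ.
Qed.

Lemma mkP k X Y : mk (k *: X + Y) = k ⋅ mk X + mk Y.
Proof. by apply/matrixP => i j; rewrite !mxE jentryP o2cD o2cZ. Qed.

Lemma mkC6 X : C6 R (mk X).
Proof.
apply/matrixP => i j; rewrite !mxE o2c_dia; congr o2c.
by elim/ord3P: i; elim/ord3P: j; rewrite /jentry /= ?odia_scal ?odiaK.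
Qed.

Lemma odia_fix x : odia x = x -> x = oscal (ore x).
Proof.
case: x => a b c d e f g h; rewrite O8_dia O8_scal oreE /=.
have opp0 (p : K) : - p = p -> p = 0.
  by move=> /esym/eqP; rewrite -addr_eq0 -mulr2n mulrn_eq0 => /eqP.
by case=> /opp0 -> /opp0 -> /opp0 -> /opp0 -> /opp0 -> /opp0 -> /opp0 ->.
Qed.

Definition unmk (A : M) : J := J6 (ore (c2o (A 0 0))) (ore (c2o (A 1 1)))
  (ore (c2o (A 2 2))) (c2o (A 1 2)) (c2o (A 2 0)) (c2o (A 0 1)).

Lemma unmkK A : C6 R A -> mk (unmk A) = A.
Proof.
move=> hA; have E i j : c2o (A i j) = odia (c2o (A j i)).
  by rewrite -[in LHS]hA !mxE -[A j i in LHS]c2oK o2c_dia o2cK.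
apply/matrixP => i j; rewrite mxE -[RHS]c2oK; congr o2c.
by elim/ord3P: i; elim/ord3P: j; rewrite /jentry /= -?odia_fix // -E.
Qed.

Lemma C6P A : C6 R A -> exists X, A = mk X.
Proof. by move=> hA; exists (unmk A); rewrite unmkK. Qed.

Lemma mk_star X : cdmx_star (mk X) = mk (jconj X).
Proof.
apply/matrixP => i j; rewrite !mxE o2c_star; congr o2c.
by elim/ord3P: i; elim/ord3P: j;
  rewrite /jentry /= ?oconj_scal ?odia_scal ?oconj_dia ?odiaK.
Qed.

Lemma mk_one : cdmx_one = mk (jone K).
Proof.
apply/matrixP => i j; rewrite !mxE o2c_scal.
by elim/ord3P: i; elim/ord3P: j; rewrite /jentry /= ?odia0 ?o2c0.
Qed.

Lemma mkD X Y : mk (X + Y) = mk X + mk Y.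
Proof.
have := mkP 1 X Y; rewrite scale1r => ->; congr (_ + _).
by apply/matrixP => i j; rewrite !mxE scale1r.
Qed.

Lemma mkZ k X : mk (k *: X) = k ⋅ mk X.
Proof.
apply/matrixP => i j; rewrite !mxE -o2cZ; congr o2c.
by elim/ord3P: i; elim/ord3P: j; rewrite /jentry /= -?oscalZ ?odiaZ.
Qed.

Lemma mk0 : mk 0 = 0.
Proof.
have := mkD 0 0; rewrite addr0 => /eqP.
by rewrite -subr_eq0 opprD addNKr oppr_eq0 => /eqP.
Qed.

Lemma mkB X Y : mk (X - Y) = mk X - mk Y.
Proof. by apply/eqP; rewrite eq_sym subr_eq -mkD subrK. Qed.

Lemma mk_jmul X Y : jmul (mk X) (mk Y) = mk (jprod X Y).
Proof.
rewrite /jprod mkZ /jmul; congr (_ ⋅ _); rewrite jtriple_oneE.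
rewrite !jform_one; case: X => a b c x y z; case: Y => a' b' c' x' y' z'.
set Z := (X in _ = mk X); have {Z}-> : Z = J6 (2 * (a * a' + odot y y' + odot z z'))
    (2 * (b * b' + odot z z' + odot x x')) (2 * (c * c' + odot x x' + odot y y'))
    (odia (omul y z' + omul y' z) + (b + c) *: x' + (b' + c') *: x)
    (odia (omul z x' + omul z' x) + (c + a) *: y' + (c' + a') *: y)
    (odia (omul x y' + omul x' y) + (a + b) *: z' + (a' + b') *: z).
  rewrite /Z jformE jcrossE /=; apply: J6_eq; rewrite /= ?scaler0 ?add0r.
  1-3: by ring.
  - move: (odia _) => p; oct_module.
  - move: (odia _) => p; oct_module.
  move: (odia _) => p; oct_module.
apply/matrixP => i j; rewrite !mxE !big_ord3 !mxE !o2cM -!o2cD; congr o2c.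
elim/ord3P: i; elim/ord3P: j; rewrite /jentry /= ?omul_scall ?omul_scalr.
1,5,9: by_coordinates.
all: rewrite ?odiaD ?odiaZ ?odiaM ?odiaK.
all: oct_module.
Qed.

Lemma mk_triple X Y Z : triple (mk X) (mk Y) (mk Z) = mk (2^-1 *: jtrip X Y Z).
Proof. by rewrite /triple mk_star !mk_jmul -mkD -mkB jtriple_jprod. Qed.

End HermitianMatrices.

(** * The determinants of the Cartan factor as quotients of norms *)

Section DeterminantsAsNorms.
Variable R : realType.
Local Open Scope classical_set_scope.
Local Open Scope ring_scope.
Local Open Scope cd_scope.
Local Notation K := R[i].
Local Notation J := (albert K).
Local Notation M := 'M[OC R]_3.
Local Notation "x %:C" := (real_complex R x) : ring_scope.
Implicit Types (k : K) (X Y Z U V W : J) (v : 'I_3 -> J) (u x : M) (w : 'I_3 -> M).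

(** Mediates between the triple product of matrices and [jtrip], which is kept free of the factor
    one half. *)
Lemma half_eq (X Y : J) : 2^-1 *: X = Y <-> X = 2 *: Y.
Proof.
have n2 : (2 : K) != 0 by rewrite pnatr_eq0.
split=> [<-|->]; first by rewrite scalerA divff // scale1r.
by rewrite scalerA mulVf // scale1r.
Qed.

Lemma triple_mkP X Y Z W : triple (mk X) (mk Y) (mk Z) = mk W <-> jtrip X Y Z = 2 *: W.
Proof.
rewrite mk_triple -half_eq; split=> [/mk_inj //|->//].
Qed.

Lemma unitaryP U : unitary (mk U) <-> junitary U.
Proof.
split=> [[_ H] X|H]; first by apply/triple_mkP/H/mkC6.
by split=> [|_ /C6P[X ->]]; [exact: mkC6|exact/triple_mkP/H].
Qed.

Lemma tripotentP V : tripotent (mk V) <-> jtripotent V.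
Proof.
split=> [[_ /triple_mkP]//|H]; split; [exact: mkC6|exact/triple_mkP].
Qed.

Lemma orthogonalP V W : orthogonal (mk V) (mk W) <-> jtrip V V W = 0.
Proof.
by rewrite /orthogonal -mk0; split=> [/triple_mkP|E]; [|apply/triple_mkP]; rewrite scaler0.
Qed.

Lemma minimal_tripotentP V : minimal_tripotent (mk V) <-> jminimal V.
Proof.
split=> [[/tripotentP HV Hr H0]|[HV V0 Hr]]; split=> //; first 1 last.
- move=> X HX; have : [set x | C6 R x /\ triple (mk V) (mk V) x = x] (mk X).
    by split; [exact: mkC6|exact/triple_mkP].
  by rewrite Hr => -[k _]; rewrite -mkZ => /mk_inj <-; exists k.
- exact/tripotentP.
- apply/seteqP; split=> [x [/C6P[X ->{x}] /triple_mkP /Hr[k ->]]|x [k _ <-]].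
    by exists k => //; rewrite mkZ.
  rewrite -mkZ; split; first exact: mkC6.
  apply/triple_mkP; have := HV; rewrite /jtripotent /jtrip /jtriple => {}HV.
  have -> : 2 *: (k *: V) = k *: (2 *: V) by rewrite scalerA mulrC -scalerA.
  by rewrite -HV; albert_module.
- move=> E; apply: V0; apply: mk_inj; rewrite mk0.
  have : range (fun a => a ⋅ mk V) (mk V) by exists 1 => //; rewrite -mkZ scale1r.
  by rewrite E.
move=> V0; apply: H0; apply/seteqP; split=> [x [k _ <-]|x ->] /=.
  by rewrite -mkZ V0 scaler0 mk0.
by exists 0 => //; rewrite -mkZ scale0r mk0.
Qed.

Lemma frame_belowP U v : frame_below (mk U) (@mk R \o v) <-> jframe U v.
Proof.
split=> [[H1 H2 H3]|[H1 H2 H3]]; split.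
- by move=> j; apply/minimal_tripotentP/H1.
- by move=> i j ij; apply/orthogonalP/H2.
- move=> j; have [] := H3 j; rewrite /= -mkB.
  by move=> /tripotentP ? /orthogonalP.
- by move=> j; apply/minimal_tripotentP/H1.
- by move=> i j ij; apply/orthogonalP/H2.
move=> j; have [? ?] := H3 j; split; rewrite /= -mkB; first exact/tripotentP.
exact/orthogonalP.
Qed.

Lemma frame_below_mk U w : frame_below (mk U) w -> exists v, w = @mk R \o v.
Proof.
case=> H _ _; exists (@unmk R \o w); apply/funext => j /=.
by rewrite unmkK //; case: (H j) => -[].
Qed.

Lemma mk_sum (a : 'I_3 -> K) v : mk (\sum_j a j *: v j) = \sum_j a j ⋅ mk (v j).
Proof. by rewrite !big_ord3 !mkD !mkZ. Qed.

Lemma real_repP U X (a : 'I_3 -> R) v :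
  real_rep (mk U) (mk X) a (@mk R \o v) <-> jrep U v (fun j => (a j)%:C) X.
Proof.
by split=> -[/frame_belowP Fv]; [rewrite -mk_sum => /mk_inj|move=> ->; rewrite mk_sum].
Qed.

Lemma normC1 k : `|k| = 1 <-> k * conjc k = 1.
Proof.
rewrite -[k * conjc k]normCK; split=> [->|/eqP]; first by rewrite expr1n.
by rewrite sqrp_eq1 // => /eqP.
Qed.

Lemma unitary_repP U X (a : 'I_3 -> K) v : unitary_rep (mk U) (mk X) a (@mk R \o v) <->
  (forall j, a j * conjc (a j) = 1) /\ jrep U v a X.
Proof.
split=> [[Ha /frame_belowP Fv]|[Ha [/frame_belowP Fv HX]]].
  by rewrite -mk_sum => /mk_inj; split=> // j; exact/normC1.
by split=> [j|//|]; [exact/normC1|rewrite HX mk_sum].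
Qed.

(** The right side does not mention the representation, so the choice made by [xget] is
    immaterial. *)
Lemma dtR_rep U X a w : junitary U -> real_rep (mk U) (mk X) a w ->
  \prod_j (a j)%:C = jnorm X / jnorm U.
Proof.
move=> HU H; have [v Ev] := frame_below_mk H.1; move: H; rewrite Ev => /real_repP H.
by rewrite (jrep_norm HU H) mulfK // jnorm_unitary_neq0.
Qed.

Lemma dtR_jnorm U X : junitary U -> jtrip U X U = 2 *: X ->
  dtR (mk U) (mk X) = jnorm X / jnorm U.
Proof.
move=> HU HX; have [a [v /real_repP H]] := real_rep_exists HU HX.
(* The default value 0 is excluded by the representation just found. *)
rewrite /dtR; case: xgetP => [d _ [b [w [Hw ->]]]|]; first exact: dtR_rep Hw.
by move=> /(_ (\prod_j (a j)%:C)) []; exists a, (@mk R \o v).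
Qed.

Lemma dtU_jnorm U X : junitary U -> junitary X ->
  dtU (mk U) (mk X) = jnorm X / jnorm U.
Proof.
move=> HU HX; have [a [v /unitary_repP H]] := unitary_rep_exists HU HX.
rewrite /dtU; case: xgetP => [d _ [b [w [Hw ->]]]|]; last first.
  by move=> /(_ (\prod_j a j)) []; exists a, (@mk R \o v).
have [v' Ev] := let: And3 _ F _ := Hw in frame_below_mk F.
move: Hw; rewrite Ev => /unitary_repP[_ Hw].
by rewrite (jrep_norm HU Hw) mulfK // jnorm_unitary_neq0.
Qed.

Lemma dtU_one X : junitary X -> dtU cdmx_one (mk X) = jnorm X.
Proof.
move=> HX; rewrite mk_one dtU_jnorm //; last exact: junitary_one.
by rewrite jone_norm divr1.
Qed.

(** The denominator [jnorm U] of the first factor is the second factor, so the choice of [U]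
    cancels. *)
Lemma dt_factor U X : junitary U -> jtrip U X U = 2 *: X ->
  dtR (mk U) (mk X) * dtU cdmx_one (mk U) = jnorm X.
Proof.
move=> HU HX; by rewrite dtR_jnorm // dtU_one // divfK // jnorm_unitary_neq0.
Qed.

Lemma dt_jnorm X : dt (mk X) = jnorm X.
Proof.
rewrite /dt; case: xgetP => [d _ [u []]|].
  move=> Hu; have [U EU] := C6P Hu.1; move: Hu; rewrite EU => /unitaryP HU.
  by move=> /esym/triple_mkP HX ->; exact: dt_factor.
(* Polar decomposition excludes the default value of [xget]. *)
have [U [HU HX]] := polar_exists X.
move=> /(_ (dtR (mk U) (mk X) * dtU cdmx_one (mk U))) [].
by exists (mk U); split; [exact/unitaryP|apply/esym/triple_mkP|].
Qed.

End DeterminantsAsNorms.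

(** * Biquaternionic matrices *)

Section Biquaternions.
Variable R : realType.
Local Open Scope cd_scope.
Local Notation K := R[i].

Definition quat : Type := HC R.
HB.instance Definition _ := GRing.Zmodule.copy quat (HC R).

Implicit Types (p q r : quat) (k : K).

Let HC_eq (a b c d a' b' c' d' : K) : a = a' -> b = b' -> c = c' -> d = d' ->
  ((a, b), (c, d)) = ((a', b'), (c', d')) :> HC R.
Proof. by move=> -> -> -> ->. Qed.

Fact quat_mulA : associative (fun p q : quat => (p : HC R) ⊡ q).
Proof.
by move=> [[? ?] [? ?]] [[? ?] [? ?]] [[? ?] [? ?]]; apply: HC_eq; rewrite /=; ring.
Qed.

Fact quat_mul1 : left_id (cdscal 2 1 : quat) (fun p q : quat => (p : HC R) ⊡ q).
Proof. by move=> [[? ?] [? ?]]; apply: HC_eq; rewrite /=; ring. Qed.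

Fact quat_mulr1 : right_id (cdscal 2 1 : quat) (fun p q : quat => (p : HC R) ⊡ q).
Proof. by move=> [[? ?] [? ?]]; apply: HC_eq; rewrite /=; ring. Qed.

Fact quat_mulDl : left_distributive (fun p q : quat => (p : HC R) ⊡ q) +%R.
Proof.
by move=> [[? ?] [? ?]] [[? ?] [? ?]] [[? ?] [? ?]]; apply: HC_eq; rewrite /=; ring.
Qed.

Fact quat_mulDr : right_distributive (fun p q : quat => (p : HC R) ⊡ q) +%R.
Proof.
by move=> [[? ?] [? ?]] [[? ?] [? ?]] [[? ?] [? ?]]; apply: HC_eq; rewrite /=; ring.
Qed.

Fact quat_1neq0 : (cdscal 2 1 : quat) != 0.
Proof. by apply/eqP => -[/eqP]; rewrite oner_eq0. Qed.

HB.instance Definition _ := GRing.Zmodule_isNzRing.Build quat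
  quat_mulA quat_mul1 quat_mulr1 quat_mulDl quat_mulDr quat_1neq0.

Lemma quat_scal k q : k *: (q : HC R) = (cdscal 2 k : quat) * q.
Proof. by case: q => [[? ?] [? ?]]; apply: HC_eq; rewrite /= -?[_ *: _]/(_ * _); ring. Qed.

Lemma quat_scalC k q : (cdscal 2 k : quat) * q = q * (cdscal 2 k : quat).
Proof. by case: q => [[? ?] [? ?]]; apply: HC_eq; rewrite /=; ring. Qed.

Lemma quat_diaM p q : cddia (p * q : HC R) = (cddia (q : HC R) : quat) * cddia (p : HC R).
Proof.
by move: p q => [[? ?] [? ?]] [[? ?] [? ?]]; apply: HC_eq; rewrite /=; ring.
Qed.

Lemma quat_starM p q : cdstar (p * q : HC R) = (cdstar (q : HC R) : quat) * cdstar (p : HC R).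
Proof.
move: p q => [[? ?] [? ?]] [[? ?] [? ?]].
by apply: HC_eq; rewrite /= !(rmorphD, rmorphB, rmorphM, rmorphN) /=; ring.
Qed.

Lemma quat_starD p q : cdstar (p + q : HC R) = cdstar (p : HC R) + cdstar (q : HC R).
Proof.
move: p q => [[? ?] [? ?]] [[? ?] [? ?]].
by apply: HC_eq; rewrite /= !(rmorphD, rmorphN) /= ?opprD.
Qed.

Lemma quat_diaD p q : cddia (p + q : HC R) = cddia (p : HC R) + cddia (q : HC R).
Proof.
by move: p q => [[? ?] [? ?]] [[? ?] [? ?]]; apply: HC_eq; rewrite /= ?opprD.
Qed.

Lemma quat_starK p : cdstar (cdstar (p : HC R)) = p.
Proof.
by move: p => [[? ?] [? ?]]; apply: HC_eq; rewrite /= ?rmorphN /= ?conjcK ?opprK.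
Qed.

Lemma quat_star_dia p : cdstar (cddia (p : HC R)) = cddia (cdstar (p : HC R)).
Proof.
by move: p => [[? ?] [? ?]]; apply: HC_eq; rewrite /= ?rmorphN.
Qed.

Lemma quat_reC p q : (p * q : HC R).1.1 = (q * p : HC R).1.1.
Proof. by move: p q => [[? ?] [? ?]] [[? ?] [? ?]]; rewrite /=; ring. Qed.

End Biquaternions.

Section BiquaternionMatrices.
Variable R : realType.
Local Open Scope cd_scope.
Local Notation K := R[i].
Local Notation A := 'M[quat R]_3.
Implicit Types (x y z u v : A) (k : K).

Lemma cdmx_mulE x y : (x : 'M[HC R]_3) ⊠ y = x * y.
Proof. by apply/matrixP => i j; rewrite !mxE. Qed.

Lemma cdmx_oneE : (cdmx_one : 'M[HC R]_3) = (1 : A).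
Proof. by apply/matrixP => i j; rewrite !mxE; case: eqP. Qed.

(** Complex scalars enter as central matrices, since [quat R] is equipped with a ring structure
    only. *)
Definition qscal k : A := (cdscal 2 k : quat R)%:M.

Lemma cdmx_scaleE k x : k ⋅ (x : 'M[HC R]_3) = qscal k * x.
Proof.
apply/matrixP => i j; rewrite mxE quat_scal.
by rewrite -[qscal k * x]/(_%:M *m x) mul_scalar_mx mxE.
Qed.

Lemma qscalC k x : qscal k * x = x * qscal k.
Proof.
apply/matrixP => i j; rewrite -[qscal k * x]/(_%:M *m x).
rewrite mul_scalar_mx mxE quat_scalC.
rewrite -[x * _]/(x *m _) mxE (bigD1 j) //= mxE eqxx mulr1n big1 ?addr0 // => l lj.
by rewrite mxE (negPf lj) mulr0n mulr0.
Qed.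

Lemma qscal1 : qscal 1 = 1. Proof. by []. Qed.

Lemma qscalD k k' : qscal (k + k') = qscal k + qscal k'.
Proof. by rewrite -[RHS]raddfD /=; congr (_%:M); congr ((_, _), (_, _)); rewrite /= addr0. Qed.

Lemma qscal0 : qscal 0 = 0.
Proof. by apply/matrixP => i j; rewrite !mxE -[cdscal 2 0]/(0 : quat R) mul0rn. Qed.

Lemma qscalN k : qscal (- k) = - qscal k.
Proof. by apply/eqP; rewrite -addr_eq0 -qscalD addNr qscal0. Qed.

Definition qstar x : A := cdmx_star (x : 'M[HC R]_3).
Definition qdia x : A := cdmx_dia (x : 'M[HC R]_3).

Lemma qstarM x y : qstar (x * y) = qstar y * qstar x.
Proof.
apply/matrixP => i j; rewrite -[x * y]/(x *m y) -[RHS]/((_ *m _) i j) !mxE.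
by rewrite !big_ord3 !quat_starD !quat_starM !mxE.
Qed.

Lemma qdiaM x y : qdia (x * y) = qdia y * qdia x.
Proof.
apply/matrixP => i j; rewrite -[x * y]/(x *m y) -[RHS]/((_ *m _) i j) !mxE.
by rewrite !big_ord3 !quat_diaD !quat_diaM !mxE.
Qed.

Lemma qstarK x : qstar (qstar x) = x.
Proof. by apply/matrixP => i j; rewrite !mxE quat_starK. Qed.

Lemma qstar_dia x : qstar (qdia x) = qdia (qstar x).
Proof. by apply/matrixP => i j; rewrite !mxE quat_star_dia. Qed.

Lemma qstar1 : qstar 1 = 1.
Proof. by have := qstarM 1 (qstar 1); rewrite mul1r qstarK mul1r => <-. Qed.

(** Scalar parts of the diagonal. The value at the unit is 3, which matches the trace
    [jform (jone K)] of the Albert algebra. *)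
Definition qtr x : K := \sum_i (x i i : HC R).1.1.

Lemma qtrC x y : qtr (x * y) = qtr (y * x).
Proof.
rewrite /qtr -[x * y]/(x *m y) -[y * x]/(y *m x).
have S z t i : ((z *m t) i i : HC R).1.1 = \sum_j (z i j * t j i : HC R).1.1.
  by rewrite mxE !big_ord3.
under eq_bigr do rewrite S; under [RHS]eq_bigr do rewrite S.
rewrite exchange_big; apply: eq_bigr => i _; apply: eq_bigr => j _.
exact: quat_reC.
Qed.

Lemma qtrP k x y : qtr (qscal k * x + y) = k * qtr x + qtr y.
Proof.
rewrite -cdmx_scaleE /qtr mulr_sumr -big_split /=; apply: eq_bigr => i _.
by rewrite !mxE.
Qed.

End BiquaternionMatrices.

Section SpecialTriple.
Variable A : nzRingType.
Variables (h x w z : A).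
Hypotheses (hC : forall t, t * h = h * t) (h2 : h + h = 1).

(** In an associative algebra the Jordan triple product is half of [x w z + z w x]. The parameters
    [m] and [e] stand for the scalar matrices of -1 and 1 that [relD] produces, and [h] for that of
    one half. *)
Lemma special_triple (m e : A) : m = - 1 -> e = 1 ->
  m * (h * (h * (x * z + z * x) * w + w * (h * (x * z + z * x)))) +
  (e * (h * (h * (x * w + w * x) * z + z * (h * (x * w + w * x)))) +
   h * (h * (z * w + w * z) * x + x * (h * (z * w + w * z)))) =
  h * (x * w * z + z * w * x).
Proof.
have C s t : s * (h * t) = h * (s * t) by rewrite !mulrA hC.
have D s t : h * s * t = h * (s * t) by rewrite mulrA.
move=> -> ->; rewrite mulN1r mul1r addrC.
rewrite !D !C -!mulrDr -!mulrBr; congr (_ * _).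
rewrite -[RHS]mul1r -h2 [RHS]mulrDl -[RHS]mulrDr; congr (_ * _).
apply/eqP; rewrite subr_eq !mulrDl !mulrDr !mulrA !addrA.
by apply/eqP; rewrite [LHS](ACl (1*4*8*5*7*3*2*6)%AC).
Qed.

End SpecialTriple.

Section InclusionOfBiquaternions.
Variable R : realType.
Local Open Scope cd_scope.
Local Notation K := R[i].
Local Notation J := (albert K).
Local Notation Q := (quat R).
Local Notation A := 'M[quat R]_3.
Implicit Types (p q : Q) (x y z u v w : A) (X Y Z U V : J) (k : K).

Definition q2o (p : HC R) : octonion K := O8 p.1.1 p.1.2 p.2.1 p.2.2 0 0 0 0.

Lemma q2o_incl p : o2c (q2o p) = cdincl p.
Proof. by case: p => [[? ?] [? ?]]. Qed.

Lemma q2o_inj : injective q2o.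
Proof. by move=> [[? ?] [? ?]] [[? ?] [? ?]] [] /= -> -> -> ->. Qed.

Lemma q2oM p q : omul (q2o p) (q2o q) = q2o (p * q : Q).
Proof.
by move: p q => [[? ?] [? ?]] [[? ?] [? ?]]; rewrite /q2o O8M; apply: O8_eq; rewrite /=; ring.
Qed.

Lemma q2o_dia p : odia (q2o p) = q2o (cddia (p : HC R)).
Proof. by case: p => [[? ?] [? ?]]; rewrite /q2o O8_dia; apply: O8_eq; rewrite /= ?oppr0. Qed.

Lemma q2o_conj p : oconj (q2o p) = q2o (cdconj (p : HC R)).
Proof. by case: p => [[? ?] [? ?]]; apply: O8_eq => //; exact: (rmorph0 (@conjc R)). Qed.

Lemma q2oD p q : q2o (p + q) = q2o p + q2o q.
Proof. by apply: O8_eq; rewrite /= ?addr0. Qed.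

Lemma q2oZ k p : q2o (k *: (p : HC R)) = k *: q2o p.
Proof. by apply: O8_eq; rewrite /= ?mulr0. Qed.

(** Both sides describe the same octonion matrix. Only hermitian [x] are related to some [X], while
    products leave the hermitian matrices, so a relation is handier than a map. *)
Definition rel X x := forall i j, jentry X i j = q2o (x i j).

Lemma relE X x : mk X = inclO (x : 'M[HC R]_3) <-> rel X x.
Proof.
split=> [E i j|E]; last by apply/matrixP => i j; rewrite !mxE E q2o_incl.
apply: (can_inj (@o2cK R)); rewrite q2o_incl.
by have := congr1 (fun B : 'M_3 => B i j) E; rewrite !mxE.
Qed.

Lemma relD k X Y x y : rel X x -> rel Y y -> rel (k *: X + Y) (qscal k * x + y).
Proof.
move=> Ex Ey i j; rewrite jentryP Ex Ey -cdmx_scaleE mxE.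
by rewrite q2oD; congr (_ + _); rewrite mxE q2oZ.
Qed.

Lemma rel_one : rel (jone K) 1.
Proof.
apply/relE; rewrite -mk_one -cdmx_oneE; apply/matrixP => i j; rewrite !mxE.
by case: eqP.
Qed.

Lemma rel_jprod X Y x y : rel X x -> rel Y y ->
  rel (jprod X Y) (qscal 2^-1 * (x * y + y * x)).
Proof.
move=> Ex Ey; apply/relE; rewrite -mk_jmul /jmul.
move/relE: Ex => ->; move/relE: Ey => ->; rewrite -cdmx_scaleE.
have M (x' y' : A) :
    inclO (x' : 'M[HC R]_3) ⊠ inclO (y' : 'M[HC R]_3) = inclO (x' * y' : 'M[HC R]_3).
  rewrite -cdmx_mulE; apply/matrixP => i j; rewrite !mxE !big_ord3 !mxE.
  by rewrite -!q2o_incl !o2cM -!o2cD !q2oM -!q2oD.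
rewrite !M; apply/matrixP => i j; rewrite !mxE.
by rewrite -!q2o_incl -!o2cD -q2oD -o2cZ -q2oZ.
Qed.

Lemma rel_conj X x : rel X x -> rel (jconj X) (qstar x).
Proof.
move/relE => Ex; apply/relE; rewrite -mk_star Ex.
apply/matrixP => i j; rewrite !mxE.
rewrite -q2o_incl o2c_star q2o_conj q2o_dia q2o_incl; congr cdincl.

Qed.

Lemma rel_trip X Y Z x y z : rel X x -> rel Y y -> rel Z z ->
  rel (2^-1 *: jtrip X Y Z) (qscal 2^-1 * (x * qstar y * z + z * qstar y * x)).
Proof.
move=> Ex Ey Ez; rewrite -jtriple_jprod.
have Ew := rel_conj Ey; move: (jconj Y) (qstar y) Ew => W w Ew {Y y Ey}.
have E1 := rel_jprod (rel_jprod Ex Ew) Ez.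
have E2 := rel_jprod (rel_jprod Ez Ew) Ex.
have E3 := rel_jprod (rel_jprod Ex Ez) Ew.
set j1 := jprod (jprod X W) Z in E1 *; set j2 := jprod (jprod Z W) X in E2 *.
set j3 := jprod (jprod X Z) W in E3 *.
have -> : j1 + j2 - j3 = -1 *: j3 + (1 *: j1 + j2) by rewrite scaleN1r scale1r addrC.
have := relD (-1) E3 (relD 1 E1 E2); congr rel.
apply: special_triple.
- by move=> t; rewrite qscalC.
- by rewrite -qscalD -[in RHS]qscal1; congr qscal; field.
- by rewrite qscalN qscal1.
exact: qscal1.
Qed.

Lemma rel_entries X x : rel X x -> [/\ x 0 0 = cdscal 2 (ja X),
  x 1 1 = cdscal 2 (jb X), x 2 2 = cdscal 2 (jc X) &
  [/\ q2o (x 1 2) = jx X, q2o (x 2 0) = jy X & q2o (x 0 1) = jz X] /\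
  [/\ x 2 1 = cddia (x 1 2 : HC R), x 0 2 = cddia (x 2 0 : HC R) &
      x 1 0 = cddia (x 0 1 : HC R)]].
Proof.
move=> H; have S k : oscal k = q2o (cdscal 2 k) by rewrite O8_scal.
split; first by apply: q2o_inj; rewrite -H -S.
- by apply: q2o_inj; rewrite -H -S.
- by apply: q2o_inj; rewrite -H -S.
split; split; rewrite -?H //; apply: q2o_inj; by rewrite -q2o_dia -!H.
Qed.

Lemma rel_form X Y x y : rel X x -> rel Y y -> jform X Y = qtr (x * y).
Proof.
move=> /rel_entries[E1 E2 E3 [[Fx Fy Fz] [G1 G2 G3]]].
move=> /rel_entries[E1' E2' E3' [[Fx' Fy' Fz'] [G1' G2' G3']]].
rewrite /qtr -[x * y]/(x *m y) big_ord3 !mxE !big_ord3.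
rewrite E1 E2 E3 G1 G2 G3 E1' E2' E3' G1' G2' G3' (albert_eta X) (albert_eta Y).
rewrite -Fx -Fy -Fz -Fx' -Fy' -Fz' jformE /q2o !O8_dot.
move: (x 1 2) (x 2 0) (x 0 1) (y 1 2) (y 2 0) (y 0 1).
do 6! case=> [[? ?] [? ?]].
rewrite /=; ring.
Qed.

Lemma rel_dt3 X x : rel X x -> dt3 (x : 'M[HC R]_3) = cdscal 2 (jnorm X).
Proof.
move=> /rel_entries[E1 E2 E3 [[Fx Fy Fz] [G1 G2 G3]]].
rewrite /dt3 E1 E2 E3 G1 G2 G3 (albert_eta X) -Fx -Fy -Fz jnormE q2o_dia.
rewrite (@q2oM (x 0 1) (x 1 2)) /q2o !O8_dot.
move: (x 1 2) (x 2 0) (x 0 1); do 3! case=> [[? ?] [? ?]].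
by congr ((_, _), (_, _)); rewrite /=; ring.
Qed.

End InclusionOfBiquaternions.

Section TwoSidedInverse.
Variable A : nzRingType.

(* The products [u * w] and [w * u] are idempotents with sum [2]. *)
Lemma special_inverse (u w h : A) : h * (1 + 1) = 1 -> u * w + w * u = 1 + 1 ->
  u * w * u = u -> u * w = 1 /\ w * u = 1.
Proof.
move=> h2 E1 E2; suff uw : u * w = 1.
  by split=> //; move/eqP: E1; rewrite uw (inj_eq (addrI _)) => /eqP.
have pp : u * w * (u * w) = u * w by rewrite mulrA E2.
have qq : w * u * (w * u) = w * u by rewrite -mulrA (mulrA u) E2.
have q : w * u = 1 + 1 - u * w by rewrite -E1 addrC addKr.
move: qq pp; rewrite {}q; move: (u * w) => p {E1 E2} qq pp.
have ee : (1 - p) * (1 - p) = 1 - p by rewrite mulrBr mulr1 mulrBl mul1r pp subrr subr0.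
(* With [e = 1 - p] idempotent, idempotency of [1 + e] leaves [2 e = 0]. *)
have : (1 - p) + (1 - p) = 0.
  apply: (addrI (1 + (1 - p))); rewrite addr0; rewrite -!addrA in qq.
  by rewrite -[RHS]qq mulrDr mulr1 mulrDl mul1r ee.
move/(congr1 ( *%R h)); rewrite mulr0 -{1 2}[1 - p]mul1r -mulrDl mulrA h2 mul1r.
by move/eqP; rewrite subr_eq0 => /eqP.
Qed.
End TwoSidedInverse.

(** * Newton's identities relative to a unitary *)

Section NewtonIdentity.
Variable R : rcfType.
Local Notation K := R[i].
Local Notation J := (albert K).
Implicit Types (k : K) (X Y Z U V : J).
Local Notation tr := (jform (jone K)).

(** Six times the third elementary symmetric function of three numbers in terms of their power
    sums. *)
Definition newton (t1 t2 t3 : K) := t1 ^+ 3 - 3 * t1 * t2 + 2 * t3.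

Lemma jtriple_mid_one X Z : jtriple X (jone K) Z = jtriple X Z (jone K).
Proof.
rewrite jtriple_oneE /jtriple [jcross (jcross X Z) _]jcrossC jcross_one.
rewrite jform_one_cross [jform X (jone K)]jformC [jform Z _]jformC; albert_module.
Qed.

Lemma jform_one_jprod X Y : tr (2^-1 *: jtriple X Y (jone K)) = jform X Y.
Proof.
rewrite jtriple_oneE; jform_expand; rewrite jform_one_cross.
have -> : tr (jone K) = 3 by rewrite jform1E /=; ring.
by field.
Qed.

(** Powers in the isotope with unit [U]; for biquaternion matrices the star of [u] stands between
    the factors. *)
Definition jsquare U X := 2^-1 *: jtrip X U X.
Definition jcube U X := 2^-1 *: jtrip X U (jsquare U X).

Lemma newton_one X : 6 * jnorm X =
  newton (jherm X (jone K)) (jherm (jsquare (jone K) X) (jone K))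
    (jherm (jcube (jone K) X) (jone K)).
Proof.
have N : 6 * jnorm X = jform (jcross X X) X.
  by rewrite jcross_adj jformZl jform_adj; ring.
rewrite /newton /jherm /jcube /jsquare /jtrip jone_conj !jtriple_mid_one.
rewrite ![jform _ (jone K)]jformC !jform_one_jprod N jtriple_oneE.
by jform_expand; rewrite [jform X (jone K)]jformC [jform X (jcross X X)]jformC; field.
Qed.

(** A structure map taking [U] to the unit carries isotope powers to ordinary powers, preserves the
    pairings, and scales the norms of [U] and [X] alike. *)
Lemma newton_unitary U X : junitary U -> 6 * jnorm X =
  newton (jherm X U) (jherm (jsquare U X) U) (jherm (jcube U X) U) * jnorm U.
Proof.
move=> /junitary_one_transitive[g Sg gU].
have [chi [chi0 E]] := structure_norm Sg.
have E2 : g (jsquare U X) = jsquare (jone K) (g X).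
  by rewrite (structureZ Sg) -(structure_trip _ _ _ Sg) gU.
have E3 : g (jcube U X) = jcube (jone K) (g X).
  by rewrite (structureZ Sg) -(structure_trip _ _ _ Sg) gU E2.
rewrite -(structure_herm Sg X) -(structure_herm Sg (jsquare U X)).
rewrite -(structure_herm Sg (jcube U X)) gU E2 E3 -newton_one E.
have /eqP := E U; rewrite gU jone_norm eq_sym => /eqP chiU.
by rewrite -mulrA (mulrC _ (jnorm U)) -{1}[jnorm X]mul1r -chiU; ring.
Qed.

End NewtonIdentity.

Section UnitaryBiquaternionMatrices.
Variable R : realType.
Local Notation K := R[i].
Local Notation J := (albert K).
Local Notation A := 'M[quat R]_3.
Implicit Types (x y z u v w : A) (X Y Z U V : J) (k : K).

Lemma rel_inj X x y : rel X x -> rel X y -> x = y.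
Proof. by move=> Ex Ey; apply/matrixP => i j; apply: (@q2o_inj R); rewrite -Ex Ey. Qed.

Let half2 : qscal 2^-1 + qscal 2^-1 = 1 :> A.
Proof. by rewrite -qscalD -[RHS]qscal1; congr qscal; field. Qed.

Let halfD (T : nzRingType) (h x : T) : h + h = 1 -> h * (x + x) = x.
Proof. by move=> h2; rewrite mulrDr -mulrDl h2 mul1r. Qed.

Lemma rel_square U X u x : rel U u -> rel X x -> rel (jsquare U X) (x * qstar u * x).
Proof.
by move=> Eu Ex; have := rel_trip Ex Eu Ex; rewrite (halfD _ half2).
Qed.

Lemma rel_cube U X u x : rel U u -> rel X x ->
  rel (jcube U X) (x * qstar u * x * qstar u * x).
Proof.
move=> Eu Ex; have := rel_trip Ex Eu (rel_square Eu Ex).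
have E (T : nzRingType) (a b : T) : a * b * (a * b * a) = a * b * a * b * a.
  by rewrite !mulrA.
by rewrite E (halfD _ half2).
Qed.

(** Unitarity tested on [U] and on the unit gives [u * qstar u * u = u] and
    [u * qstar u + qstar u * u = 2], from which [special_inverse] concludes. *)
Lemma rel_unitary U u : junitary U -> rel U u -> u * qstar u = 1 /\ qstar u * u = 1.
Proof.
move=> HU Eu.
have E2 := rel_square Eu Eu; rewrite /jsquare HU scalerA mulVf ?scale1r ?pnatr_eq0 // in E2.
have {}E2 := rel_inj E2 Eu.
have E1 := rel_trip Eu Eu (rel_one R).
rewrite HU scalerA mulVf ?scale1r ?pnatr_eq0 // in E1.
have {}E1 := rel_inj E1 (rel_one R).
have L (T : nzRingType) (h a b : T) : h + h = 1 -> h * (a * b * 1 + 1 * b * a) = 1 ->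
    a * b + b * a = 1 + 1 /\ h * (1 + 1) = 1.
  move=> h2; rewrite mulr1 mul1r => E.
  split; last by rewrite mulrDr !mulr1.
  by rewrite -[LHS]mul1r -{1}h2 mulrDl E.
have [E3 h1] := L _ _ _ _ half2 E1.
exact: special_inverse h1 E3 E2.
Qed.

Lemma rel_newton U X u x : junitary U -> rel U u -> rel X x ->
  6 * jnorm X = newton (qtr (x * qstar u)) (qtr (x * qstar u * x * qstar u))
    (qtr (x * qstar u * x * qstar u * x * qstar u)) * jnorm U.
Proof.
move=> HU Eu Ex; rewrite (newton_unitary X HU) /jherm.
rewrite (rel_form Ex (rel_conj Eu)) (rel_form (rel_square Eu Ex) (rel_conj Eu)).
by rewrite (rel_form (rel_cube Eu Ex) (rel_conj Eu)).
Qed.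

End UnitaryBiquaternionMatrices.

(** * Uniqueness of the trace on biquaternion matrices *)

Section TraceUniqueness.
Variable R : realType.
Local Notation K := R[i].
Local Notation Q := (quat R).
Local Notation A := 'M[quat R]_3.
Implicit Types (x y : A) (k : K) (p q : Q) (i j : 'I_3).

Let unit_mx i j q : A := \matrix_(a, b) (if (a == i) && (b == j) then q else 0).

Let unit_mxM i j l p q : unit_mx i j p * unit_mx j l q = unit_mx i l (p * q).
Proof.
apply/matrixP => a b; rewrite -[unit_mx i j p * _]/(_ *m _) !mxE (bigD1 j) //= !mxE eqxx.
rewrite big1 ?addr0 => [|c cj]; last by rewrite !mxE (negPf cj) mulr0.
by rewrite andbT; case: eqP => //= _; rewrite ?mul0r //; case: eqP; rewrite ?mulr0.
Qed.

Let unit_mxM0 i j i' l p q : j != i' -> unit_mx i j p * unit_mx i' l q = 0.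
Proof.
move=> ji; apply/matrixP => a b; rewrite -[unit_mx i j p * _]/(_ *m _) !mxE big1 // => c _.
rewrite !mxE; case: (c =P j) => [->|_]; last by rewrite andbF mul0r.
by rewrite (negPf ji) mulr0.
Qed.

Let unit_mx_sum x : x = \sum_i \sum_j unit_mx i j (x i j).
Proof.
apply/matrixP => a b; rewrite summxE (bigD1 a) //= summxE (bigD1 b) //= mxE !eqxx.
rewrite big1 ?addr0 => [|j jb]; last by rewrite mxE eqxx eq_sym (negPf jb).
rewrite big1 ?addr0 // => i ia; rewrite summxE big1 // => j _.
by rewrite mxE eq_sym (negPf ia).
Qed.

Variable f : A -> K.
Hypotheses (fP : forall k x y, f (qscal k * x + y) = k * f x + f y)
  (fC : forall x y, f (x * y) = f (y * x)).

Let f0 : f 0 = 0.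
Proof. by have := fP (-1) 0 0; rewrite mulr0 addr0 mulN1r addNr. Qed.

Let fD x y : f (x + y) = f x + f y.
Proof. by have := fP 1 x y; rewrite qscal1 !mul1r. Qed.

Let f_sum (F : 'I_3 -> A) : f (\sum_i F i) = \sum_i f (F i).
Proof. by rewrite !big_ord3 !fD. Qed.

(** An off-diagonal matrix unit is a product of two matrix units whose product in the other order is
    zero. *)
Let f_off i j q : i != j -> f (unit_mx i j q) = 0.
Proof.
move=> ij; have {1}-> : q = 1 * q by rewrite mul1r.
by rewrite -(unit_mxM i i j) fC unit_mxM0 // eq_sym.
Qed.

Let f_diag i p q : f (unit_mx i i (p * q)) = f (unit_mx 0 0 (q * p)).
Proof. by rewrite -(unit_mxM i 0 i) fC unit_mxM. Qed.

Let g q := f (unit_mx 0 0 q).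

Let gP k p q : g ((cdscal 2 k : Q) * p + q) = k * g p + g q.
Proof.
rewrite /g -fP; congr f; apply/matrixP => a b; rewrite -cdmx_scaleE !mxE.
by case: ifP => _; rewrite quat_scal ?mulr0 ?addr0.
Qed.

Let gC p q : g (p * q) = g (q * p). Proof. exact: f_diag. Qed.

(** Each imaginary unit is the product of the other two in one order and minus that product in the
    other, so a functional with [gC] vanishes on it. *)
Let g_eq q : g q = (q : HC R).1.1 * g 1.
Proof.
pose e1 : Q := ((0, 1), (0, 0)) : HC R; pose e2 : Q := ((0, 0), (1, 0)) : HC R.
pose e3 : Q := ((0, 0), (0, 1)) : HC R.
have g0 : g 0 = 0 by have := gP (-1) 0 0; rewrite mulr0 addr0 mulN1r addNr.
have gN p : g (- p) = - g p.
  by have := gP (-1) p 0; rewrite addr0 g0 addr0 mulN1r => <-; congr g;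
    rewrite -quat_scal scaleN1r.
have z p : g p = - g p -> g p = 0.
  by move/eqP; rewrite -addr_eq0 -mulr2n mulrn_eq0 => /eqP.
have E1 : e1 = - (e2 * e3) by congr ((_, _), (_, _)); rewrite /=; ring.
have E1' : e3 * e2 = e1 by congr ((_, _), (_, _)); rewrite /=; ring.
have E2 : e2 = - (e3 * e1) by congr ((_, _), (_, _)); rewrite /=; ring.
have E2' : e1 * e3 = e2 by congr ((_, _), (_, _)); rewrite /=; ring.
have E3 : e3 = - (e1 * e2) by congr ((_, _), (_, _)); rewrite /=; ring.
have E3' : e2 * e1 = e3 by congr ((_, _), (_, _)); rewrite /=; ring.
have g1 : g e1 = 0 by apply: z; rewrite {1}E1 gN gC E1'.
have g2 : g e2 = 0 by apply: z; rewrite {1}E2 gN gC E2'.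
have g3 : g e3 = 0 by apply: z; rewrite {1}E3 gN gC E3'.
have {1}-> : q = (cdscal 2 (q : HC R).1.1 : Q) * 1 + ((cdscal 2 (q : HC R).1.2 : Q) * e1
    + ((cdscal 2 (q : HC R).2.1 : Q) * e2 + ((cdscal 2 (q : HC R).2.2 : Q) * e3 + 0))).
  by case: q => [[? ?] [? ?]]; congr ((_, _), (_, _)); rewrite /=; ring.
by rewrite !gP g1 g2 g3 g0 !mulr0 !addr0.
Qed.

Lemma trace_unique x : f 1 = 3 -> f x = qtr x.
Proof.
have D i q : f (unit_mx i i q) = (q : HC R).1.1 * g 1.
  by rewrite -{1}[q]mulr1 f_diag mul1r -/(g q) g_eq.
have E y : f y = qtr y * g 1.
  rewrite {1}[y]unit_mx_sum f_sum /qtr mulr_suml; apply: eq_bigr => i _.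
  rewrite f_sum (bigD1 i) //= D big1 ?addr0 // => j ji.
  by rewrite f_off // eq_sym.
rewrite !E.
have -> : qtr (1 : A) = 3 by rewrite /qtr big_ord3 !mxE /=; ring.
by rewrite -{2}[3]mulr1 => /(mulfI _) ->; rewrite ?mulr1 // pnatr_eq0.
Qed.

End TraceUniqueness.

(** * Isotope isomorphisms and the determinant over the biquaternions *)

Section Isotopes.
Variable R : realType.
Local Open Scope cd_scope.
Local Notation K := R[i].
Local Notation J := (albert K).
Local Notation A := 'M[quat R]_3.
Implicit Types (x y z u v w : A) (X Y Z U V : J) (k : K).

Lemma herm_rel x : herm R 2 3 (x : 'M[HC R]_3) -> exists X, rel X x.
Proof.
move=> hx; suff : C6 R (inclO (x : 'M[HC R]_3)).
  by move=> /C6P[X EX]; exists X; apply/relE.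
apply/matrixP => i j; rewrite !mxE -!q2o_incl o2c_dia q2o_dia; congr (o2c (q2o _)).
by rewrite -[in RHS]hx !mxE.
Qed.

Lemma rel_herm X x : rel X x -> qdia x = x.
Proof.
move=> Ex; apply/matrixP => i j; rewrite !mxE; apply: (@q2o_inj R).
rewrite -q2o_dia -!Ex; apply: (can_inj (@o2cK R)).
by have := congr1 (fun B : 'M_3 => B i j) (mkC6 X); rewrite !mxE o2c_dia.
Qed.

(** Since [u] is the unit of the isotope, [T u = 1], and [m -> T (m * u)] is multiplicative for the
    ordinary product. Its composition with [qtr] is therefore a trace with value 3 at the unit,
    hence equal to [qtr], whatever [T] is; Newton's identities turn this into a statement on
    norms. *)
Lemma isotope_dt3 U X u x (T : 'M[HC R]_3 -> 'M[HC R]_3) :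
  junitary U -> rel U u -> rel X x -> isotope_iso u T ->
  dt3 (T x) = cdscal 2 (jnorm X / jnorm U).
Proof.
move=> HU Eu Ex [Tbij TP TM _ Tdia].
have [uu' u'u] := rel_unitary HU Eu; set s := qstar u in uu' u'u.
have {}TP k (y z : A) : T (qscal k * y + z) = qscal k * (T y : A) + (T z : A).
  by rewrite -!cdmx_scaleE; exact: TP.
have {}TM (y z : A) : T (y * s * z) = (T y : A) * (T z : A).
  by have := TM y z; rewrite !cdmx_mulE; exact.
have Tu : T u = 1 :> A.
  have [T' TK T'K] := Tbij.
  have := TM u (T' (1 : A)); rewrite uu' mul1r T'K mulr1.
  by move=> <-.
have trT (z : A) : qtr (T z : A) = qtr (z * s).
  have f1 : qtr (T (1 * u) : A) = 3 by rewrite mul1r Tu /qtr big_ord3 !mxE /=; ring.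
  transitivity (qtr (T (z * s * u) : A)); first by rewrite -mulrA u'u mulr1.
  apply: (@trace_unique R (fun m => qtr (T (m * u) : A))) => //.
  - by move=> k y w; rewrite -qtrP -TP mulrDl mulrA.
  have M (y w : A) : T (y * w * u) = (T (y * u) : A) * (T (w * u) : A).
    by rewrite -TM -!mulrA (mulrA u s) uu' mul1r.
  by move=> y w; rewrite !M qtrC.
have hTx : herm R 2 3 (T x).
  by rewrite /herm /= -Tdia; congr T; exact: (rel_herm Ex).
have [Y EY] := @herm_rel (T x) hTx.
rewrite (rel_dt3 EY); congr (cdscal 2 _).
have N := rel_newton HU Eu Ex.
have := rel_newton (@junitary_one R) (rel_one R) EY.
rewrite jone_norm mulr1 qstar1 !mulr1.
have -> : (T x : A) * (T x : A) * (T x : A) = T (x * s * x * s * x).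
  by rewrite -TM -TM.
rewrite -TM !trT => NY.
apply: (@mulfI K 6); first by rewrite pnatr_eq0.
by rewrite NY mulrA N mulfK // jnorm_unitary_neq0.
Qed.

(** Newton interpolation: a new node is met by adding a multiple of the polynomial that vanishes at
    the old ones. Repetitions in [s] are allowed, as spectral values may coincide. *)
Lemma interpolation (F : K -> K) (s : seq K) : exists p : {poly K},
  forall a, a \in s -> p.[a] = F a.
Proof.
elim: s => [|b s [p Hp]]; first by exists 0.
have [bs|bs] := boolP (b \in s).
  by exists p => a; rewrite inE => /predU1P[->|]; exact: Hp.
pose q : {poly K} := \prod_(c <- s) ('X - c%:P).
have qb : q.[b] != 0.
  by rewrite -rootE root_prod_XsubC.
exists (p + ((F b - p.[b]) / q.[b]) *: q) => a; rewrite inE => /predU1P[->|sa].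
  by rewrite !hornerE divfK // addrC subrK.
by rewrite !hornerE Hp // (rootP (_ : root q a)) ?mulr0 ?addr0 // root_prod_XsubC.
Qed.

Lemma rel_horner X x s : rel X x -> exists y, rel (jhorner X s) y.
Proof.
move=> Ex; elim: s => [|c s [y Ey]] /=.
  exists 0 => i j; rewrite mxE; elim/ord3P: i; elim/ord3P: j;
    rewrite /jentry /= ?odia0 ?O8_scal //.
exists (qscal c * 1 + qscal 2^-1 * (y * x + x * y)); rewrite addrC.
exact: relD (rel_one R) (rel_jprod Ey Ex).
Qed.

(* A square root of a unitary [u] that is a polynomial in [u] again belongs to
   the hermitian biquaternionic matrices. *)
Lemma unitary_sqrt U u : junitary U -> rel U u ->
  exists V v, [/\ junitary V, rel V v & v * v = u].
Proof.
move=> HU Eu; have [a [w [a1 Hw]]] := unitary_rep_exists (@junitary_one R) HU.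
have [p pE] := interpolation (fun k : K => sqrtC k) [:: a 0; a 1; a 2].
have [v Ev] := rel_horner p Eu; exists (jhorner U p), v.
have pj j : p.[a j] = sqrtC (a j).
  by apply: pE; elim/ord3P: j; rewrite !inE eqxx ?orbT.
have HV := jrep_horner p Hw.
split=> //.
  have [g Ag [gV _]] := jrep_diag HV; have [h [Ah gK hK]] := jaut_inv Ag.
  rewrite -[jhorner U p]gK gV; apply: (junitary_structure Ah.1).
  by apply: junitary_diag1; rewrite -[horner_rec _ _]/(p.[_]) pj; exact: sqrtC_unit.
have [_ EVV] := jrep_mul HV HV.
have {}EVV : jprod (jhorner U p) (jhorner U p) = U.
  rewrite /jprod EVV; case: Hw => _ ->; apply: eq_bigr => j _.
  by rewrite -[horner_rec _ _]/(p.[_]) pj -expr2 sqrtCK.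
have := rel_jprod Ev Ev; rewrite EVV => /rel_inj/(_ Eu) <-.
have D (T : nzRingType) (h b : T) : h + h = 1 -> h * (b + b) = b.
  by move=> h2; rewrite mulrDr -mulrDl h2 mul1r.
by rewrite D // -qscalD -[RHS]qscal1; congr qscal; field.
Qed.

Lemma isotope_exists U u : junitary U -> rel U u -> exists T, isotope_iso u T.
Proof.
move=> HU Eu; have [V [v [HV Ev <-]]] := unitary_sqrt HU Eu.
have [vv' v'v] := rel_unitary HV Ev; set s := qstar v in vv' v'v.
(* Here [s] is the inverse of the square root [v], so the unit [v * v] of the isotope is sent to
   1. *)
exists (fun x : 'M[HC R]_3 => s * (x : A) * s : A); split.
- exists (fun x : 'M[HC R]_3 => v * (x : A) * v : A) => x.
    by rewrite !mulrA vv' mul1r -mulrA v'v mulr1.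
  by rewrite !mulrA v'v mul1r -mulrA vv' mulr1.
- by move=> k x y; rewrite !cdmx_scaleE mulrDr mulrDl !mulrA qscalC.
- move=> x y; rewrite -[cdmx_star _]/(qstar (v * v)) qstarM -/s !cdmx_mulE.
  by rewrite !mulrA.
- move=> x; rewrite !cdmx_mulE -[cdmx_star _ in LHS]/(qstar x) -[RHS]/(qstar (s * x * s)).
  rewrite !qstarM qstarK !mulrA v'v mul1r -!mulrA vv' mulr1 //.
move=> x; rewrite -[cdmx_dia x]/(qdia x) -[RHS]/(qdia (s * x * s)) !qdiaM.
have -> : qdia s = s by rewrite /s -qstar_dia (rel_herm Ev).
by rewrite mulrA.
Qed.

End Isotopes.

(** * Jordan automorphisms preserve the norm *)

Section JordanAutomorphisms.
Variable R : realType.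
Local Open Scope classical_set_scope.
Local Open Scope ring_scope.
Local Open Scope cd_scope.
Local Notation K := R[i].
Local Notation J := (albert K).
Local Notation M := 'M[OC R]_3.
Implicit Types (X Y Z U : J).

Lemma jprod_one X : jprod (jone K) X = X.
Proof.
rewrite /jprod jtriple_oneE jcross_one; have -> : jform (jone K) (jone K) = 3.
  by rewrite jform_one /=; ring.
by apply: jform_ext => Z; jform_expand; field.
Qed.

Lemma jtripE X Y Z : jtrip X Y Z = 2 *: (jprod (jprod X (jconj Y)) Z
  + jprod (jprod Z (jconj Y)) X - jprod (jprod X Z) (jconj Y)).
Proof. by rewrite jtriple_jprod scalerA divff ?scale1r // pnatr_eq0. Qed.

(** Spectral representations are transported with the same coefficients, and by [jrep_norm] the
    coefficients give the norm. Relative to the unit this settles unitaries; a general [X] is then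
    represented relative to a polar unitary, whose norm is already known to be preserved. *)
Lemma unital_iso_norm (f : J -> J) X : triple_iso f -> f (jone K) = jone K ->
  jnorm (f X) = jnorm X.
Proof.
move=> If f1.
have HU Y : junitary Y -> jnorm (f Y) = jnorm Y.
  move=> HY; have [a [v [_ Hv]]] := unitary_rep_exists (@junitary_one R) HY.
  rewrite (jrep_norm (@junitary_one R) Hv).
  have := iso_rep If Hv; rewrite f1 => /(jrep_norm (@junitary_one R)) ->.
  by [].
have [U [HUU HX]] := polar_exists X; have [a [v Hv]] := real_rep_exists HUU HX.
rewrite (jrep_norm HUU Hv) -(HU _ HUU).
exact: jrep_norm (iso_unitary If HUU) (iso_rep If Hv).
Qed.

(** The map [phi] is constrained on [C6 R] only, so it is replaced by the map that it induces on the
    Albert algebra. *)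
Lemma jordan_star_aut_iso (phi : M -> M) : jordan_star_aut phi ->
  exists f, [/\ triple_iso f, f (jone K) = jone K & forall X, phi (mk X) = mk (f X)].
Proof.
move=> [[Hfun Hinj Hsurj] HL HM HS]; pose f X := unmk (phi (mk X)).
have E X : phi (mk X) = mk (f X) by rewrite unmkK //; apply: Hfun; exact: mkC6.
have fL k X Y : f (k *: X + Y) = k *: f X + f Y.
  by apply: mk_inj; rewrite -E !mkP HL; [rewrite !E|exact: mkC6|exact: mkC6].
have fM X Y : f (jprod X Y) = jprod (f X) (f Y).
  by apply: mk_inj; rewrite -E -!mk_jmul HM; [rewrite !E|exact: mkC6|exact: mkC6].
have fS X : f (jconj X) = jconj (f X).
  by apply: mk_inj; rewrite -E -!mk_star HS; [rewrite E|exact: mkC6].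
have fI : injective f.
  move=> X Y XY; apply: mk_inj; apply: Hinj; rewrite ?inE; try exact: mkC6.
  by rewrite !E XY.
have fO Y : exists X, f X = Y.
  have [_ /C6P[X ->] XY] := Hsurj _ (mkC6 Y).
  by exists X; apply: mk_inj; rewrite -E.
have f0 : f 0 = 0.
  by have := fL (-1) 0 0; rewrite !scaler0 addr0 scaleN1r addNr.
have fD X Y : f (X + Y) = f X + f Y.
  by have := fL 1 X Y; rewrite !scale1r.
have fZ k X : f (k *: X) = k *: f X.
  by have := fL k X 0; rewrite !addr0 f0 addr0.
have fN X : f (- X) = - f X by rewrite -scaleN1r fZ scaleN1r.
exists f; split=> //.
  exists (fun Y => sval (cid (fO Y))); split=> //.
    by split=> X; [apply: fI|]; exact: (svalP (cid (fO _))).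
  move=> X Y Z; rewrite !jtripE fZ; congr (_ *: _).
  by rewrite !fD fN !fM !fS.
(* A preimage [X] of the unit suffices: the product of [f (jone K)] with [f X] is [f X] on the one
   hand and [f (jone K)] on the other. *)
have [X X1] := fO (jone K).
have C Y Z : jprod Y Z = jprod Z Y by rewrite /jprod jtriple_one_sym.
by rewrite -[LHS]jprod_one -{1}X1 C -fM jprod_one.
Qed.

End JordanAutomorphisms.

(** * Spectral representations and determinants in the Cartan factor of type 6 *)

Local Open Scope classical_set_scope.
Local Open Scope ring_scope.
Local Open Scope complex_scope.
Local Open Scope cd_scope.

Theorem theorem10p4 (R : realType) (x : 'M[OC R]_3) (hx : C6 R x) :
  (* (a) *)
  (exists u, unitary u /\ x = triple u x u) /\
  (* (b)(i) *)
  (forall u, unitary u -> x = triple u x u ->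
     exists (alpha : 'I_3 -> R) v, real_rep u x alpha v) /\
  (* (b)(ii) *)
  (forall u, unitary u -> x = triple u x u ->
     forall (alpha beta : 'I_3 -> R) v w,
       real_rep u x alpha v -> real_rep u x beta w ->
       (exists s : 'S_3, forall j, beta j = alpha (s j)) /\
       (forall a : R, \sum_(j | alpha j == a) v j = \sum_(j | beta j == a) w j)) /\
  (* (c) *)
  (forall u, unitary u -> x = triple u x u ->
     forall (alpha : 'I_3 -> R) v, real_rep u x alpha v ->
       dtR u x = \prod_j (alpha j)%:C /\
       (unitary x -> dtR u x = dtU u x) /\
       (forall x' u' : 'M[HC R]_3, herm R 2 3 x' -> herm R 2 3 u' ->
          x = inclO x' -> u = inclO u' ->
          is_dt3e u' x' (cdscal 2 (dtR u x)))) /\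
  (* (d) *)
  (forall u w, unitary u -> x = triple u x u ->
     unitary w -> x = triple w x w ->
     dtR u x * dtU cdmx_one u = dtR w x * dtU cdmx_one w) /\
  (forall u, unitary u -> x = triple u x u ->
     dt x = dtR u x * dtU cdmx_one u) /\
  (unitary x -> dt x = dtU cdmx_one x) /\
  (forall x' : 'M[HC R]_3, herm R 2 3 x' -> x = inclO x' ->
     cdscal 2 (dt x) = dt3 x') /\
  (* (e) *)
  (forall phi, jordan_star_aut phi -> dt (phi x) = dt x).
Proof.
have [X {hx}->] := C6P hx.
have U_of u : unitary u -> exists2 U, u = mk U & junitary U.
  by move=> Hu; have [U EU] := C6P Hu.1; exists U => //; apply/unitaryP; rewrite -EU.
have polarP U : mk X = triple (mk U) (mk X) (mk U) <-> jtrip U X U = 2 *: X.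
  by split=> [/esym/triple_mkP|/triple_mkP ->].
have injC (a b : R) : (a%:C == b%:C) = (a == b) by rewrite (inj_eq (@complexI R)).
split.
  have [U [HU HX]] := polar_exists X.
  by exists (mk U); split; [exact/unitaryP|exact/polarP].
split.
  move=> _ /U_of[U -> HU] /polarP HX; have [a [v Hv]] := real_rep_exists HU HX.
  by exists a, (@mk R \o v); apply/real_repP.
split.
  move=> _ /U_of[U -> HU] _ alpha beta w1 w2 H1 H2.
  have [v1 E1] := frame_below_mk H1.1; have [v2 E2] := frame_below_mk H2.1.
  move: H1 H2; rewrite E1 E2 => /real_repP H1 /real_repP H2.
  have [[s sE] Hs] := jrep_unique HU H1 H2; split=> [|a].
    by exists s => j; apply: (@complexI R).
  have mk_sum_if (P : pred 'I_3) v : mk (\sum_(j | P j) v j) = \sum_(j | P j) mk (v j).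
    by rewrite big_mkcond [RHS]big_mkcond !big_ord3 !mkD; do 3! case: ifP; rewrite ?mk0.
  have := congr1 (@mk R) (Hs a%:C); rewrite !mk_sum_if.
  by under eq_bigl do rewrite injC; under [X in _ = X]eq_bigl do rewrite injC.
split.
  move=> _ /U_of[U -> HU] /polarP HX alpha w Hw.
  rewrite (dtR_jnorm HU HX) (dtR_rep HU Hw); split=> //; split.
    by move=> /unitaryP HX'; rewrite dtU_jnorm.
  move=> x' u' _ _ /relE Ex /relE Eu; split; first exact: isotope_exists HU Eu.
  by move=> T HT; exact: isotope_dt3 HU Eu Ex HT.
split.
  move=> _ _ /U_of[U -> HU] /polarP HX /U_of[W -> HW] /polarP HX'.
  by transitivity (jnorm X); [exact: dt_factor|apply: esym; exact: dt_factor].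
split.
  by move=> _ /U_of[U -> HU] /polarP HX; rewrite dt_jnorm; apply: esym; exact: dt_factor.
split.
  move=> /unitaryP HX.
  by rewrite dt_jnorm dtU_one.
split.
  by move=> x' _ /relE Ex; rewrite dt_jnorm (rel_dt3 Ex).
move=> phi /jordan_star_aut_iso[f [If f1 ->]].
by rewrite !dt_jnorm unital_iso_norm.
Qed.
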